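(* (Sign coherence of $c$-vectors.) Let $\Gamma$ be fixed data and $\mathbf s$ a seed. For any vertex $w$ of $\mathfrak T_{\mathbf s}$ and fixed $k$ satisfying $1\le k\le n$, either the entries $\tilde\epsilon^w_{k,j}$, $n+1\le j\le2n$, are all non-positive, or these entries are all non-negative.
   Context: $[a]_+=\max(a,0)$. FIXED DATA $\Gamma$: a lattice $N$ of rank $n$ with a skew-symmetric form $\{\cdot,\cdot\}:N\times N\to\mathbb Q$; a saturated sublattice $N_{uf}\subseteq N$; $I=\{1,\dots,n\}\supseteq I_{uf}$ with $|I_{uf}|=\operatorname{rank}N_{uf}$; positive integers $d_i$ ($i\in I$) with gcd $1$; a finite-index sublattice $N^\circ\subseteq N$ with $\{N_{uf},N^\circ\}\subseteq\mathbb Z$ and $\{N,N_{uf}\cap N^\circ\}\subseteq\mathbb Z$. $M^\circ=\operatorname{Hom}(N^\circ,\mathbb Z)$. A seed is a basis $\mathbf s=(e_i)_{i\in I}$ of $N$ with $(e_i)_{i\in I_{uf}}$ a basis of $N_{uf}$ and $(d_ie_i)_{i\in I}$ a basis of $N^\circ$; $f_i=d_i^{-1}e_i^*$, a basis of $M^\circ$; it is assumed that $\{e_i,\cdot\}\ne0$ for $i\in I_{uf}$. Principal data: $\tilde N=N\oplus M^\circ$ with $\{(n_1,m_1),(n_2,m_2)\}=\{n_1,n_2\}+\langle n_1,m_2\rangle-\langle n_2,m_1\rangle$, and $\tilde{\mathbf s}=((e_1,0),\dots,(e_n,0),(0,f_1),\dots,(0,f_n))$, a basis of $\tilde N$. For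 a basis $(\tilde e_1,\dots,\tilde e_{2n})$, mutation at $k\in I_{uf}\subseteq\{1,\dots,n\}$ gives $\tilde e_k'=-\tilde e_k$, $\tilde e_i'=\tilde e_i+[\{\tilde e_i,\tilde e_k\}d_k]_+\tilde e_k$ for $i\neq k$, $1\le i\le2n$. $\mathfrak T_{\mathbf s}$ is the infinite rooted tree with $|I_{uf}|$ outgoing edges labelled by $I_{uf}$ at each vertex; for a vertex $w$, $\tilde{\mathbf s}_w=(\tilde e_1,\dots,\tilde e_{2n})$ is obtained from $\tilde{\mathbf s}$ by the sequence of mutations along the path from the root to $w$. The $n\times2n$ exchange matrix is $$\tilde\epsilon^w_{ij}=\begin{cases}\{\tilde e_i,\tilde e_j\}d_j&1\le j\le n,\\ \{\tilde e_i,\tilde e_j\}d_{j-n}&n+1\le j\le2n,\end{cases}\qquad 1\le i\le n.$$ The $c$-vectors are the rows of its right-hand $n\times n$ block. *)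

(* Defs.v *)
From HB Require Import structures.
From mathcomp Require Import all_boot all_order all_algebra ring lra.

Set Implicit Arguments.
Unset Strict Implicit.
Unset Printing Implicit Defensive.

Import Order.TTheory GRing.Theory Num.Theory.
Local Open Scope ring_scope.

(* A lattice is a [vectType int], i.e., a Z-module linearly isomorphic to Z^r,
   and its rank r is [dim]; a sublattice is given by an injective map.  The index set {1, ..., n} is
   'I_n, and {1, ..., 2n} is 'I_(n + n), with [lshift n i] standing for i and
   [rshift n i] for n + i. *)

Record sublattice (N : vectType int) := Sublattice {
  sub_sort :> vectType int;
  incl : {linear sub_sort -> N};
  incl_inj : injective incl
}.

Definition saturated (N : vectType int) (S : sublattice N) : Prop :=
  forall (x : N) (m : nat), (0 < m)%N ->
    (exists u : S, x *+ m = incl S u) -> exists u : S, x = incl S u.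

Definition finite_index (N : vectType int) (S : sublattice N) : Prop :=
  exists r : seq N, forall x : N,
    exists2 y, y \in r & exists u : S, x - y = incl S u.

Definition Zbasis (I : finType) (L : vectType int) (b : I -> L) : Prop :=
  forall x : L, exists! a : {ffun I -> int}, x = \sum_i a i *: b i.

Definition sub_Zbasis (I : finType) (N : vectType int) (S : sublattice N)
    (b : I -> N) : Prop :=
  exists2 c : I -> S, Zbasis c & forall i, incl S (c i) = b i.

Record fixed_data (n : nat) := FixedData {
  latN : vectType int;
  latN_rank : dim latN = n;
  form : latN -> latN -> rat;
  form_addl : forall x y z, form (x + y) z = form x z + form y z;
  form_skew : forall x y, form x y = - form y x;
  latNuf : sublattice latN;
  latNuf_saturated : saturated latNuf;
  Iuf : {set 'I_n};
  Iuf_card : #|Iuf| = dim latNuf;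
  dd : 'I_n -> nat;
  dd_gt0 : forall i, (0 < dd i)%N;
  dd_gcd : \big[gcdn/0%N]_(i < n) dd i = 1%N;
  latNo : sublattice latN;
  latNo_index : finite_index latNo;
  form_uf_o : forall (u : latNuf) (v : latNo),
    form (incl _ u) (incl _ v) \is a Num.int;
  form_N_ufo : forall (x : latN) (u : latNuf) (v : latNo),
    incl _ u = incl _ v -> form x (incl _ v) \is a Num.int
}.

Record seed (n : nat) (G : fixed_data n) := Seed {
  seed_vec :> 'I_n -> latN G;
  seed_basis : Zbasis seed_vec;
  seed_basis_uf :
    sub_Zbasis (latNuf G) (fun i : {i | i \in Iuf G} => seed_vec (val i));
  seed_basis_o : sub_Zbasis (latNo G) (fun i => seed_vec i *+ dd G i);
  seed_nondeg : forall i, i \in Iuf G -> exists x, form (seed_vec i) x != 0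
}.

Section Coordinates.
Context (I : finType) (L : vectType int) (b : I -> L) (bP : Zbasis b).

Lemma Zcoord_subproof x : exists a : {ffun I -> int}, x == \sum_i a i *: b i.
Proof. by case: (bP x) => a [/eqP ? _]; exists a. Qed.

(* [Zcoord bP i] is the dual basis vector b_i^*. *)
Definition Zcoord (i : I) (x : L) : int := xchoose (Zcoord_subproof x) i.

Lemma Zcoord_eq (a : {ffun I -> int}) i : Zcoord i (\sum_j a j *: b j) = a i.
Proof.
set x := \sum_j _; case: (bP x) => a0 [_ a0u].
rewrite -(a0u a) // /Zcoord; congr (fun_of_fin _ _); apply/esym/a0u/eqP.
exact: (xchooseP (Zcoord_subproof x)).
Qed.

End Coordinates.

Lemma finite_index_multiple (N : vectType int) (S : sublattice N) :
  finite_index S -> forall x : N,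
  exists p : nat * S, (0 < p.1)%N && (incl S p.2 == x *+ p.1).
Proof.
case=> r rP x.
have /fin_all_exists2[y yr /fin_all_exists[z zP]] (i : 'I_(size r).+1) :
  exists2 y, y \in r & exists u : S, x *+ i - y = incl S u by exact: rP.
have [i [j [lt_ij eq_y]]] : exists i j : 'I_(size r).+1, (i < j)%N /\ y i = y j.
  have /injectivePn[i [j ne_ij eq_y]] : ~~ injectiveb y.
    apply/negP => y_inj.
    suff: (size (codom y) <= size r)%N by rewrite size_codom card_ord ltnn.
    by apply: uniq_leq_size => // _ /codomP[i ->].
  case: (ltngtP i j) ne_ij => [lt|lt|/val_inj->]; last by rewrite eqxx.
    by exists i, j.
  by exists j, i.
exists ((j - i)%N, z j - z i); rewrite subn_gt0 lt_ij /= raddfB /= -!zP eq_y.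
by apply/eqP; rewrite opprD opprK addrACA addNr addr0 (mulrnBr x (ltnW lt_ij)).
Qed.

Section PrincipalData.
Context (n : nat) (G : fixed_data n).

Definition Mo := 'Hom(latNo G, int^o).

(* The pairing N x M^o -> Q: M^o lies in Hom(N, Q) because some positive
   multiple x *+ p.1 = incl p.2 of x lies in N^o. *)
Definition pairing (x : latN G) (m : Mo) : rat :=
  let p := xchoose (finite_index_multiple (latNo_index G) x) in
  (m p.2 : int)%:~R / p.1%:R.

Lemma pairingE (x : latN G) (m : Mo) (D : nat) (u : latNo G) :
  (0 < D)%N -> incl _ u = x *+ D -> pairing x m = (m u : int)%:~R / D%:R.
Proof.
move=> D0 uE; rewrite /pairing.
have /andP[] := xchooseP (finite_index_multiple (latNo_index G) x).
case: (xchoose _) => E v /= E0 /eqP vE.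
have eq_uv : u *+ E = v *+ D.
  by apply: (@incl_inj _ (latNo G)); rewrite !raddfMn /= uE vE -!mulrnA mulnC.
apply/eqP; rewrite eqr_div ?pnatr_eq0 -?lt0n //.
rewrite !mulr_natr -!rmorphMn /=; apply/eqP; congr (_%:~R).
by rewrite -[LHS](raddfMn m) -[RHS](raddfMn m) eq_uv.
Qed.

Definition latNt : Type := (latN G * Mo)%type.
HB.instance Definition _ := Vector.on latNt.

Definition tform (x y : latNt) : rat :=
  form x.1 y.1 + pairing x.1 y.2 - pairing y.1 x.2.

Definition dual_fun (s : seed G) (i : 'I_n) (u : latNo G) : int^o :=
  (Zcoord (seed_basis s) i (incl _ u) %/ (dd G i)%:Z)%Z.

(* f_i = d_i^-1 e_i^*, as an element of M^o; the division is exact and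
   [dual_fun s i] is linear, see [f_vecE] below. *)
Definition f_vec (s : seed G) (i : 'I_n) : Mo := linfun (dual_fun s i).

Lemma dual_funE (s : seed G) (c : 'I_n -> latNo G) (a : {ffun 'I_n -> int}) i :
    (forall j, incl _ (c j) = s j *+ dd G j) ->
  dual_fun s i (\sum_j a j *: c j) = a i.
Proof.
move=> cE; rewrite /dual_fun linear_sum /=.
have -> : \sum_j incl (latNo G) (a j *: c j)
  = \sum_j [ffun j => a j * (dd G j)%:Z] j *: s j.
  by apply: eq_bigr => j _; rewrite linearZ /= cE ffunE -scaler_nat scalerA natz.
by rewrite Zcoord_eq ffunE mulzK // eqz_nat -lt0n dd_gt0.
Qed.

Lemma dual_fun_linear (s : seed G) i : linear (dual_fun s i).
Proof.
have [c cP cE] := seed_basis_o s; move=> z u v.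
have [[a [-> _]] [b [-> _]]] := (cP u, cP v).
have -> : z *: (\sum_j a j *: c j) + \sum_j b j *: c j
    = \sum_j [ffun j => z * a j + b j] j *: c j.
  rewrite scaler_sumr -big_split; apply: eq_bigr => j _ /=.
  by rewrite ffunE scalerDl scalerA.
by rewrite !dual_funE // ffunE.
Qed.

Lemma f_vecE (s : seed G) i (u : latNo G) :
  (f_vec s i u : int)%:~R * (dd G i)%:R
    = (Zcoord (seed_basis s) i (incl _ u))%:~R :> rat.
Proof.
pose F := GRing.isLinear.Build _ _ _ _ (dual_fun s i) (dual_fun_linear s i).
pose f : {linear _ -> _} := HB.pack (dual_fun s i) F.
rewrite /f_vec (lfunE f) /= /dual_fun.
have [c cP cE] := seed_basis_o s; have [a [-> _]] := cP u.
have -> : incl (latNo G) (\sum_j a j *: c j)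
  = \sum_j [ffun j => a j * (dd G j)%:Z] j *: s j.
  rewrite linear_sum /=; apply: eq_bigr => j _.
  by rewrite linearZ /= cE ffunE -scaler_nat scalerA natz.
rewrite Zcoord_eq ffunE mulzK ?eqz_nat -?lt0n ?dd_gt0 //.
by rewrite rmorphM.
Qed.

Definition tilde_seed (s : seed G) (i : 'I_(n + n)) : latNt :=
  match split i with
  | inl j => (s j, 0)
  | inr j => (0, f_vec s j)
  end.

(* The scalar [{e_i, e_k} d_k]_+ is an integer along every sequence of
   mutations (see [tilde_form_int]), so taking the floor only reads this
   rational number as an integer. *)
Definition mutation (k : 'I_n) (e : 'I_(n + n) -> latNt) (i : 'I_(n + n)) :
    latNt :=
  let ek := e (lshift n k) in
  if i == lshift n k then - ek
  else e i + Num.floor (Num.max (tform (e i) ek * (dd G k)%:R) 0) *: ek.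

(* A vertex of the rooted tree is the word of edge labels read along the path
   from the root. *)
Definition vertex := seq {k : 'I_n | k \in Iuf G}.

Definition tilde_seed_at (s : seed G) (w : vertex) : 'I_(n + n) -> latNt :=
  foldl (fun e k => mutation (val k) e) (tilde_seed s) w.

Definition exchange_matrix (s : seed G) (w : vertex) : 'M[rat]_(n, n + n) :=
  \matrix_(i < n, j < n + n)
    (tform (tilde_seed_at s w (lshift n i)) (tilde_seed_at s w j)
     * match split j with inl j' => (dd G j')%:R | inr j' => (dd G j')%:R end).

Lemma pairing_seed (s : seed G) (i j : 'I_n) :
  pairing (s j) (f_vec s i) * (dd G j)%:R = (i == j)%:R.
Proof.
have [c _ cE] := seed_basis_o s.
have d0 k : (dd G k)%:R != 0 :> rat by rewrite pnatr_eq0 -lt0n dd_gt0.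
rewrite (pairingE _ (dd_gt0 G j) (cE j)) divfK //.
apply: (mulIf (d0 i)); rewrite f_vecE cE.
have -> : s j *+ dd G j = \sum_k [ffun k => (dd G j)%:Z *+ (k == j)] k *: s k.
  rewrite (bigD1 j) //= big1 => [|k /negPf nkj]; rewrite ffunE ?nkj ?scale0r //.
  by rewrite eqxx addr0 -scaler_nat natz.
by rewrite Zcoord_eq ffunE; case: eqP => [->|_]; rewrite ?mul1r ?mul0r.
Qed.

Lemma pairingBl (x y : latN G) (m : Mo) :
  pairing (x - y) m = pairing x m - pairing y m.
Proof.
have [[D u] /= /andP[D0 /eqP uE]] := finite_index_multiple (latNo_index G) x.
have [[E v] /= /andP[E0 /eqP vE]] := finite_index_multiple (latNo_index G) y.
have uEE : incl _ (u *+ E) = x *+ (D * E) by rewrite raddfMn /= uE mulrnA.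
have vDE : incl _ (v *+ D) = y *+ (D * E).
  by rewrite raddfMn /= vE mulnC mulrnA.
have uvE : incl _ (u *+ E - v *+ D) = (x - y) *+ (D * E).
  by rewrite raddfB /= uEE vDE mulrnBl.
have DE0 : (0 < D * E)%N by rewrite muln_gt0 D0.
rewrite (pairingE m DE0 uEE) (pairingE m DE0 vDE) (pairingE m DE0 uvE).
by rewrite -mulrBl -rmorphB; congr (_%:~R / _); exact: (raddfB m).
Qed.

Lemma pairingBr (x : latN G) (m1 m2 : Mo) :
  pairing x (m1 - m2) = pairing x m1 - pairing x m2.
Proof.
have [[D u] /= /andP[D0 /eqP uE]] := finite_index_multiple (latNo_index G) x.
rewrite !(pairingE _ D0 uE) -mulrBl -rmorphB; congr (_%:~R / _).
by rewrite add_lfunE opp_lfunE.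
Qed.

Lemma tform_skew x y : tform x y = - tform y x.
Proof. by rewrite /tform form_skew; ring. Qed.

Lemma form_subl (x y z : latN G) : form (x - y) z = form x z - form y z.
Proof. by apply/eqP; rewrite eq_sym subr_eq -form_addl subrK. Qed.

Lemma tform_subl z : zmod_morphism (tform^~ z).
Proof.
by move=> x y /=; rewrite /tform /= form_subl pairingBl pairingBr; ring.
Qed.

Lemma tform_lin (a : int) x y z :
  tform (x + a *: y) z = tform x z + a%:~R * tform y z.
Proof.
pose F := GRing.isZmodMorphism.Build _ _ (tform^~ z) (tform_subl z).
pose f : {additive _ -> _} := HB.pack (tform^~ z) F.
rewrite -[tform _ z]/(f _) -[tform x z]/(f x) -[tform y z]/(f y).
by rewrite raddfD -[a in a *: y]intz scaler_int raddfMz mulrzl.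
Qed.

Lemma tilde_form_int (s : seed G) (w : vertex) (i : 'I_(n + n)) (k : 'I_n) :
    k \in Iuf G ->
  tform (tilde_seed_at s w i) (tilde_seed_at s w (lshift n k)) * (dd G k)%:R
    \is a Num.int.
Proof.
rewrite /tilde_seed_at; pose P e := forall i (k : 'I_n), k \in Iuf G ->
  tform (e i) (e (lshift n k)) * (dd G k)%:R \is a Num.int.
suff: P (foldl (fun e k => mutation (val k) e) (tilde_seed s) w) by apply.
have: P (tilde_seed s).
  have [[cu _ cuE] [co _ coE]] := (seed_basis_uf s, seed_basis_o s).
  have p0 x : pairing x 0 = 0 by rewrite -(subrr 0) pairingBr subrr.
  have f0 x : form (0 : latN G) x = 0 by rewrite -(subrr 0) form_subl subrr.
  move=> {}i {}k kuf; rewrite /tilde_seed.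
  rewrite (unsplitK (inl k : 'I_n + 'I_n)%type).
  case: (split i) => j; rewrite /tform /= !p0 ?f0 ?addr0 ?subr0 ?add0r.
    have -> : form (s j) (s k) * (dd G k)%:R = form (s j) (s k *+ dd G k).
      rewrite form_skew [RHS]form_skew mulNr; congr (- _).
      elim: (dd G k) => [|d IHd]; first by rewrite mulr0 mulr0n f0.
      by rewrite mulrSr mulrDr mulr1 IHd mulrSr form_addl.
    rewrite -coE; apply: (@form_N_ufo _ G _ (cu (exist _ k kuf) *+ dd G k)).
    by rewrite raddfMn /= cuE coE.
  by rewrite mulNr pairing_seed rpredN rpred_nat.
elim: w (tilde_seed s) => //= -[l luf] w IHw e eP; apply: IHw => {}i {}k kuf /=.
pose c i : int := if i == lshift n l then - 2 else
  Num.floor (Num.max (tform (e i) (e (lshift n l)) * (dd G l)%:R) 0).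
have mE j : mutation l e j = e j + c j *: e (lshift n l).
  rewrite /mutation /c; case: eqP => // ->.
  by rewrite scaleNr scaler_nat mulr2n opprD addrA subrr add0r.
have ll0 x : tform x x = 0 by move: (tform_skew x x); lra.
have tform_linr (a : int) x y z :
    tform z (x + a *: y) = tform z x + a%:~R * tform z y.
  by rewrite tform_skew tform_lin opprD -mulrN -!(tform_skew z).
rewrite !mE tform_lin !tform_linr ll0 mulr0 addr0.
set ik := tform (e i) _; set il := tform (e i) _; set lk := tform _ _.
have -> : (ik + (c (lshift n k))%:~R * il + (c i)%:~R * lk) * (dd G k)%:R
   = ik * (dd G k)%:R + (c i)%:~R * (lk * (dd G k)%:R)
     + (c (lshift n k))%:~R * il * (dd G k)%:R by ring.
apply: rpredD.
  by apply: rpredD; [|apply: rpredM; rewrite ?intr_int //]; apply: eP.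
rewrite /c; case: eqP => [/lshift_inj kl|_].
  by rewrite -mulrA rpredM ?intr_int // /il -kl eP.
case: leP => [_|_]; first by rewrite floor0 !mul0r rpred0.
rewrite floorK ?eP // tform_skew -/lk.
have -> : - lk * (dd G l)%:R * il * (dd G k)%:R
  = - ((lk * (dd G k)%:R) * (il * (dd G l)%:R)) by ring.
by rewrite rpredN rpredM ?eP.
Qed.

End PrincipalData.

(* Main.v *)
Require Import Defs.
From mathcomp Require Import all_boot all_order all_algebra ring lra zify.
From Stdlib Require Import FunctionalExtensionality.

(* The proof replaces the scattering diagram of Gross, Hacking, Keel and
   Kontsevich by an element of a pronilpotent group of quantum torus series.
   For a skew form [L] on Z^n, a series with constant term 1 factors uniquely,
   for every linear functional [th], into a part supported on [th >= 0] and a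
   part supported on [th < 0]; the restriction of the first part to [th = 0] is
   the wall function at [th].  There is a series [g] such that the wall function
   at [L x] has no logarithmic coefficient in degree [x] (no incoming walls)
   except on the coordinate axes, where [g] is a quantum dilogarithm.  Such
   series are compatible with mutation at [k]: the two quotients of [g] by the
   dilogarithm of [e_k] are supported in the two cones on which the two
   piecewise linear branches of the mutation make sense, because the commutation
   relation with the dilogarithm is, on each line of direction [e_k],
   multiplication by a palindromic polynomial.  Hence the walls of the mutated
   seed are the images of those of the initial one.  Following a path of the
   tree, the positive orthant is sent to a chamber without walls in its
   interior, the facets of which carry dilogarithms in the c-vectors; since [g]
   is supported on the nonnegative orthant, each c-vector is nonnegative or
   nonpositive. *)

Set Implicit Arguments.
Unset Strict Implicit.
Unset Printing Implicit Defensive.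

Import Order.TTheory GRing.Theory Num.Theory.
Local Open Scope ring_scope.

(** * Series on the quantum torus *)

(** Walls are attached to all additive functionals [th], not only to those of the form [L x],
    because [L] may be degenerate; the c-vectors then live in Z^n, starting from the unit vectors.
    The obstacle is that a path grows at its far end, whereas the comparison of walls under mutation
    changes the root. The induction is therefore on the length of the path, for all forms at once:
    the c-vectors along [k :: w] are images of those along [w] for the mutated root under one of two
    reflections. The choice depends on the side of the hyperplane of [e_k] on which the chamber
    lies; it makes sense because the wall of normal [e_k] is nontrivial on that entire hyperplane
    and so cannot cut a chamber. Logarithms are never formed: logarithmic derivatives replace them.
    The multipliers [d_i] enter by clearing denominators: the form times [scale] is integral, and
    [e_k] carries the dilogarithm whose parameter is 2 to the power [scale / d_k]. *)

Lemma big_uniq_supp (T : eqType) (r1 r2 : seq T) (F : T -> rat) :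
    uniq r1 -> uniq r2 ->
    (forall a, F a != 0 -> (a \in r1) = (a \in r2)) ->
  \sum_(a <- r1) F a = \sum_(a <- r2) F a.
Proof.
move=> u1 u2 e12.
rewrite (bigID [pred a | F a == 0]) /= big1 ?add0r; last by move=> a /eqP.
rewrite [RHS](bigID [pred a | F a == 0]) /= [X in _ = X + _]big1 ?add0r;
  last by move=> a /eqP.
rewrite -[LHS]big_filter -[RHS]big_filter; apply: perm_big.
apply: uniq_perm; rewrite ?filter_uniq // => a; rewrite !mem_filter.
by case: eqP => //= /eqP; apply: e12.
Qed.

Section Vectors.
Context (n : nat).
Implicit Types x y z : 'rV[int]_n.

Definition vpos x : bool := [forall i, 0 <= x 0 i].
Definition vdeg x : int := \sum_i x 0 i.
Definition unitv (i : 'I_n) : 'rV[int]_n := delta_mx 0 i.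

Lemma vposP x : reflect (forall i, 0 <= x 0 i) (vpos x).
Proof. exact: forallP. Qed.

Lemma vpos0 : vpos 0.
Proof. by apply/vposP => i; rewrite mxE. Qed.

Lemma vposD x y : vpos x -> vpos y -> vpos (x + y).
Proof. by move=> /vposP xp /vposP yp; apply/vposP => i; rewrite mxE addr_ge0. Qed.

Lemma vpos_anti x : vpos x -> vpos (- x) -> x = 0.
Proof.
move=> /vposP xp /vposP nxp; apply/rowP => i; have := nxp i; rewrite !mxE => h.
by apply/eqP; rewrite eq_le xp -oppr_ge0 h.
Qed.

Lemma vpos_unitv i : vpos (unitv i).
Proof. by apply/vposP => j; rewrite mxE; case: (_ && _). Qed.

Lemma unitvE i j : unitv i 0 j = (i == j)%:R.
Proof. by rewrite mxE eqxx eq_sym. Qed.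

Lemma unitv_neq0 i : unitv i != 0.
Proof. by apply/eqP => /rowP/(_ i); rewrite unitvE eqxx mxE. Qed.

Lemma vpos_scale (c : int) x : 0 <= c -> vpos x -> vpos (c *: x).
Proof. by move=> c0 /vposP xp; apply/vposP => i; rewrite mxE mulr_ge0. Qed.

Lemma row_unitv x : x = \sum_i x 0 i *: unitv i.
Proof. exact: row_sum_delta. Qed.

Lemma vdegD x y : vdeg (x + y) = vdeg x + vdeg y.
Proof. by rewrite /vdeg -big_split; apply: eq_bigr => i _; rewrite mxE. Qed.

Lemma vdeg0 : vdeg 0 = 0.
Proof. by rewrite /vdeg big1 // => i _; rewrite mxE. Qed.

Lemma vdeg_ge0 x : vpos x -> 0 <= vdeg x.
Proof. by move=> /vposP xp; apply: sumr_ge0 => i _; apply: xp. Qed.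

Lemma vdeg_gt0 x : vpos x -> x != 0 -> 0 < vdeg x.
Proof.
move=> xp; apply: contraR; rewrite -leNgt => dx; apply/eqP/rowP => i; rewrite mxE.
have /eqP : vdeg x = 0 by apply/eqP; rewrite eq_le dx vdeg_ge0.
rewrite psumr_eq0; last by move=> j _; apply/vposP.
by move/allP/(_ i); rewrite mem_index_enum => /(_ isT) /eqP.
Qed.

(** The degrees [a] with [0 <= a <= x] coordinatewise, found among vectors with coordinates at most
    [|vdeg x|]; none unless [x] is nonnegative. *)
Definition box x : seq 'rV[int]_n :=
  [seq a <- undup (codom (fun f : {ffun 'I_n -> 'I_(absz (vdeg x)).+1} =>
                     \row_i (f i : nat)%:Z)) | vpos (x - a)].

Lemma mem_box x a : (a \in box x) = vpos a && vpos (x - a).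
Proof.
rewrite mem_filter mem_undup andbC; case: (boolP (vpos (x - a))) => [xap|];
  last by rewrite !andbF.
rewrite !andbT; apply/codomP/idP => [[f ->]|ap].
  by apply/vposP => i; rewrite mxE.
have bnd i : (absz (a 0%R i) < (absz (vdeg x)).+1)%N.
  have /vposP/(_ i) ai := ap.
  have aE : a 0 i <= vdeg a.
    rewrite /vdeg (bigD1 i) //= lerDl; apply: sumr_ge0 => j _; exact/vposP.
  have xE : vdeg x = vdeg (x - a) + vdeg a by rewrite -vdegD subrK.
  have := vdeg_ge0 xap;
    move: (a 0 i) (vdeg a) (vdeg x) (vdeg (x - a)) ai aE xE => p q r s. lia.
exists [ffun i => Ordinal (bnd i)].
by apply/rowP => i; rewrite !mxE ffunE /= gez0_abs //; apply/vposP.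
Qed.

Lemma box_uniq x : uniq (box x).
Proof. by rewrite filter_uniq // undup_uniq. Qed.

Lemma box_pos x a : a \in box x -> vpos x.
Proof. by rewrite mem_box => /andP[ap xap]; rewrite -(subrK a x) vposD. Qed.

Lemma vposB_trans a c x : vpos (a - c) -> vpos (x - a) -> vpos (x - c).
Proof. by move=> ac xa; have -> : x - c = (x - a) + (a - c);
  [rewrite addrA subrK|rewrite vposD]. Qed.

End Vectors.

Arguments vpos {n}.
Arguments vdeg {n}.

(* The number 2 stands for the quantum parameter: all that matters is that it
   is not a root of unity. *)
Definition qpow (m : int) : rat := 2%:R ^ m.

Lemma qpowD a b : qpow (a + b) = qpow a * qpow b.
Proof. exact: expfzDr. Qed.
Lemma qpow0 : qpow 0 = 1. Proof. exact: expr0z. Qed.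
Lemma qpow_gt0 a : 0 < qpow a. Proof. exact: exprz_gt0. Qed.
Lemma qpow_inj : injective qpow.
Proof. by apply: ieexprIz; rewrite ?ltr0n. Qed.

Section Series.
Context (n : nat).
Local Notation V := 'rV[int]_n.
Implicit Types (x y z a b c : V) (f g h : V -> rat) (P : V -> Prop).

Definition skew_form (L : V -> V -> int) : Prop :=
  (forall x y z, L (x + y) z = L x z + L y z) /\ (forall x y, L x y = - L y x).

Section Form.
Context (L : V -> V -> int) (sL : skew_form L).

Lemma formDl x y z : L (x + y) z = L x z + L y z.
Proof. by case: sL => h _; apply: h. Qed.
Lemma formC x y : L x y = - L y x.
Proof. by case: sL. Qed.
Lemma formDr x y z : L x (y + z) = L x y + L x z.
Proof. by rewrite formC formDl opprD -!(formC x). Qed.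
Lemma formxx x : L x x = 0.
Proof. have := formC x x; lia. Qed.
Lemma form0l x : L 0 x = 0.
Proof. by have := formDl 0 0 x; rewrite addr0; lia. Qed.
Lemma form0r x : L x 0 = 0.
Proof. by rewrite formC form0l oppr0. Qed.
Lemma formNl x y : L (- x) y = - L x y.
Proof. by have := formDl (- x) x y; rewrite addNr form0l; lia. Qed.
Lemma formNr x y : L x (- y) = - L x y.
Proof. by rewrite formC formNl -formC. Qed.
Lemma formBr x y z : L x (y - z) = L x y - L x z.
Proof. by rewrite formDr formNr. Qed.
Lemma formBl x y z : L (x - y) z = L x z - L y z.
Proof. by rewrite formDl formNl. Qed.
Lemma formZl (m : int) x y : L (m *: x) y = m * L x y.
Proof.
elim: m => [|m IH|m IH]; first by rewrite scale0r form0l mul0r.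
  by rewrite intS scalerDl scale1r formDl IH mulrDl mul1r.
by rewrite intS opprD scalerDl scaleN1r formDl formNl IH mulrDl mulN1r.
Qed.
Lemma formZr (m : int) x y : L x (m *: y) = m * L x y.
Proof. by rewrite formC formZl -mulrN -formC. Qed.

(** Twisted convolution [X^a X^b = q^(L a b) X^(a + b)]. Summing over [box x] keeps the sum finite
    and the product supported on the nonnegative orthant, whatever [f] and [g] are. *)
Definition qmul f g x : rat :=
  \sum_(a <- box x) qpow (L a (x - a)) * f a * g (x - a).

Definition one : V -> rat := fun x => (x == 0)%:R.
Definition pos f : Prop := forall x, f x != 0 -> vpos x.
Definition supp f P : Prop := forall x, f x != 0 -> P x.
Definition addclosed P : Prop := forall x y, P x -> P y -> P (x + y).

Lemma posE f x : pos f -> ~~ vpos x -> f x = 0.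
Proof. by move=> fp; apply: contraNeq => /fp. Qed.

Lemma qmul_supp (r : seq V) f g x : uniq r -> pos f -> pos g ->
    (forall a, f a != 0 -> g (x - a) != 0 -> a \in r) ->
  qmul f g x = \sum_(a <- r) qpow (L a (x - a)) * f a * g (x - a).
Proof.
move=> ur fp gp rP; apply: big_uniq_supp => // [|a]; first exact: box_uniq.
rewrite !mulf_eq0 !negb_or => /andP[/andP[_ fa] ga].
by rewrite mem_box fp // gp // rP.
Qed.

Lemma pos_mul f g : pos (qmul f g).
Proof.
move=> x; apply: contraNT => nx; rewrite /qmul big_seq big1 // => a /box_pos.
by rewrite (negPf nx).
Qed.

Lemma mul_neq0 f g x : qmul f g x != 0 ->
  exists2 a, a \in box x & f a != 0 /\ g (x - a) != 0.
Proof.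
move=> nz; have /hasP[a ax /andP[fa ga]] :
    has (fun a => (f a != 0) && (g (x - a) != 0)) (box x).
  apply: contraNT nz => /hasPn H; rewrite /qmul big_seq big1 // => a /H.
  rewrite negb_and !negbK => /orP[] /eqP ->; first by rewrite mulr0 mul0r.
  by rewrite mulr0.
by exists a.
Qed.

End Form.
End Series.

(** * Fixed points by degree and the associative product *)

Section Algebra.
Context (n : nat).
Local Notation V := 'rV[int]_n.
Implicit Types (x y z a b c : V) (f g h : V -> rat) (P : V -> Prop).

Definition additive_fun (D : V -> int) : Prop :=
  forall x y, D (x + y) = D x + D y.

Lemma additive_fun0 (D : V -> int) : additive_fun D -> D 0 = 0.
Proof. by move=> aD; have := aD 0 0; rewrite addr0; lia. Qed.
Lemma additive_funN (D : V -> int) x : additive_fun D -> D (- x) = - D x.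
Proof. by move=> aD; have := aD (- x) x; rewrite addNr additive_fun0 //; lia. Qed.
Lemma additive_funB (D : V -> int) x y :
  additive_fun D -> D (x - y) = D x - D y.
Proof. by move=> aD; rewrite aD additive_funN. Qed.
Lemma additive_funZ (D : V -> int) (m : int) x :
  additive_fun D -> D (m *: x) = m * D x.
Proof.
move=> aD; elim: m => [|m IH|m IH].
- by rewrite scale0r additive_fun0 // mul0r.
- by rewrite intS scalerDl scale1r aD IH mulrDl mul1r.
by rewrite intS opprD scalerDl scaleN1r aD additive_funN // IH mulrDl mulN1r.
Qed.

Definition der (D : V -> int) f x : rat := (D x)%:~R * f x.

Definition agree (d : int) f g : Prop :=
  forall x, vpos x -> vdeg x < d -> f x = g x.

Lemma agreeW d e f g : d <= e -> agree e f g -> agree d f g.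
Proof. by move=> de fg x xp xd; apply: fg => //; apply: lt_le_trans de. Qed.

Lemma agree_eq f g : pos f -> pos g -> (forall d : nat, agree d f g) -> f = g.
Proof.
move=> fp gp fg; apply: functional_extensionality => x.
case: (boolP (vpos x)) => xp; last by rewrite !posE.
by apply: (fg (absz (vdeg x)).+1); have := vdeg_ge0 xp; lia.
Qed.

Definition fixser (F : (V -> rat) -> (V -> rat)) : V -> rat :=
  fun x => iter (absz (vdeg x)).+1 F (fun=> 0) x.

(** Each application of [F] settles one more degree, so [vdeg x + 1] iterations from zero already
    give the fixed point at [x]. Inverses, factorizations and the cluster element are all obtained
    this way. *)
Definition contracting (F : (V -> rat) -> (V -> rat)) : Prop :=
  (forall f, pos (F f)) /\
  (forall (d : nat) f g, agree d f g -> agree d.+1 (F f) (F g)).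

Lemma pos_fixser F : contracting F -> pos (fixser F).
Proof. by move=> [Fp _] x; rewrite /fixser iterS => /Fp. Qed.

Lemma fixserE F : contracting F -> F (fixser F) = fixser F.
Proof.
move=> cF; have [Fp Fc] := cF.
have it (d : nat) : agree d (iter d F (fun=> 0)) (iter d.+1 F (fun=> 0)).
  elim: d => [x xp|d IH]; first by have := vdeg_ge0 xp; lia.
  by rewrite !iterS; apply: Fc.
have it2 (d e : nat) : (d <= e)%N -> agree d (iter d F (fun=> 0)) (iter e F (fun=> 0)).
  elim: e => [|e IH]; first by rewrite leqn0 => /eqP ->.
  rewrite leq_eqVlt => /orP[/eqP -> //|de] x xp xd; rewrite IH // it //.
  by apply: lt_le_trans xd _; rewrite lez_nat.
have itf (d : nat) : agree d (fixser F) (iter d F (fun=> 0)).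
  move=> x xp xd; rewrite /fixser; have h0 := vdeg_ge0 xp; apply: it2 => //; lia.
apply: agree_eq => [||d]; [exact: Fp|exact: pos_fixser|].
move=> x xp xd; rewrite (itf d.+1) ?iterS //; last by lia.
by apply: (Fc _ _ _ (itf d)) => //; lia.
Qed.

Context (L : V -> V -> int) (sL : skew_form L).
Local Notation "f ** g" := (qmul L f g) (at level 40, left associativity).

Lemma qmulA f g h : f ** (g ** h) = f ** g ** h.
Proof.
apply: functional_extensionality => x; rewrite /qmul; apply/esym.
pose F a c := qpow (L c (x - c) + L (a - c) (x - a)) * f c * g (a - c) * h (x - a).
(* Both bracketings become the sum over chains [c <= a <= x], where [c] is the degree of [f] and [a]
   that of the product of [f] and [g]; the exponents agree by bilinearity. *)
transitivity (\sum_(a <- box x) \sum_(c <- box x | vpos (a - c)) F a c).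
  rewrite big_seq [RHS]big_seq; apply: eq_bigr => a; rewrite mem_box => /andP[ap xa].
  rewrite mulr_sumr mulr_suml -[RHS]big_filter.
  rewrite [RHS](@big_uniq_supp _ _ (box a)); first last.
  - move=> c _; rewrite mem_filter !mem_box; apply/andP/andP.
      by case=> ac /andP[cp _].
    by case=> cp ac; rewrite cp ac (vposB_trans ac xa).
  - exact: box_uniq.
  - exact/filter_uniq/box_uniq.
  rewrite big_seq [RHS]big_seq; apply: eq_bigr => c _; rewrite /F.
  have -> : L c (x - c) = L c (a - c) + L c (x - a).
    by rewrite -formDr // [_ + (x - a)]addrC addrA subrK.
  have -> : L a (x - a) = L c (x - a) + L (a - c) (x - a).
    by rewrite -formDl // [c + _]addrC subrK.
  by rewrite !qpowD; ring.
rewrite (exchange_big_dep predT) //=.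
rewrite big_seq [RHS]big_seq; apply: eq_bigr => c; rewrite mem_box => /andP[cp xc].
rewrite mulr_sumr -[LHS]big_filter.
transitivity (\sum_(a <- [seq b + c | b <- box (x - c)]) F a c).
  apply: big_uniq_supp; first exact/filter_uniq/box_uniq.
    by rewrite map_inj_uniq ?box_uniq //; apply: addIr.
  move=> a _; rewrite mem_filter mem_box.
  apply/andP/mapP => [[ac /andP[_ xa]]|[b + ->]].
    exists (a - c); rewrite ?subrK // mem_box ac.
    by rewrite -[x - c - _]addrA -opprD [c + _]addrC subrK.
  rewrite mem_box => /andP[bp xcb]; rewrite addrK; split => //.
  by rewrite vposD //= opprD addrA [_ - b - c]addrAC.
rewrite big_map; apply: eq_bigr => b _; rewrite /F addrK.
have -> : x - (b + c) = x - c - b by rewrite opprD addrA addrAC.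
by rewrite qpowD; ring.
Qed.

Lemma qmul1f f : pos f -> one (n:=n) ** f = f.
Proof.
move=> fp; apply: functional_extensionality => x.
have p1 : pos (one (n:=n)).
  by move=> y; rewrite /one pnatr_eq0 eqb0 negbK => /eqP ->; apply: vpos0.
rewrite (@qmul_supp _ L [:: 0]) // => [|a].
  by rewrite big_seq1 subr0 form0l // qpow0 mul1r /one eqxx mul1r.
by rewrite /one pnatr_eq0 eqb0 negbK inE.
Qed.

Lemma qmulf1 f : pos f -> f ** one (n:=n) = f.
Proof.
move=> fp; apply: functional_extensionality => x.
have p1 : pos (one (n:=n)).
  by move=> y; rewrite /one pnatr_eq0 eqb0 negbK => /eqP ->; apply: vpos0.
rewrite (@qmul_supp _ L [:: x]) // => [|a _].
  by rewrite big_seq1 subrr form0r // qpow0 mul1r /one eqxx mulr1.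
by rewrite /one pnatr_eq0 eqb0 negbK inE subr_eq0 eq_sym.
Qed.

Lemma qmulDl f g h x : ((fun x => f x + g x) ** h) x = (f ** h) x + (g ** h) x.
Proof. by rewrite /qmul -big_split; apply: eq_bigr => a _ /=; ring. Qed.

Lemma qmulDr f g h x : (f ** (fun x => g x + h x)) x = (f ** g) x + (f ** h) x.
Proof. by rewrite /qmul -big_split; apply: eq_bigr => a _ /=; ring. Qed.

Lemma qmul0 f g : (f ** g) 0 = f 0 * g 0.
Proof.
rewrite /qmul (@big_uniq_supp _ _ [:: 0]) ?box_uniq // => [|a _].
  by rewrite big_seq1 subr0 form0l // qpow0 mul1r.
rewrite mem_box inE sub0r; apply/andP/eqP => [[]|->]; first exact: vpos_anti.
by rewrite oppr0 vpos0.
Qed.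

Lemma qmul_split f g x : vpos x -> x != 0 ->
  (f ** g) x = f 0 * g x + f x * g 0
    + \sum_(a <- box x | (a != 0) && (a != x))
        qpow (L a (x - a)) * f a * g (x - a).
Proof.
move=> xp x0; rewrite /qmul (bigD1_seq 0) ?box_uniq ?mem_box ?subr0 ?vpos0 //=.
rewrite -big_filter (bigD1_seq x) /=; last first.
- exact/filter_uniq/box_uniq.
- by rewrite mem_filter mem_box x0 subrr vpos0 xp.
rewrite big_filter_cond addrA subrr form0l // form0r // qpow0 !mul1r.
by congr (_ + _).
Qed.

End Algebra.

(** * Unipotent series: inverses, supports and derivations *)

Section Unipotent.
Context (n : nat).
Local Notation V := 'rV[int]_n.
Implicit Types (x y z a b c : V) (f g h : V -> rat) (P : V -> Prop).
Context (L : V -> V -> int) (sL : skew_form L).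
Local Notation "f ** g" := (qmul L f g) (at level 40, left associativity).
Local Notation one := (one (n:=n)).

Lemma sum_mid f g x (r := [pred a | (a != 0) && (a != x)]) :
    (forall a, vpos a -> vpos (x - a) -> a != 0 -> a != x ->
       f a = 0 \/ g (x - a) = 0) ->
  \sum_(a <- box x | (a != 0) && (a != x))
     qpow (L a (x - a)) * f a * g (x - a) = 0.
Proof.
move=> H; rewrite big_seq_cond big1 // => a /and3P[].
rewrite mem_box => /andP[ap xa] a0 ax.
by case: (H a) => // ->; rewrite ?mulr0 ?mul0r.
Qed.

(** In the top degree a change of the factors is seen only by the two terms in which the other
    factor is constant. This is what makes the recursions contracting. *)
Lemma qmul_diff d f f' g g' x : agree d f f' -> agree d g g' ->
    vpos x -> x != 0 -> vdeg x <= d ->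
  (f ** g) x - (f' ** g') x = (f x - f' x) * g 0 + f 0 * (g x - g' x).
Proof.
move=> ff gg xp x0 xd; rewrite !qmul_split //.
have d0 : 0 < d by apply: lt_le_trans xd; apply: vdeg_gt0.
have <- : f 0 = f' 0 by apply: ff; rewrite ?vpos0 ?vdeg0.
have <- : g 0 = g' 0 by apply: gg; rewrite ?vpos0 ?vdeg0.
set s := \sum_(_ <- _ | _) _; set s' := \sum_(_ <- _ | _) _.
have -> : s = s'; last by ring.
rewrite /s /s' big_seq_cond [RHS]big_seq_cond; apply: eq_bigr => a /and3P[].
rewrite mem_box => /andP[ap xa] a0 ax.
have := vdegD (x - a) a; rewrite subrK => xE.
have da := vdeg_gt0 ap a0.
have dxa : 0 < vdeg (x - a) by apply: vdeg_gt0; rewrite // subr_eq0 eq_sym.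
by rewrite ff ?gg //; lia.
Qed.

Lemma pos_one : pos one.
Proof. by move=> y; rewrite /one pnatr_eq0 eqb0 negbK => /eqP ->; apply: vpos0. Qed.

Definition unip f : Prop := pos f /\ f 0 = 1.

Lemma unip_mul f g : unip f -> unip g -> unip (f ** g).
Proof. by move=> [fp f0] [gp g0]; split;
  [exact: pos_mul | rewrite qmul0 // f0 g0 mulr1]. Qed.

Definition aug f : V -> rat := fun a => if a == 0 then 0 else f a.

(** The equation [f h = 1] in the form [h = 1 - (f - 1) h], where [f - 1] raises the degree. *)
Definition qinv f : V -> rat :=
  fixser (fun h x => one x - (aug f ** h) x).

Lemma contracting_qinv f : contracting (fun h x => one x - (aug f ** h) x).
Proof.
split=> [h x|d h h' hh x xp xd].
  case: (boolP (vpos x)) => // nx.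
  by rewrite (posE pos_one) // (posE (@pos_mul _ L _ _)) // subrr eqxx.
congr (_ - _); case: (eqVneq x 0) => [->|x0];
  first by rewrite !qmul0 // /aug eqxx !mul0r.
have xd' : vdeg x <= d by lia.
apply/eqP; rewrite -subr_eq0 (@qmul_diff d) //.
by rewrite subrr /aug eqxx !mul0r addr0.
Qed.

Lemma pos_qinv f : pos (qinv f).
Proof. exact/pos_fixser/contracting_qinv. Qed.

Lemma qmulfV f : unip f -> f ** qinv f = one.
Proof.
move=> [fp f0]; apply: functional_extensionality => x.
have fE : f = fun a => one a + aug f a.
  apply: functional_extensionality => a; rewrite /one /aug.
  by case: eqP => [->|_]; rewrite ?addr0 ?add0r.
have iE := congr1 (@^~ x) (fixserE (contracting_qinv f)).
rewrite [X in qmul L X _]fE qmulDl qmul1f //; last exact: pos_qinv.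
by rewrite -[qinv f x]iE subrK.
Qed.

Lemma unip_qinv f : unip f -> unip (qinv f).
Proof.
move=> uf; split; first exact: pos_qinv.
have := congr1 (@^~ 0) (qmulfV uf); rewrite qmul0 // /one eqxx.
by case: uf => _ ->; rewrite mul1r.
Qed.

Lemma qmulVf f : unip f -> qinv f ** f = one.
Proof.
move=> uf; have ui := unip_qinv uf.
suff e : f = qinv (qinv f) by rewrite [X in _ ** X]e qmulfV.
transitivity (f ** (qinv f ** qinv (qinv f))).
  by rewrite qmulfV ?qmulf1 //; case: uf.
by rewrite qmulA // qmulfV // qmul1f //; exact: pos_qinv.
Qed.

Lemma qmulKf f g : unip f -> pos g -> qinv f ** (f ** g) = g.
Proof. by move=> uf gp; rewrite qmulA // qmulVf // qmul1f. Qed.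

Lemma qmulVKf f g : unip f -> pos g -> f ** (qinv f ** g) = g.
Proof. by move=> uf gp; rewrite qmulA // qmulfV // qmul1f. Qed.

Lemma qmulfK f g : unip f -> pos g -> g ** f ** qinv f = g.
Proof. by move=> uf gp; rewrite -qmulA // qmulfV // qmulf1. Qed.

Lemma qmulfVK f g : unip f -> pos g -> g ** qinv f ** f = g.
Proof. by move=> uf gp; rewrite -qmulA // qmulVf // qmulf1. Qed.

Lemma qmulfI f g h : unip f -> pos g -> pos h -> f ** g = f ** h -> g = h.
Proof. by move=> uf gp hp e; rewrite -(qmulKf uf gp) e qmulKf. Qed.

Lemma qinv_unique f g : unip f -> pos g -> f ** g = one -> g = qinv f.
Proof.
move=> uf gp e; apply: (qmulfI uf gp) => //; first exact: pos_qinv.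
by rewrite e qmulfV.
Qed.

Lemma qinvM f g : unip f -> unip g -> qinv (f ** g) = qinv g ** qinv f.
Proof.
move=> uf ug; apply/esym/qinv_unique; [exact: unip_mul|exact: pos_mul|].
rewrite qmulA // -[f ** g ** _]qmulA // qmulfV // qmulf1 ?qmulfV //; by case: uf.
Qed.

Lemma supp_mul P f g : addclosed P -> supp f P -> supp g P -> supp (f ** g) P.
Proof.
move=> Pa fP gP x /mul_neq0[a _ [fa ga]].
by have -> : x = a + (x - a); [rewrite addrC subrK | apply: Pa; [apply: fP|apply: gP]].
Qed.

Lemma vdeg_ind (Q : V -> Prop) :
  (forall x, vpos x -> (forall y, vpos y -> vdeg y < vdeg x -> Q y) -> Q x) ->
  forall x, vpos x -> Q x.
Proof.
move=> step x; have [m] := ubnP (absz (vdeg x)); elim: m x => // m IH x xm xp.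
apply: step => // y yp yx; apply: IH => //.
have := vdeg_ge0 yp; have := vdeg_ge0 xp; lia.
Qed.

Lemma vdeg_mid x a : vpos (x - a) -> a != x -> vdeg a < vdeg x.
Proof.
move=> xa ax; have := vdegD (x - a) a; rewrite subrK => ->.
by rewrite ltrDr vdeg_gt0 // subr_eq0 eq_sym.
Qed.

Lemma vdeg_midr x a : vpos a -> a != 0 -> vdeg (x - a) < vdeg x.
Proof.
move=> ap a0; have := vdegD (x - a) a; rewrite subrK => ->.
by rewrite ltrDl vdeg_gt0.
Qed.

Lemma supp_qinv P f : unip f -> P 0 -> addclosed P -> supp f P -> supp (qinv f) P.
Proof.
move=> uf P0 Pa fP x; have [ip i0] := unip_qinv uf.
move=> nz; have xp := ip _ nz; move: x xp nz; apply: vdeg_ind => x xp IH nz.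
case: (eqVneq x 0) => [->//|x0].
have := congr1 (@^~ x) (qmulfV uf); rewrite qmul_split // /one (negPf x0) i0 mulr1.
have [fp f0] := uf; rewrite f0 mul1r.
case: (eqVneq (f x) 0) => [->|/fP //]; rewrite addr0.
case: (boolP (has (fun a => [&& a != 0, a != x, f a != 0 & qinv f (x - a) != 0]) (box
  x))).
  case/hasP => a; rewrite mem_box => /andP[ap xa] /and4P[a0 ax fa ia] _.
  have -> : x = a + (x - a) by rewrite addrC subrK.
  by apply: Pa; [exact: fP | apply: IH ia => //; exact: vdeg_midr].
move=> /hasPn H; rewrite sum_mid ?addr0 => [e|a ap xa a0 ax].
  by rewrite e eqxx in nz.
have := H a; rewrite mem_box ap xa a0 ax /= negb_and !negbK => /(_ isT).
by case/orP => /eqP; [left|right].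
Qed.

Lemma der_mul D f g : additive_fun D ->
  der D (f ** g) = fun x => (der D f ** g) x + (f ** der D g) x.
Proof.
move=> aD; apply: functional_extensionality => x.
rewrite /der /qmul mulr_sumr -big_split; apply: eq_bigr => a _ /=.
have DE : D x = D (x - a) + D a by rewrite -aD subrK.
by rewrite DE rmorphD /=; ring.
Qed.

Lemma pos_der D f : pos f -> pos (der D f).
Proof. by move=> fp x; rewrite mulf_eq0 negb_or => /andP[_ /fp]. Qed.

Lemma supp_der D f P : supp f P -> supp (der D f) P.
Proof. by move=> fp x; rewrite mulf_eq0 negb_or => /andP[_ /fp]. Qed.

Definition rs (p : pred V) f : V -> rat := fun x => if p x then f x else 0.

Lemma pos_rs p f : pos f -> pos (rs p f).
Proof. by move=> fp x; rewrite /rs; case: (p x); rewrite ?eqxx // => /fp. Qed.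

Lemma unip_rs (p : pred V) f : p 0 -> unip f -> unip (rs p f).
Proof. by move=> p0 [fp f0]; split; [exact: pos_rs | rewrite /rs p0]. Qed.

Lemma supp_rs (p : pred V) f : supp (rs p f) p.
Proof. by move=> x; rewrite /rs; case: (p x); rewrite ?eqxx. Qed.

Lemma supp_rsW (p : pred V) f P : supp f P -> supp (rs p f) P.
Proof. by move=> fp x; rewrite /rs; case: (p x); rewrite ?eqxx // => /fp. Qed.

Lemma rs_id (p : pred V) f : supp f p -> rs p f = f.
Proof.
move=> fp; apply: functional_extensionality => x; rewrite /rs.
by case: ifPn => // /negP px; apply/esym/eqP; apply: contraT => /fp.
Qed.

End Unipotent.

(** * Wall functions *)

Section Factorization.
Context (n : nat).
Local Notation V := 'rV[int]_n.
Implicit Types (x y z a b c v : V) (f g h : V -> rat) (P : V -> Prop).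
Context (L : V -> V -> int) (sL : skew_form L).
Local Notation "f ** g" := (qmul L f g) (at level 40, left associativity).
Local Notation one := (one (n:=n)).

Lemma agree_ind (d : nat) f g :
    (forall e : nat, (e <= d)%N -> agree e f g ->
       forall v, vpos v -> vdeg v <= e -> vdeg v < d -> f v = g v) ->
  agree d f g.
Proof.
move=> step; suff H (e : nat) : (e <= d)%N -> agree e f g by apply: H.
elim: e => [_ x xp|e IH ed x xp xe]; first by have := vdeg_ge0 xp; lia.
by apply: (step e (ltnW ed) (IH (ltnW ed))) => //; lia.
Qed.

Section Theta.
Context (th : V -> int) (ath : additive_fun th).

Definition nnpart f : V -> rat :=
  fun v => if v == 0 then 1 else if 0 <= th v then f v else 0.
Definition ngpart f : V -> rat :=
  fun v => if v == 0 then 1 else if 0 <= th v then 0 else f v.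

(** In degree [v] the product [nnpart f ** ngpart f] is [f v] plus a contribution of lower degrees,
    so adding the error to [f v] solves the factorization degree by degree. *)
Definition split_step g f : V -> rat := fun v =>
  if vpos v then if v == 0 then 1 else g v - (nnpart f ** ngpart f) v + f v
  else 0.

(* [gsplit g] packs the two factors of [g = nnpart (gsplit g) ** ngpart
   (gsplit g)], the first supported on [th >= 0], the second on [th < 0]
   and [0], into one function. *)
Definition gsplit g := fixser (split_step g).

Definition wall g : V -> rat := rs (fun v => th v == 0) (gsplit g).

Lemma agree_nnpart d f g : agree d f g -> agree d (nnpart f) (nnpart g).
Proof. by move=> fg x xp xd; rewrite /nnpart fg. Qed.
Lemma agree_ngpart d f g : agree d f g -> agree d (ngpart f) (ngpart g).
Proof. by move=> fg x xp xd; rewrite /ngpart fg. Qed.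

Lemma parts_diff d f f' v : agree d f f' -> vpos v -> v != 0 -> vdeg v <= d ->
  (nnpart f ** ngpart f) v - (nnpart f' ** ngpart f') v = f v - f' v.
Proof.
move=> ff vp v0 vd; rewrite (@qmul_diff _ _ sL d) //; last 2 first.
- exact: agree_nnpart.
- exact: agree_ngpart.
by rewrite /nnpart /ngpart eqxx (negPf v0); case: (0 <= th v); ring.
Qed.

Lemma contracting_split g : contracting (split_step g).
Proof.
split=> [f x|d f f' ff x xp xd]; first by rewrite /split_step; case: ifP; rewrite ?eqxx.
rewrite /split_step xp; case: eqP => // /eqP x0.
have xd' : vdeg x <= d by lia.
have := parts_diff ff xp x0 xd'.
by move=> /(congr1 (fun t => g x - t)); lra.
Qed.

Lemma gsplit0 g : gsplit g 0 = 1.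
Proof. rewrite /gsplit -fixserE; last exact: contracting_split.
by rewrite /split_step vpos0 eqxx. Qed.

Lemma pos_gsplit g : pos (gsplit g).
Proof. exact/pos_fixser/contracting_split. Qed.

Lemma pos_nnpart f : pos f -> pos (nnpart f).
Proof.
move=> fp x; rewrite /nnpart; case: (x =P 0) => [->|_]; rewrite ?vpos0 //.
by case: ifP => _; [exact: fp | rewrite eqxx].
Qed.

Lemma pos_ngpart f : pos f -> pos (ngpart f).
Proof.
move=> fp x; rewrite /ngpart; case: (x =P 0) => [->|_]; rewrite ?vpos0 //.
by case: ifP => _; [rewrite eqxx | exact: fp].
Qed.

Lemma unip_nnpart g : unip (nnpart (gsplit g)).
Proof. by split; [exact/pos_nnpart/pos_gsplit | rewrite /nnpart eqxx]. Qed.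
Lemma unip_ngpart g : unip (ngpart (gsplit g)).
Proof. by split; [exact/pos_ngpart/pos_gsplit | rewrite /ngpart eqxx]. Qed.

Lemma gsplitE g : unip g -> nnpart (gsplit g) ** ngpart (gsplit g) = g.
Proof.
move=> [gp g0]; apply: functional_extensionality => x.
case: (boolP (vpos x)) => xp; last by rewrite !posE //; apply: pos_mul.
have := congr1 (@^~ x) (fixserE (contracting_split g)).
rewrite -/(gsplit g) {1}/split_step xp; case: eqP => [-> _|_ e].
  by rewrite qmul0 // /nnpart /ngpart eqxx g0 mulr1.
by move: e; lra.
Qed.

Lemma supp_nnpart g : supp (nnpart (gsplit g)) (fun v => 0 <= th v).
Proof.
move=> x; rewrite /nnpart; case: (x =P 0) => [->|_]; first by rewrite additive_fun0.
by case: ifP; rewrite ?eqxx.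
Qed.

Lemma supp_ngpart g : supp (ngpart (gsplit g)) (fun v => v = 0 \/ th v < 0).
Proof.
move=> x; rewrite /ngpart; case: (x =P 0) => [->|_]; first by left.
by case: ifP; rewrite ?eqxx // ltNge => ->; right.
Qed.

Lemma wallE g : wall g = rs (fun v => th v == 0) (nnpart (gsplit g)).
Proof.
apply: functional_extensionality => x; rewrite /wall /rs /nnpart.
case: (eqVneq x 0) => [->|x0]; first by rewrite additive_fun0 // gsplit0.
by case: eqP => // ->.
Qed.

Lemma unip_wall g : unip (wall g).
Proof. rewrite wallE; apply: unip_rs; last exact: unip_nnpart.
by rewrite additive_fun0. Qed.

Lemma supp_wall g : supp (wall g) (fun v => th v == 0).
Proof. exact: supp_rs. Qed.

Lemma addclosed_nn : addclosed (fun v => 0 <= th v).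
Proof. by move=> x y x0 y0; rewrite ath addr_ge0. Qed.
Lemma addclosed_np : addclosed (fun v => th v <= 0).
Proof. by move=> x y x0 y0; rewrite ath; lia. Qed.
Lemma addclosed_eq0 : addclosed (fun v => th v == 0).
Proof. by move=> x y /eqP x0 /eqP y0; rewrite ath x0 y0. Qed.
Lemma addclosed_ng : addclosed (fun v => v = 0 \/ th v < 0).
Proof.
move=> x y [->|x0] [->|y0]; rewrite ?add0r ?addr0; [by left|by right|by right|].
by right; rewrite ath; lia.
Qed.

(** The hyperplane [th = 0] is a face of each closed half space: a sum of two elements of the half
    space lies on it only if both do. The sign of [e] selects the half space. *)
Lemma rs0_mul f g (e : int) : e != 0 ->
    supp f (fun v => 0 <= e * th v) -> supp g (fun v => 0 <= e * th v) ->
  rs (fun v => th v == 0) (f ** g)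
    = rs (fun v => th v == 0) f ** rs (fun v => th v == 0) g.
Proof.
move=> e0 fp gp; apply: functional_extensionality => x; rewrite {1}/rs.
case: eqP => [x0|/eqP x0]; last first.
  apply/esym/eqP; apply: contraNT x0.
  exact: (supp_mul addclosed_eq0 (@supp_rs _ _ f) (@supp_rs _ _ g)).
apply: eq_bigr => a _; rewrite /rs.
case: (eqVneq (f a) 0) => [->|/fp fa]; first by rewrite if_same !mulr0 !mul0r.
case: (eqVneq (g (x - a)) 0) => [->|/gp]; first by rewrite if_same !mulr0.
rewrite additive_funB // x0 sub0r => ga.
suff -> : th a = 0 by rewrite eqxx.
have : e * th a = 0 by lia.
by move/eqP; rewrite mulf_eq0 (negPf e0) => /eqP.
Qed.

Lemma wall_fact f g : unip f -> unip g ->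
    supp f (fun v => 0 <= th v) -> supp g (fun v => v = 0 \/ th v < 0) ->
  wall (f ** g) = rs (fun v => th v == 0) f.
Proof.
move=> uf ug fp gp; rewrite wallE; congr rs.
have ufg := unip_mul sL uf ug.
set X := nnpart _; set Z := ngpart (gsplit (f ** g)).
have e : X ** Z = f ** g by apply: gsplitE.
have uX : unip X by apply: unip_nnpart.
have uZ : unip Z by apply: unip_ngpart.
have [fp0 gp0 Xp0 Zp0] : [/\ pos f, pos g, pos X & pos Z].
  by case: uf uX uZ ug => [? _] [? _] [? _] [? _].
have uiX := unip_qinv sL uX; have uig := unip_qinv sL ug.
(* Equality of the two factorizations yields a series supported both on [th >= 0] and on [0]
   together with [th < 0]; it is therefore 1. *)
have e2 : qinv L X ** f = Z ** qinv L g.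
  have <- : qinv L X ** (X ** Z) ** qinv L g = Z ** qinv L g by rewrite qmulKf.
  by rewrite e -qmulA // qmulfK.
have e3 : qinv L X ** f = one.
  apply: functional_extensionality => v; rewrite /one; case: eqP => [->|v0].
    by case: (unip_mul sL uiX uf).
  apply/eqP; apply: contraT => nz.
  have : 0 <= th v.
    apply: (supp_mul (L := L) addclosed_nn _ fp nz); apply: supp_qinv => //.
    - by rewrite additive_fun0.
    - exact: addclosed_nn.
    - exact: supp_nnpart.
  rewrite e2 in nz.
  have [//|] : v = 0 \/ th v < 0; last by lia.
  apply: (supp_mul (L := L) addclosed_ng _ _ nz); first exact: supp_ngpart.
  apply: supp_qinv => //; [by left|exact: addclosed_ng].
by rewrite -(qmulf1 sL Xp0) -e3 qmulVKf.
Qed.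

Lemma wall_mul f g : unip f -> unip g ->
    supp f (fun v => 0 <= th v) -> supp g (fun v => th v <= 0) ->
  wall (f ** g) = rs (fun v => th v == 0) f ** rs (fun v => th v == 0) g.
Proof.
move=> uf ug fp gp; set r0 := rs _; set g0 := r0 g.
have th0 : th 0 == 0 by rewrite additive_fun0.
have ug0 : unip g0 by apply: unip_rs.
have g0s : supp g0 (fun v => th v == 0) by apply: supp_rs.
have uig0 := unip_qinv sL ug0.
have ig0s : supp (qinv L g0) (fun v => th v == 0).
  by apply: supp_qinv => //; apply: addclosed_eq0.
(* The part of [g] on [th = 0] is moved to the left factor; what remains is supported on [0] and
   [th < 0], as [wall_fact] demands. *)
have -> : f ** g = (f ** g0) ** (qinv L g0 ** g).
  by rewrite -qmulA // qmulVKf //; case: ug.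
rewrite wall_fact.
- rewrite /r0 (@rs0_mul _ _ 1) //.
  + by rewrite [rs _ g0]rs_id.
  + by move=> v /fp; rewrite mul1r.
  + by move=> v /g0s /eqP ->.
- exact: unip_mul.
- exact: unip_mul.
- apply: supp_mul; [exact: addclosed_nn|exact: fp|by move=> v /g0s /eqP ->].
move=> v nz; case: (ltgtP (th v) 0) => [|vg|v0]; first by right.
  have : th v <= 0.
    apply: (supp_mul (L := L) addclosed_np _ gp nz).
    by move=> w /ig0s /eqP ->.
  by lia.
left; have : r0 (qinv L g0 ** g) v != 0 by rewrite /r0 /rs v0 eqxx.
rewrite /r0 (@rs0_mul _ _ (- 1)) //.
- rewrite [rs _ (qinv L g0)]rs_id // -/r0 -/g0 qmulVf // /one.
  by rewrite pnatr_eq0 eqb0 negbK => /eqP.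
- by move=> w /ig0s /eqP ->.
- by move=> w /gp; lia.
Qed.

Lemma gsplit_diff d g g' v : unip g -> unip g' ->
    agree d (gsplit g) (gsplit g') -> vpos v -> v != 0 -> vdeg v <= d ->
  gsplit g v - gsplit g' v = g v - g' v.
Proof.
move=> ug ug' dd vp v0 vd; rewrite -[in RHS](gsplitE ug) -[in RHS](gsplitE ug').
by rewrite (parts_diff dd).
Qed.

Lemma agree_gsplit (d : nat) g g' : unip g -> unip g' -> agree d g g' ->
  agree d (gsplit g) (gsplit g').
Proof.
move=> ug ug' gg; apply: agree_ind => e ed IH v vp ve vd.
case: (eqVneq v 0) => [->|v0]; first by rewrite !gsplit0.
apply/eqP; rewrite -subr_eq0 (gsplit_diff ug ug' IH vp v0 ve).
by rewrite gg // subrr.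
Qed.

Lemma wall_agree (d : nat) g g' : unip g -> unip g' -> agree d g g' ->
  agree d (wall g) (wall g').
Proof.
by move=> ug ug' gg x xp xd; rewrite /wall /rs (agree_gsplit ug ug' gg).
Qed.

Lemma wall_diff (d : nat) g g' v : unip g -> unip g' -> agree d g g' ->
    vpos v -> v != 0 -> vdeg v <= d -> th v = 0 ->
  wall g v - wall g' v = g v - g' v.
Proof.
move=> ug ug' gg vp v0 vd thv; rewrite /wall /rs thv eqxx.
by apply: (gsplit_diff ug ug' _ vp v0 vd); apply: agree_gsplit.
Qed.

Lemma gsplit_indec g v : unip g -> vpos v -> v != 0 ->
    (forall a, vpos a -> vpos (v - a) -> a != 0 -> a != v ->
       gsplit g a = 0 \/ gsplit g (v - a) = 0) ->
  gsplit g v = g v.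
Proof.
move=> ug vp v0 H; rewrite -[in RHS](gsplitE ug) qmul_split // sum_mid.
  by rewrite /nnpart /ngpart eqxx (negPf v0); case: (0 <= th v); ring.
move=> a ap va a0 av; rewrite /nnpart /ngpart (negPf a0).
have : v - a != 0 by rewrite subr_eq0 eq_sym.
move/negPf ->; have [->|->] := H a ap va a0 av; rewrite ?if_same; [by left|by right].
Qed.

Lemma supp_gsplit g P : unip g -> supp g P -> P 0 -> addclosed P ->
  supp (gsplit g) P.
Proof.
move=> ug gP P0 Pa v nz; have vp := pos_gsplit nz; move: v vp nz.
apply: vdeg_ind => v vp IH nz.
case: (eqVneq v 0) => [->//|v0].
case: (boolP (has (fun a => [&& a != 0, a != v, gsplit g a != 0
                            & gsplit g (v - a) != 0]) (box v))).
  case/hasP => a; rewrite mem_box => /andP[ap va] /and4P[a0 av fa ia].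
  have -> : v = a + (v - a) by rewrite addrC subrK.
  apply: Pa; [apply: IH fa => //; exact: vdeg_mid|].
  by apply: IH ia => //; exact: vdeg_midr.
move=> /hasPn H; apply: gP; rewrite -gsplit_indec // => a ap va a0 av.
have := H a; rewrite mem_box ap va a0 av /= negb_and !negbK => /(_ isT).
by case/orP => /eqP; [left|right].
Qed.

Lemma supp_wallW g P : unip g -> supp g P -> P 0 -> addclosed P ->
  supp (wall g) P.
Proof. by move=> ug gP P0 Pa; apply: supp_rsW; apply: supp_gsplit. Qed.

(** Without a proper decomposition of [v] inside [P], the product of the two factors of [g] has no
    mixed term in degree [v]. *)
Lemma wall_indec g P v : unip g -> supp g P -> P 0 -> addclosed P ->
    vpos v -> v != 0 -> th v = 0 ->
    (forall a, P a -> P (v - a) -> a != 0 -> a != v -> False) ->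
  wall g v = g v.
Proof.
move=> ug gP P0 Pa vp v0 thv H; rewrite /wall /rs thv eqxx.
apply: gsplit_indec => // a ap va a0 av.
have sg := supp_gsplit ug gP P0 Pa.
case: (eqVneq (gsplit g a) 0) => [|/sg ga]; first by left.
case: (eqVneq (gsplit g (v - a)) 0) => [|/sg gb]; first by right.
by case: (H a).
Qed.

End Theta.
End Factorization.

(** * Logarithmic derivatives *)

Section LogDerivative.
Context (n : nat).
Local Notation V := 'rV[int]_n.
Implicit Types (x y z a b c v : V) (f g h : V -> rat) (P : V -> Prop).
Context (L : V -> V -> int) (sL : skew_form L).
Local Notation "f ** g" := (qmul L f g) (at level 40, left associativity).
Local Notation one := (one (n:=n)).

(** Used in place of the logarithm: on the centraliser of [v], the coefficient in degree [v] is
    additive in [f] and, as [D] varies, proportional to [D v]. *)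
Definition ldv (D : V -> int) f : V -> rat := qinv L f ** der D f.

Lemma pos_ldv D f : pos (ldv D f).
Proof. exact: pos_mul. Qed.

Lemma qmul_ldv D f : unip f -> f ** ldv D f = der D f.
Proof. by move=> uf; rewrite qmulVKf //; apply: pos_der; case: uf. Qed.

Lemma qinv_diff d f f' v : unip f -> unip f' -> agree d f f' ->
    agree d (qinv L f) (qinv L f') -> vpos v -> v != 0 -> vdeg v <= d ->
  qinv L f v - qinv L f' v = - (f v - f' v).
Proof.
move=> uf uf' ff ii vp v0 vd.
have [_ i0] := unip_qinv sL uf; have [_ f0] := uf.
have := qmul_diff sL ff ii vp v0 vd; rewrite !qmulfV // subrr i0 f0; lra.
Qed.

Lemma agree_qinv (d : nat) f f' : unip f -> unip f' -> agree d f f' ->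
  agree d (qinv L f) (qinv L f').
Proof.
move=> uf uf' ff; apply: agree_ind => e ed IH v vp ve vd.
case: (eqVneq v 0) => [->|v0].
  by rewrite (proj2 (unip_qinv sL uf)) (proj2 (unip_qinv sL uf')).
apply/eqP; rewrite -subr_eq0 (qinv_diff uf uf' _ IH vp v0 ve).
  by rewrite ff // subrr oppr0.
by apply: agreeW ff; rewrite lez_nat.
Qed.

Lemma agree_der D d f f' : agree d f f' -> agree d (der D f) (der D f').
Proof. by move=> ff x xp xd; rewrite /der ff. Qed.

Lemma ldv_diff (d : nat) D f f' v : additive_fun D -> unip f -> unip f' ->
    agree d f f' -> vpos v -> v != 0 -> vdeg v <= d ->
  ldv D f v - ldv D f' v = (D v)%:~R * (f v - f' v).
Proof.
move=> aD uf uf' ff vp v0 vd; rewrite /ldv (@qmul_diff _ _ sL d) //; last 2 first.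
- exact: agree_qinv.
- exact: agree_der.
rewrite /der additive_fun0 // mul0r mulr0 add0r (proj2 (unip_qinv sL uf)) mul1r.
by rewrite mulrBr.
Qed.

Lemma supp_ldv D f P : unip f -> supp f P -> P 0 -> addclosed P ->
  supp (ldv D f) P.
Proof.
move=> uf fP P0 Pa; apply: supp_mul => //; [exact: supp_qinv|exact: supp_der].
Qed.

Lemma ldv_indec D f P v : additive_fun D -> unip f -> supp f P -> P 0 ->
    addclosed P -> vpos v -> v != 0 ->
    (forall a, P a -> P (v - a) -> a != 0 -> a != v -> False) ->
  ldv D f v = (D v)%:~R * f v.
Proof.
move=> aD uf fP P0 Pa vp v0 H; rewrite /ldv qmul_split // sum_mid ?addr0.
  by rewrite (proj2 (unip_qinv sL uf)) mul1r /der additive_fun0 // mul0r mulr0 addr0.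
have sI := supp_qinv sL uf P0 Pa fP; have sD := @supp_der _ D _ _ fP.
move=> a ap va a0 av.
case: (eqVneq (qinv L f a) 0) => [|/sI ga]; first by left.
case: (eqVneq (der D f (v - a)) 0) => [|/sD gb]; first by right.
by case: (H a).
Qed.

(* On the centraliser of [v] the coefficient of [v] is a trace, so that the
   coefficient of [v] in a logarithmic derivative is additive. *)
Lemma qmul_trace f g v :
    supp f (fun a => L v a == 0) -> supp g (fun a => L v a == 0) ->
  (f ** g) v = (g ** f) v.
Proof.
move=> fs gs; rewrite /qmul.
transitivity (\sum_(a <- [seq v - b | b <- box v])
    qpow (L a (v - a)) * f a * g (v - a)).
  apply: big_uniq_supp; first exact: box_uniq.
    by rewrite map_inj_uniq ?box_uniq // => a b /addrI /oppr_inj.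
  move=> a _; rewrite mem_box; apply/andP/mapP => [[ap va]|[b + ->]].
    by exists (v - a); rewrite ?mem_box opprB [v + (a - v)]addrC subrK // va ap.
  by rewrite mem_box opprB [v + (b - v)]addrC subrK => /andP[-> ->].
rewrite big_map; apply: eq_bigr => a _; rewrite opprB [v + (a - v)]addrC subrK.
case: (eqVneq (g a) 0) => [->|/gs /eqP Lva]; first by rewrite !mulr0 mul0r.
have Lav : L a v = 0 by rewrite formC // Lva.
have -> : L (v - a) a = 0 by rewrite formBl // formxx // Lva.
have -> : L a (v - a) = 0 by rewrite formBr // formxx // Lav.
by ring.
Qed.

Lemma ldv_mul D f g v : additive_fun D -> unip f -> unip g ->
    supp f (fun a => L v a == 0) -> supp g (fun a => L v a == 0) ->
  ldv D (f ** g) v = ldv D f v + ldv D g v.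
Proof.
move=> aD uf ug fs gs; pose P a := L v a == 0.
have P0 : P 0 by rewrite /P form0r.
have Pa : addclosed P by move=> a b; rewrite /P formDr // => /eqP -> /eqP ->.
rewrite /ldv qinvM // der_mul // qmulDr.
have -> : qinv L g ** qinv L f ** (f ** der D g) = qinv L g ** der D g.
  rewrite -qmulA // [qinv L f ** _]qmulA // qmulVf // qmul1f //.
  by apply: pos_der; case: ug.
congr (_ + _).
have -> : qinv L g ** qinv L f ** (der D f ** g)
    = qinv L g ** (ldv D f ** g) by rewrite /ldv !qmulA.
rewrite qmul_trace.
- by rewrite -qmulA // qmulfV // qmulf1 //; apply: pos_ldv.
- exact: supp_qinv.
by apply: supp_mul => //; apply: supp_ldv.
Qed.

(** Since the derivations commute, the logarithmic derivatives satisfy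
    [w1 w2 + D1 w2 = w2 w1 + D2 w1], and the trace identifies the two products in degree [v].
    Vanishing for the single derivation [vdeg] thus gives it for all. *)
Lemma ldv_swap D1 D2 f v : additive_fun D1 -> additive_fun D2 -> unip f ->
    supp f (fun a => L v a == 0) ->
  (D1 v)%:~R * ldv D2 f v = (D2 v)%:~R * ldv D1 f v.
Proof.
move=> a1 a2 uf fs; pose P a := L v a == 0.
have P0 : P 0 by rewrite /P form0r.
have Pa : addclosed P by move=> a b; rewrite /P formDr // => /eqP -> /eqP ->.
pose w1 := ldv D1 f; pose w2 := ldv D2 f.
have H D D' : additive_fun D -> additive_fun D' ->
    der D (der D' f) = f ** (fun x => (ldv D f ** ldv D' f) x + der D (ldv D' f) x).
  move=> aD aD'; rewrite -[in LHS](qmul_ldv D' uf) der_mul //.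
  rewrite -(qmul_ldv D uf) -qmulA //.
  by apply: functional_extensionality => x; rewrite -qmulDr.
have C : der D1 (der D2 f) = der D2 (der D1 f).
  by apply: functional_extensionality => x; rewrite /der; ring.
have pE D D' : pos (fun x => (ldv D f ** ldv D' f) x + der D (ldv D' f) x).
  move=> x; apply: contraNT => nx.
  by rewrite !posE // ?addr0 //; [apply/pos_der/pos_ldv|apply: pos_mul].
have := qmulfI sL uf (pE D1 D2) (pE D2 D1).
rewrite -!H // => /(_ C) /(congr1 (@^~ v)).
rewrite [(ldv D2 f ** ldv D1 f) v]qmul_trace; last 2 first.
- exact: supp_ldv.
- exact: supp_ldv.
by move/addrI.
Qed.

End LogDerivative.

(** * The quantum dilogarithm *)

(** The recursion is forced by the functional equation: with [Q = qpow p], the case [c = 0] of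
    [psit_rec] reads [psi_m (Q^(-m) - Q^m) = Q^(m-1) psi_(m-1)]. *)
Fixpoint psi (p : int) (m : nat) : rat :=
  if m is m'.+1 then
    psi p m' * qpow (p * m'%:Z) / (qpow (- (p * m%:Z)) - qpow (p * m%:Z))
  else 1.

(* The coefficients of [Psi (Q ^ c y)], where [Psi] is the quantum dilogarithm
   of parameter [Q := qpow p]; it satisfies
   [Psi (Q ^ (c - 1) y) = (1 + Q ^ c y) * Psi (Q ^ (c + 1) y)]. *)
Definition psit (p c : int) (m : nat) : rat := psi p m * qpow (p * c * m%:Z).

Lemma qpow_sub_neq0 (m : int) : m != 0 -> qpow (- m) - qpow m != 0.
Proof. by move=> m0; rewrite subr_eq0; apply/negP => /eqP/qpow_inj; lia. Qed.

Lemma psit0 p c : psit p c 0 = 1.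
Proof. by rewrite /psit mulr0 qpow0 mulr1. Qed.

Lemma psit_rec (p c : int) m : p != 0 ->
  psit p (c - 1) m.+1 = psit p (c + 1) m.+1 + qpow (p * c) * psit p (c + 1) m.
Proof.
move=> p0; rewrite /psit [psi p m.+1]/=.
have nz := @qpow_sub_neq0 (p * m.+1%:Z) ltac:(by rewrite mulf_neq0).
have -> : p * (c - 1) * m.+1%:Z = p * c * m.+1%:Z + - (p * m.+1%:Z) by ring.
have -> : p * (c + 1) * m.+1%:Z = p * c * m.+1%:Z + p * m.+1%:Z by ring.
have e : qpow (p * c * m.+1) * qpow (p * m)
    = qpow (p * c) * qpow (p * (c + 1) * m).
  by rewrite -!qpowD; congr qpow; rewrite intS; ring.
rewrite ![qpow (_ + _)]qpowD.
set A := qpow (p * c * m.+1) in e *; set B := qpow (- _) in nz *.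
set C := qpow (p * m.+1) in nz *.
transitivity (psi p m * (qpow (p * c) * qpow (p * (c + 1) * m))
  + psi p m * qpow (p * m) / (B - C) * (A * C)); last by ring.
by rewrite -e; field.
Qed.

(** The quotient of [Psi (Q^(-b) y)] by [Psi (Q^b y)], obtained by [b] uses of the functional
    equation. The exponents are symmetric about 0, whence the palindromic coefficients. *)
Definition fpoly (p : int) (b : nat) : {poly rat} :=
  \prod_(r < b) (1 + qpow (p * (2 * r%:Z + 1 - b%:Z)) *: 'X).

Definition ser_poly (N : nat) (a : nat -> rat) : {poly rat} := \poly_(i < N) a i.

Definition eqtr (N : nat) (p q : {poly rat}) := forall i, (i < N)%N -> p`_i = q`_i.

Lemma eqtr_mul N (p p' q q' : {poly rat}) : eqtr N p p' -> eqtr N q q' -> eqtr N (p *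
  q) (p' * q').
Proof.
move=> pp qq i iN; rewrite !coefM; apply: eq_bigr => j _.
by rewrite pp ?qq //; have := ltn_ord j; lia.
Qed.

Lemma eqtr_trans N (p q r : {poly rat}) : eqtr N p q -> eqtr N q r -> eqtr N p r.
Proof. by move=> pq qr i iN; rewrite pq ?qr. Qed.

Lemma eqtr_cancel N (p q r : {poly rat}) : p`_0 = 1 -> eqtr N (p * q) (p * r) -> eqtr
  N q r.
Proof.
move=> p0 pqr i; elim: i {-2}i (leqnn i) => [|m IH] i im iN.
  have := pqr i iN; rewrite !coefM; have -> : i = 0%N by lia.
  by rewrite !big_ord_recl !big_ord0 /= p0 !mul1r !addr0.
have := pqr i iN; rewrite !coefM !big_ord_recl /= subn0 p0 !mul1r.
rewrite (eq_bigr (fun j : 'I_i => p`_(lift ord0 j) * r`_(i - lift ord0 j))).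
  by move/addIr.
by move=> j _; rewrite IH //; rewrite /= /bump leq0n; lia.
Qed.

Lemma coef_ser_poly_mul N a (p : {poly rat}) i : (i < N)%N ->
  (p * ser_poly N a)`_i = \sum_(j < i.+1) p`_j * a (i - j)%N.
Proof.
move=> iN; rewrite coefM; apply: eq_bigr => j _; rewrite coef_poly.
by have -> : (i - j < N)%N by lia.
Qed.

Lemma fpoly_psit (p : int) b N : p != 0 ->
  eqtr N (ser_poly N (psit p (- b%:Z))) (fpoly p b * ser_poly N (psit p b%:Z)).
Proof.
(* Strengthened to the first [m] factors, each of which raises the parameter [c] by 2 on its way
   from [-b] to [b]. *)
move=> p0; suff H m : (m <= b)%N ->
    eqtr N (ser_poly N (psit p (- b%:Z)))
      (\prod_(r < m) (1 + qpow (p * (2 * r%:Z + 1 - b%:Z)) *: 'X)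
        * ser_poly N (psit p (2 * m%:Z - b%:Z))).
  have := H b (leqnn b); have -> // : 2 * b%:Z - b%:Z = b%:Z by lia.
elim: m => [_ i iN|m IH mb]; first by rewrite big_ord0 mul1r mulr0 sub0r.
apply: eqtr_trans (IH (ltnW mb)) _; rewrite big_ord_recr /= -mulrA.
apply: (eqtr_mul (fun _ _ => erefl)) => i iN; set c := 2 * m%:Z + 1 - b%:Z.
have -> : 2 * m%:Z - b%:Z = c - 1 by rewrite /c; ring.
have -> : 2 * m.+1%:Z - b%:Z = c + 1 by rewrite /c; lia.
rewrite mulrDl mul1r coefD -scalerAl coefZ coefXM !coef_poly iN.
case: i iN => [|i] iN /=; first by rewrite !psit0 mulr0 addr0.
by rewrite (ltnW iN) psit_rec.
Qed.

(** On one line, commutation with the dilogarithm equates a multiple of [Psi (Q^(-b) y)] with a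
    multiple of [Psi (Q^b y)]; dividing by the latter leaves a polynomial factor. *)
Lemma line_conj (p : int) (b : nat) (H H' : nat -> rat) : p != 0 ->
  (forall j, \sum_(i < j.+1) psit p (- b%:Z) i * H (j - i)%N
           = \sum_(i < j.+1) psit p b i * H' (j - i)%N) <->
  (forall j, H' j = \sum_(i < j.+1) (fpoly p b)`_i * H (j - i)%N).
Proof.
move=> p0.
have E c G j : \sum_(i < j.+1) psit p c i * G (j - i)%N
    = (ser_poly j.+1 (psit p c) * ser_poly j.+1 G)`_j.
  rewrite coef_ser_poly_mul //; apply: eq_bigr => i _.
  by rewrite coef_poly ltn_ord.
split=> h j.
  have e : eqtr j.+1 (ser_poly j.+1 (psit p b) * (fpoly p b * ser_poly j.+1 H))
      (ser_poly j.+1 (psit p b) * ser_poly j.+1 H').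
    rewrite mulrCA mulrA => i ij.
    rewrite -(eqtr_mul (@fpoly_psit p b j.+1 p0) (fun _ _ => erefl)) //.
    have tr c G : (ser_poly j.+1 (psit p c) * ser_poly j.+1 G)`_i
        = (ser_poly i.+1 (psit p c) * ser_poly i.+1 G)`_i.
      apply: (@eqtr_mul i.+1) => // k ki; rewrite !coef_poly ki;
      by have -> : (k < j.+1)%N by lia.
    by rewrite !tr -!E.
  have := eqtr_cancel _ e; rewrite coef_poly psit0 => /(_ erefl j (ltnSn j)).
  by rewrite coef_ser_poly_mul // coef_poly ltnSn => ->.
rewrite !E (eqtr_mul (@fpoly_psit p b j.+1 p0) (fun _ _ => erefl)) //.
rewrite -mulrA mulrCA; apply: (eqtr_mul (fun _ _ => erefl)) (ltnSn j) => i ij.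
by rewrite coef_ser_poly_mul // coef_poly ij h.
Qed.

Lemma size_fpoly (p : int) b : (size (fpoly p b) <= b.+1)%N.
Proof.
rewrite /fpoly; apply: (leq_trans (size_poly_prod_leq _ _)).
rewrite cardT size_enum_ord.
have : (\sum_(i < b) size (1 + qpow (p * (2 * i%:Z + 1 - b%:Z)) *: 'X)%R
    <= \sum_(i < b) 2)%N.
  apply: leq_sum => i _; apply: (leq_trans (size_polyD _ _)).
  rewrite geq_max size_poly1 /=; apply: (leq_trans (size_scale_leq _ _)).
  by rewrite size_polyX.
rewrite sum_nat_const card_ord.
by set S := (\sum_(i < b) _)%N; lia.
Qed.

Lemma fpoly_big (p : int) b i : (b < i)%N -> (fpoly p b)`_i = 0.
Proof. by move=> bi; rewrite nth_default // (leq_trans (size_fpoly p b)). Qed.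

(** The coefficients of the two outermost factors are inverse to each other, so their product is a
    palindromic quadratic: the inductive step for [fpoly_sym]. *)
Lemma fpolySS (p : int) b : let s := qpow (p * b.+1%:Z) + qpow (- (p * b.+1%:Z)) in
  fpoly p b.+2 = fpoly p b * (1 + s *: 'X + 'X^2).
Proof.
rewrite /= /fpoly big_ord_recl big_ord_recr /=.
rewrite (eq_bigr (fun r : 'I_b => 1 + qpow (p * (2 * r%:Z + 1 - b%:Z)) *: 'X));
  last first.
  by move=> r _; congr (1 + qpow (p * _) *: _); rewrite /= /bump leq0n; lia.
set P := \prod_(_ < _) _; rewrite mulrCA; congr (P * _).
have -> : p * (2 * 0%N%:Z + 1 - b.+2%:Z) = - (p * b.+1%:Z) by rewrite -mulrN;
  congr (p * _); lia.
have -> : p * (2 * (bump 0 b)%:Z + 1 - b.+2%:Z) = p * b.+1%:Z.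
  by congr (p * _); rewrite /bump leq0n; lia.
have e : qpow (- (p * b.+1%:Z)) * qpow (p * b.+1%:Z) = 1 by rewrite -qpowD addNr qpow0.
rewrite mulrDl mul1r mulrDr mulr1 -scalerAl -scalerAr scalerA e scale1r -expr2.
by rewrite scalerDl !addrA.
Qed.

Lemma fpoly_sym (p : int) b i j : (i + j)%N = b -> (fpoly p b)`_i = (fpoly p b)`_j.
Proof.
elim/ltn_ind: b i j => -[|[|b]] IH i j.
- by case: i j => [|i] [|j].
- move=> ij; have -> : fpoly p 1 = 1 + 'X.
    rewrite /fpoly big_ord_recl big_ord0 mulr1 (_ : p * _ = 0) ?qpow0 ?scale1r //.
    by rewrite -[RHS](mulr0 p); congr (p * _).
  rewrite !coefD !coef1 !coefX.
  by case: i j ij => [|[|i]] [|[|j]].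
wlog: i j / (i <= j)%N.
  move=> W ij; case: (leqP i j) => [/W|/ltnW /W]; first exact.
  by rewrite addnC => /(_ ij).
move=> le_ij ij; rewrite fpolySS.
rewrite !mulrDr !mulr1 !coefD -!scalerAr !coefZ !coefMX !coefMXn.
case: i le_ij ij => [|[|i]] le_ij ij /=.
- have -> : j = b.+2 by lia.
  rewrite /= (@fpoly_big _ _ b.+2) // (@fpoly_big _ _ b.+1) //.
  by rewrite subSS subn1 (IH b _ 0%N b) //; ring.
- have -> : j = b.+1 by lia.
  case: b IH ij le_ij => [|b] IH ij le_ij /=; first by [].
  by rewrite !subSS subn0 (@fpoly_big _ _ b.+2) // (IH b.+1 _ 0%N b.+1) // (IH b.+1 _
    1%N b) //; ring.
case: j le_ij ij => [|[|j]] // _ ij /=; rewrite !subSS !subn0.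
rewrite (IH b _ i j.+2) ?(IH b _ i.+1 j.+1) ?(IH b _ i.+2 j) //; first ring; lia.
Qed.

Lemma fpoly_rev (p : int) b i : (i <= b)%N -> (fpoly p b)`_i = (fpoly p b)`_(b - i).
Proof. by move=> ib; apply: fpoly_sym; rewrite subnKC. Qed.

Section Dilogarithm.
Context (n : nat).
Local Notation V := 'rV[int]_n.
Implicit Types (x y z a b c v : V) (f g h : V -> rat) (P : V -> Prop) (k : 'I_n).

Definition on_axis k : pred V := fun x => x == x 0 k *: unitv k.

Definition dilog (p : int) k : V -> rat :=
  fun x => if vpos x && on_axis k x then psi p (absz (x 0 k)) else 0.

Lemma on_axisP k x : reflect (exists m : int, x = m *: unitv k) (on_axis k x).
Proof.
apply: (iffP eqP) => [e|[m ->]]; first by exists (x 0 k).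
by rewrite mxE unitvE eqxx mulr1.
Qed.

Lemma on_axis0 k : on_axis k 0.
Proof. by apply/on_axisP; exists 0; rewrite scale0r. Qed.

Lemma on_axis_inj i k x : x != 0 -> on_axis i x -> on_axis k x -> i = k.
Proof.
move=> x0 /eqP ei /eqP ek; apply/eqP; apply: contraT => ik.
have : x 0 i = 0 by rewrite ek mxE unitvE eq_sym (negPf ik) mulr0.
by move=> xi; move: x0; rewrite ei xi scale0r eqxx.
Qed.

Lemma addclosed_axis k : addclosed (on_axis k).
Proof.
move=> x y /on_axisP[a ->] /on_axisP[b ->]; apply/on_axisP.
by exists (a + b); rewrite scalerDl.
Qed.

Lemma pos_dilog p k : pos (dilog p k).
Proof. by move=> x; rewrite /dilog; case: (vpos x); rewrite ?eqxx. Qed.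

Lemma supp_dilog p k : supp (dilog p k) (on_axis k).
Proof. by move=> x; rewrite /dilog; case: (on_axis k x); rewrite ?andbF ?eqxx. Qed.

Lemma dilogE p k (m : nat) : dilog p k (m%:Z *: unitv k) = psi p m.
Proof.
rewrite /dilog vpos_scale ?vpos_unitv //= (_ : on_axis _ _); last by apply/on_axisP;
  exists m.
by rewrite mxE unitvE eqxx mulr1.
Qed.

Lemma unip_dilog p k : unip (dilog p k).
Proof.
split; first exact: pos_dilog.
by rewrite -[0](scale0r (unitv k)) (dilogE p k 0).
Qed.

(** Allows the weights of two walls to be compared through their first coefficients. With [A] and
    [B] the two powers of 2, the hypothesis becomes [(A - B) (A B + 1) = 0]. *)
Lemma psi1_inj (p r : int) : 0 < p -> 0 < r -> psi p 1 = psi r 1 -> p = r.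
Proof.
move=> p0 r0; rewrite /= !mulr0 qpow0 !mulr1 !mul1r => /invr_inj e.
apply: qpow_inj; move: e.
have := qpow_gt0 p; have := qpow_gt0 r.
have : qpow (- p) * qpow p = 1 by rewrite -qpowD addNr qpow0.
have : qpow (- r) * qpow r = 1 by rewrite -qpowD addNr qpow0.
move: (qpow p) (qpow r) (qpow (- p)) (qpow (- r)) => A B A' B' eB eA B0 A0 e.
have : (A - B) * (A * B + 1) = 0.
  have : (A' - A) * (A * B) = (B' - B) * (A * B) by rewrite e.
  have -> : (A' - A) * (A * B) = (A' * A) * B - A * A * B by ring.
  have -> : (B' - B) * (A * B) = A * (B' * B) - A * B * B by ring.
  by rewrite eA eB; lra.
have nz : A * B + 1 != 0 by rewrite gt_eqF // addr_gt0 // mulr_gt0.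
by move/eqP; rewrite mulf_eq0 (negPf nz) orbF subr_eq0 => /eqP.
Qed.

Lemma psi1_neq0 (p : int) : p != 0 -> psi p 1 != 0.
Proof.
move=> p0; rewrite /= !mulr0 qpow0 !mulr1 mul1r invr_eq0.
by apply: qpow_sub_neq0.
Qed.

Context (L : V -> V -> int) (sL : skew_form L).
Local Notation "f ** g" := (qmul L f g) (at level 40, left associativity).

Lemma scale_unitv_inj k : injective (fun i : nat => i%:Z *: unitv k).
Proof.
by move=> i j /rowP/(_ k); rewrite !mxE !eqxx !mulr1 => -[].
Qed.

Lemma mul_dilogl p k h x : pos h -> vpos x ->
  (dilog p k ** h) x = \sum_(i < (absz (x 0 k)).+1)
     psi p i * qpow (i%:Z * L (unitv k) x) * h (x - i%:Z *: unitv k).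
Proof.
move=> hp xp; pose r := [seq i%:Z *: unitv k | i <- iota 0 (absz (x 0 k)).+1].
rewrite (@qmul_supp _ L r) //; first last.
- move=> a da; have ap := pos_dilog da; have /eqP ae := supp_dilog da.
  move=> /hp /vposP/(_ k); rewrite 2!mxE => xa.
  have a0 : 0 <= a 0 k by apply/vposP.
  apply/mapP; exists (absz (a 0 k)); last by rewrite gez0_abs.
  by rewrite mem_iota; move: (a 0 k) (x 0 k) a0 xa => s t; lia.
- exact: pos_dilog.
- by rewrite map_inj_uniq ?iota_uniq //; apply: scale_unitv_inj.
rewrite big_map -[(absz (x 0 k)).+1]subn0 -/(index_iota 0 _) big_mkord;
  apply: eq_bigr => i _.
rewrite dilogE formBr // !formZl // formZr // formxx // !mulr0 subr0; ring.
Qed.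

Lemma mul_dilogr p k h x : pos h -> vpos x ->
  (h ** dilog p k) x = \sum_(i < (absz (x 0 k)).+1)
     psi p i * qpow (- (i%:Z * L (unitv k) x)) * h (x - i%:Z *: unitv k).
Proof.
move=> hp xp; pose r := [seq x - i%:Z *: unitv k | i <- iota 0 (absz (x 0 k)).+1].
rewrite (@qmul_supp _ L r) //; first last.
- move=> a /hp ap da; have xap := pos_dilog da; have /eqP ae := supp_dilog da.
  have a0 : 0 <= (x - a) 0 k by apply/vposP.
  have a1 : 0 <= a 0 k by apply/vposP.
  apply/mapP; exists (absz ((x - a)%R 0%R k));
    last by rewrite gez0_abs // -ae opprB [x + (_ - x)]addrC subrK.
  rewrite mem_iota; move: a0; rewrite 2!mxE; move: (a 0 k) (x 0 k) a1 => s t; lia.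
- exact: pos_dilog.
- by rewrite map_inj_uniq ?iota_uniq // => a b /addrI /oppr_inj /scale_unitv_inj.
rewrite big_map -[(absz (x 0 k)).+1]subn0 -/(index_iota 0 _) big_mkord;
  apply: eq_bigr => i _.
rewrite opprB [x + (_ - x)]addrC subrK dilogE formBl // !formZr // formZl // formxx //.
rewrite !mulr0 subr0 (formC sL x) mulrN; ring.
Qed.

Definition line_rel (p : int) k (bf : V -> int) h h' : Prop := forall x,
  (0 <= bf x -> h' x = \sum_(i < (absz (bf x)).+1)
                  (fpoly p (absz (bf x)))`_i * h (x - i%:Z *: unitv k)) /\
  (bf x <= 0 -> h x = \sum_(i < (absz (bf x)).+1)
                  (fpoly p (absz (bf x)))`_i * h' (x - i%:Z *: unitv k)).

Definition line x k (j : nat) : V := x + (j%:Z - x 0 k) *: unitv k.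

Lemma line_coord x k j : line x k j 0 k = j.
Proof. by rewrite !mxE eqxx eqxx mulr1 addrC subrK. Qed.

Lemma line_self x k : vpos x -> line x k (absz (x 0 k)) = x.
Proof. by move=> /vposP xp; rewrite /line gez0_abs // subrr scale0r addr0. Qed.

Lemma vpos_line x k j : vpos x -> vpos (line x k j).
Proof.
move=> /vposP xp; apply/vposP => i; rewrite /line mxE mxE unitvE.
case: eqP => [<-|_]; last by rewrite mulr0 addr0.
by rewrite mulr1 addrC subrK.
Qed.

Lemma line_sub x k j (i : nat) : (i <= j)%N ->
  line x k j - i%:Z *: unitv k = line x k (j - i).
Proof.
by move=> ij; rewrite /line -addrA -scalerBl; congr (_ + _ *: _); lia.
Qed.

Lemma line_line x k j l : line (line x k j) k l = line x k l.
Proof.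
rewrite {1}/line line_coord /line -addrA -scalerDl; congr (_ + _ *: _).
by lia.
Qed.

Lemma fpoly_sum_line (p : int) (b : nat) k h x : pos h -> vpos x ->
  \sum_(i < b.+1) (fpoly p b)`_i * h (x - i%:Z *: unitv k)
    = \sum_(i < (absz (x 0 k)).+1)
        (fpoly p b)`_i * h (line x k (absz (x 0 k) - i)).
Proof.
move=> hp xp; set j := absz (x 0 k).
have xk : x 0 k = j by rewrite gez0_abs //; apply/vposP.
pose F (i : nat) := (fpoly p b)`_i * h (x - i%:Z *: unitv k).
have ext N M : (N <= M)%N -> (forall i : nat, (N <= i)%N -> F i = 0) ->
    \sum_(i < N) F i = \sum_(i < M) F i.
  move=> NM H; rewrite -!(big_mkord xpredT) (big_cat_nat (leq0n N) NM) /=.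
  rewrite [X in _ + X]big1_seq ?addr0 // => i.
  by rewrite mem_index_iota => /andP[_ /andP[Ni _]]; apply: H.
transitivity (\sum_(i < j.+1) F i); last first.
  apply: eq_bigr => i _; rewrite /F -{1}(line_self k xp) -/j line_sub //.
  by have := ltn_ord i; lia.
rewrite (ext b.+1 (maxn b j).+1) ?(ext j.+1 (maxn b j).+1) //; try lia.
  move=> i ji; rewrite /F posE ?mulr0 //; apply/negP => /vposP/(_ k).
  by rewrite !mxE !eqxx mulr1 xk; lia.
by move=> i bi; rewrite /F fpoly_big // mul0r.
Qed.

(** Both products act along lines of direction [e_k], on which [bf] is constant. The twists are
    [Q^(-bf)] and [Q^bf], so each line is an instance of [line_conj] with [b = |bf x|], [h] and [h']
    being exchanged when [bf x] is negative. *)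
Lemma conj_line p k (bf : V -> int) h h' : p != 0 -> pos h -> pos h' ->
    (forall x, L x (unitv k) = p * bf x) ->
  (dilog p k ** h = h' ** dilog p k <-> line_rel p k bf h h').
Proof.
move=> p0 hp hp' bfE.
have bfl x j : bf (line x k j) = bf x.
  by apply: (mulfI p0); rewrite -!bfE /line formDl // formZl // formxx // mulr0 addr0.
have lE x : L (unitv k) x = - (p * bf x) by rewrite formC // bfE.
have ml x j : vpos x -> (dilog p k ** h) (line x k j) =
    \sum_(i < j.+1) psit p (- bf x) i * h (line x k (j - i)).
  move=> xp; rewrite mul_dilogl ?vpos_line // line_coord lE bfl.
  apply: eq_bigr => i _; rewrite line_sub; last by have := ltn_ord i; lia.
  by rewrite /psit; congr (_ * qpow _ * _); ring.
have mr x j : vpos x -> (h' ** dilog p k) (line x k j) =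
    \sum_(i < j.+1) psit p (bf x) i * h' (line x k (j - i)).
  move=> xp; rewrite mul_dilogr ?vpos_line // line_coord lE bfl.
  apply: eq_bigr => i _; rewrite line_sub; last by have := ltn_ord i; lia.
  by rewrite /psit; congr (_ * qpow _ * _); ring.
have npos x f : pos f -> ~~ vpos x -> forall i : nat, f (x - i%:Z *: unitv k) = 0.
  move=> fp nx i; apply: posE => //; apply: contraNN nx => xp.
  by rewrite -[x](subrK (i%:Z *: unitv k)) vposD // vpos_scale // vpos_unitv.
split=> [e x|lr].
  case: (boolP (vpos x)) => xp; last first.
    have nx f : pos f -> f x = 0 by move=> fp; apply: posE.
    split=> _; rewrite nx // big1 // => i _.
      by rewrite (npos x h) // mulr0.
    by rewrite (npos x h') // mulr0.
  have el j : \sum_(i < j.+1) psit p (- bf x) i * h (line x k (j - i))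
      = \sum_(i < j.+1) psit p (bf x) i * h' (line x k (j - i)).
    by rewrite -ml // -mr // e.
  split=> bx; rewrite fpoly_sum_line //.
    rewrite -{1}(line_self k xp).
    apply: (proj1 (line_conj (absz (bf x)) (fun j => h (line x k j))
                 (fun j => h' (line x k j)) p0)) => j.
    by rewrite gez0_abs.
  rewrite -{1}(line_self k xp).
  apply: (proj1 (line_conj (absz (bf x)) (fun j => h' (line x k j))
               (fun j => h (line x k j)) p0)) => j.
  by rewrite lez0_abs // opprK el.
apply: functional_extensionality => x.
case: (boolP (vpos x)) => xp; last by rewrite !posE //; apply: pos_mul.
rewrite -(line_self k xp) ml // mr //; set j := absz (x 0 k).
case: (lerP 0 (bf x)) => bx.
  have := proj2 (line_conj (absz (bf x)) (fun j => h (line x k j))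
               (fun j => h' (line x k j)) p0).
  rewrite gez0_abs //; apply => l.
  have [/(_ _) H _] := lr (line x k l); rewrite bfl in H.
  rewrite H // fpoly_sum_line ?vpos_line // line_coord /=.
  by apply: eq_bigr => i _; rewrite line_line.
have bx' := ltW bx.
have := proj2 (line_conj (absz (bf x)) (fun j => h' (line x k j))
             (fun j => h (line x k j)) p0).
rewrite lez0_abs // opprK => H; apply/esym; apply: H => l.
have [_ /(_ _) H] := lr (line x k l); rewrite bfl in H.
rewrite H // fpoly_sum_line ?vpos_line // line_coord /=.
by apply: eq_bigr => i _; rewrite line_line.
Qed.

End Dilogarithm.

(** * The cluster element of a form *)

Section ClusterElement.
Context (n : nat).
Local Notation V := 'rV[int]_n.
Implicit Types (x y z a b c v : V) (f g h : V -> rat) (k : 'I_n).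
Context (p : 'I_n -> int).

Definition cluster_element (L : V -> V -> int) g : Prop :=
  [/\ unip g,
      forall k x, vpos x -> on_axis k x -> g x = psi (p k) (absz (x 0 k))
    & forall x, vpos x -> x != 0 -> (forall k, ~~ on_axis k x) ->
      forall D, additive_fun D -> ldv L D (wall L (L x) g) x = 0].

Context (L : V -> V -> int) (sL : skew_form L).

(** Makes an arbitrary function unipotent, since the iteration of [cluster_step] starts from
    zero. *)
Definition normal f : V -> rat :=
  fun x => if x == 0 then 1 else if vpos x then f x else 0.

(** In degree [x], [ldv L vdeg (wall L (L x) g)] has coefficient [vdeg x] times [g x], plus a
    contribution of lower degrees; its vanishing therefore determines [g x]. *)
Definition cluster_step f : V -> rat := fun x =>
  if vpos x then
    if x == 0 then 1
    else if [pick k | on_axis k x] is Some k then psi (p k) (absz (x 0 k))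
    else normal f x - ldv L vdeg (wall L (L x) (normal f)) x / (vdeg x)%:~R
  else 0.

Lemma unip_normal f : unip (normal f).
Proof.
split=> [x|]; last by rewrite /normal eqxx.
rewrite /normal; case: (x =P 0) => [->|_]; first by rewrite vpos0.
by case: ifP; rewrite ?eqxx.
Qed.

Lemma additive_forml x : additive_fun (L x).
Proof. by move=> y z; rewrite formDr. Qed.

Lemma additive_vdeg : additive_fun (@vdeg n).
Proof. exact: vdegD. Qed.

Lemma contracting_cluster_step : contracting cluster_step.
Proof.
split=> [f x|d f f' ff x xp xd]; first by rewrite /cluster_step; case: (vpos x);
  rewrite ?eqxx.
rewrite /cluster_step xp; case: (x =P 0) => [_|/eqP x0]; first exact: erefl.
case: pickP => [k _|_]; first exact: erefl.
have dx := vdeg_gt0 xp x0.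
have nn : agree d (normal f) (normal f').
  by move=> y yp yd; rewrite /normal ff.
have [uf uf'] := (unip_normal f, unip_normal f').
have aL := additive_forml x.
have xd' : vdeg x <= d by lia.
have xx : L x x = 0 by rewrite formxx.
have ww := wall_agree sL (L x) uf uf' nn.
have := ldv_diff sL additive_vdeg (unip_wall sL aL _) (unip_wall sL aL _) ww xp x0 xd'.
rewrite (wall_diff sL uf uf' nn xp x0 xd' xx).
set l := ldv _ _ _ _; set l' := ldv _ _ _ _ => e.
have nz : (vdeg x)%:~R != 0 :> rat by rewrite intr_eq0 gt_eqF.
apply/eqP; rewrite -subr_eq0.
have -> : normal f x - l / (vdeg x)%:~R - (normal f' x - l' / (vdeg x)%:~R)
  = normal f x - normal f' x - (l - l') / (vdeg x)%:~R by field.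
by rewrite e mulrAC divff // mul1r subrr.
Qed.

Lemma cluster_element_exists : exists g, cluster_element L g.
Proof.
have cc := contracting_cluster_step.
pose g := fixser cluster_step; have gE x : g x = cluster_step g x by rewrite fixserE.
have ug : unip g.
  by split; [exact: pos_fixser | rewrite gE /cluster_step vpos0 eqxx].
have ng : normal g = g.
  apply: functional_extensionality => x; rewrite /normal; case: eqP => [->|_].
    by case: ug.
  case: ifPn => [_|nx]; first exact: erefl.
  by apply/esym/posE; [exact: (proj1 ug) | exact: nx].
exists g; split=> // [k x xp xk|x xp x0 xk D aD].
  case: (eqVneq x 0) => [->|x0]; first by rewrite mxE /= ; case: ug.
  rewrite gE /cluster_step xp (negPf x0); case: pickP => [j xj|/(_ k)].
    by rewrite (on_axis_inj x0 xj xk).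
  by rewrite xk.
have aL := additive_forml x.
have := gE x; rewrite /cluster_step xp (negPf x0).
case: pickP => [j|_]; first by rewrite (negPf (xk j)).
rewrite ng => e; have nz : (vdeg x)%:~R != 0 :> rat.
  by rewrite intr_eq0 gt_eqF ?vdeg_gt0.
have w0 : ldv L vdeg (wall L (L x) g) x = 0.
  have : ldv L vdeg (wall L (L x) g) x / (vdeg x)%:~R = 0 by move: e; lra.
  by move/eqP; rewrite mulf_eq0 invr_eq0 (negPf nz) orbF => /eqP.
have := @ldv_swap _ L sL _ D (wall L (L x) g) x additive_vdeg aD.
move=> /(_ (unip_wall sL aL g) (@supp_wall _ _ _ g)).
by rewrite w0 mulr0 => /eqP; rewrite mulf_eq0 (negPf nz) => /eqP.
Qed.

End ClusterElement.

(** * Walls after multiplication by a dilogarithm *)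

Section WallFactor.
Context (n : nat).
Local Notation V := 'rV[int]_n.
Implicit Types (x y z a b c v : V) (f g h : V -> rat) (k : 'I_n).
Context (L : V -> V -> int) (sL : skew_form L).
Local Notation "f ** g" := (qmul L f g) (at level 40, left associativity).
Context (th : V -> int) (ath : additive_fun th).

Lemma wall_mull f g : unip f -> unip g -> supp f (fun v => 0 <= th v) ->
  wall L th (f ** g) = rs (fun v => th v == 0) f ** wall L th g.
Proof.
move=> uf ug fp; rewrite -{1}(gsplitE sL th ug) qmulA //.
have un := unip_nnpart sL th g; have uz := unip_ngpart sL th g.
have sn := @supp_nnpart _ L th ath g.
rewrite wall_fact //.
- rewrite (@rs0_mul _ _ th ath _ _ 1) ?wallE //.
    by move=> v /fp; rewrite mul1r.
  by move=> v /sn; rewrite mul1r.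
- exact: unip_mul.
- by apply: supp_mul => //; apply: addclosed_nn.
exact: supp_ngpart.
Qed.

Lemma wall_mulr f g : unip f -> unip g -> supp f (fun v => th v <= 0) ->
  wall L th (g ** f) = wall L th g ** rs (fun v => th v == 0) f.
Proof.
move=> uf ug fp; rewrite -{1}(gsplitE sL th ug) -qmulA //.
have un := unip_nnpart sL th g; have uz := unip_ngpart sL th g.
have sz : supp (ngpart th (gsplit L th g)) (fun v => th v <= 0).
  by move=> v /supp_ngpart[->|/ltW //]; rewrite additive_fun0.
rewrite wall_mul //.
- rewrite -wallE //; congr (_ ** _).
  rewrite (@rs0_mul _ _ th ath _ _ (- 1)) //; last 2 first.
  + by move=> v /sz; lia.
  + by move=> v /fp; lia.
  have -> : rs (fun v => th v == 0) (ngpart th (gsplit L th g)) = one (n:=n).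
    apply: functional_extensionality => v; rewrite /rs /one.
    case: (v =P 0) => [->|/eqP v0]; first by rewrite additive_fun0 // eqxx /ngpart eqxx.
    case: eqP => // t0; apply/eqP; apply: contraT => /supp_ngpart[/eqP|].
      by rewrite (negPf v0).
    by rewrite t0.
  by rewrite qmul1f //; apply: pos_rs; case: uf.
- exact: unip_mul.
- exact: supp_nnpart.
by apply: supp_mul => //; apply: addclosed_np.
Qed.

Lemma th_dilog p k v : dilog p k v != 0 -> exists2 m : int, 0 <= m & th v = m * th
  (unitv k).
Proof.
move=> nz; have /vposP/(_ k) vk := pos_dilog nz.
have /eqP -> := supp_dilog nz; exists (v 0 k) => //.
by rewrite additive_funZ.
Qed.

Lemma supp_dilog_nn p k : 0 <= th (unitv k) -> supp (dilog p k) (fun v => 0 <= th v).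
Proof. by move=> t0 v /th_dilog[m m0 ->]; rewrite mulr_ge0. Qed.

Lemma supp_dilog_np p k : th (unitv k) <= 0 -> supp (dilog p k) (fun v => th v <= 0).
Proof. by move=> t0 v /th_dilog[m m0 ->]; rewrite mulr_ge0_le0. Qed.

Lemma rs_dilog p k : th (unitv k) != 0 ->
  rs (fun v => th v == 0) (dilog p k) = one (n:=n).
Proof.
move=> t0; apply: functional_extensionality => v; rewrite /rs /one.
case: (v =P 0) => [->|/eqP v0].
  by rewrite additive_fun0 // eqxx (proj2 (unip_dilog p k)).
case: eqP => // tv; apply/eqP; apply: contraT => nz; have [m m0 tm] := th_dilog nz.
have : m * th (unitv k) == 0 by rewrite -tm tv.
rewrite mulf_eq0 (negPf t0) orbF => /eqP m00; case/eqP: v0.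
have /eqP ve := supp_dilog nz; rewrite ve additive_funZ // in tm.
have : (v 0 k - m) * th (unitv k) == 0 by rewrite mulrBl tm subrr.
by rewrite mulf_eq0 (negPf t0) orbF m00 subr0 => /eqP vk; rewrite ve vk scale0r.
Qed.

(** The dilogarithm lives on the ray of [e_k], which meets [th = 0] only at 0, and it is absorbed by
    the factor supported on [th >= 0]. *)
Lemma wall_dilogl p k g : unip g -> 0 < th (unitv k) ->
  wall L th (dilog p k ** g) = wall L th g.
Proof.
move=> ug t0; rewrite wall_mull ?rs_dilog ?gt_eqF //; last 2 first.
- exact: unip_dilog.
- by apply: supp_dilog_nn => //; apply: ltW.
by rewrite qmul1f //; case: (unip_wall sL ath g).
Qed.

Lemma wall_dilogr p k g : unip g -> th (unitv k) < 0 ->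
  wall L th (g ** dilog p k) = wall L th g.
Proof.
move=> ug t0; rewrite wall_mulr ?rs_dilog ?lt_eqF //; last 2 first.
- exact: unip_dilog.
- by apply: supp_dilog_np => //; apply: ltW.
by rewrite qmulf1 //; case: (unip_wall sL ath g).
Qed.

End WallFactor.

Section LdvDilog.
Context (n : nat).
Local Notation V := 'rV[int]_n.
Implicit Types (x y z a b c v : V) (f g h : V -> rat) (k : 'I_n).
Context (L : V -> V -> int) (sL : skew_form L).
Local Notation "f ** g" := (qmul L f g) (at level 40, left associativity).

Lemma ldv_rs_dilog D p k x : ~~ on_axis k x ->
  ldv L D (rs (fun v => L x v == 0) (dilog p k)) x = 0.
Proof.
move=> nx; apply/eqP; apply: contraNT nx.
apply: (@supp_ldv _ L sL D _ (fun v => on_axis k v)).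
- by apply: unip_rs; [rewrite form0r | exact: unip_dilog].
- by apply: supp_rsW; apply: supp_dilog.
- exact: on_axis0.
exact: addclosed_axis.
Qed.

(** The dilogarithm may survive on the wall when [L x (unitv k) = 0], but its logarithmic derivative
    is zero off its axis, and additivity in degree [x] discards it. *)
Lemma ldv_dilogl D p k g x : additive_fun D -> unip g -> 0 <= L x (unitv k) ->
    ~~ on_axis k x ->
  ldv L D (wall L (L x) (dilog p k ** g)) x = ldv L D (wall L (L x) g) x.
Proof.
move=> aD ug Lk nx; have aL := additive_forml sL x.
rewrite wall_mull //; last 2 first.
- exact: unip_dilog.
- exact: supp_dilog_nn.
rewrite ldv_mul ?ldv_rs_dilog ?add0r //.
- by apply: unip_rs; [rewrite form0r | exact: unip_dilog].
- exact: unip_wall.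
- exact: supp_rs.
exact: supp_wall.
Qed.

Lemma ldv_dilogr D p k g x : additive_fun D -> unip g -> L x (unitv k) <= 0 ->
    ~~ on_axis k x ->
  ldv L D (wall L (L x) (g ** dilog p k)) x = ldv L D (wall L (L x) g) x.
Proof.
move=> aD ug Lk nx; have aL := additive_forml sL x.
rewrite wall_mulr //; last 2 first.
- exact: unip_dilog.
- exact: supp_dilog_np.
rewrite ldv_mul ?ldv_rs_dilog ?addr0 //.
- exact: unip_wall.
- by apply: unip_rs; [rewrite form0r | exact: unip_dilog].
- exact: supp_wall.
exact: supp_rs.
Qed.

End LdvDilog.

(** * Change of variables by a linear involution *)

Section Transport.
Context (n : nat).
Local Notation V := 'rV[int]_n.
Implicit Types (x y z a b c v : V) (f g h : V -> rat) (k : 'I_n).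
Context (L L' : V -> V -> int) (sL : skew_form L) (sL' : skew_form L').
Context (A : V -> V) (AD : forall x y, A (x + y) = A x + A y).
Context (AK : forall x, A (A x) = x).
Context (LA : forall x y, L' x y = L (A x) (A y)).
Context (P : V -> Prop) (P0 : P 0) (Pa : addclosed P).
Context (Ppos : forall x, P x -> vpos x) (PA : forall x, P (A x) -> vpos x).

Local Notation "f \oA" := (fun x => f (A x)) (at level 10).

Lemma pos_transport f : supp f P -> pos (f \oA).
Proof. by move=> fP x /fP /PA. Qed.

Lemma transport0 : A 0 = 0.
Proof. by have := AD 0 0; rewrite addr0 => /(congr1 (fun t => t - A 0));
  rewrite addrK subrr. Qed.

Lemma transportB x y : A (x - y) = A x - A y.
Proof. by apply: (addIr (A y)); rewrite -AD !subrK. Qed.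

Lemma unip_transport f : supp f P -> unip f -> unip (f \oA).
Proof. by move=> fP [fp f0]; split; [exact: pos_transport | rewrite transport0]. Qed.

(** [A] need not preserve the nonnegative orthant. The two sums agree because the supports lie in
    [P], whose elements are nonnegative before and after applying [A]. *)
Lemma qmul_transport f g : supp f P -> supp g P ->
  qmul L' (f \oA) (g \oA) = (qmul L f g) \oA.
Proof.
move=> fP gP; apply: functional_extensionality => x.
rewrite (@qmul_supp _ L' [seq A b | b <- box (A x)]).
- rewrite big_map; apply: eq_bigr => b _.
  by rewrite LA transportB AK.
- by rewrite map_inj_uniq ?box_uniq //; apply: can_inj AK.
- exact: pos_transport.
- exact: pos_transport.
move=> a fa ga; apply/mapP; exists (A a); last by rewrite AK.
by rewrite mem_box -transportB !Ppos //; [apply: gP|apply: fP].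
Qed.

Lemma one_transport : (one (n:=n)) \oA = one (n:=n).
Proof.
apply: functional_extensionality => x; rewrite /one.
suff -> : (A x == 0) = (x == 0) by [].
by apply/eqP/eqP => [e|->]; [rewrite -[x]AK e transport0 | rewrite transport0].
Qed.

Lemma qinv_transport f : supp f P -> unip f -> qinv L' (f \oA) = (qinv L f) \oA.
Proof.
move=> fP uf; apply/esym/qinv_unique => //; first exact: unip_transport.
  by apply: pos_transport; apply: supp_qinv.
rewrite qmul_transport //; last exact: supp_qinv.
by rewrite qmulfV // one_transport.
Qed.

Lemma ldv_transport D f : supp f P -> unip f ->
  ldv L' D (f \oA) = (ldv L (fun x => D (A x)) f) \oA.
Proof.
move=> fP uf; rewrite /ldv qinv_transport //.
have -> : der D (f \oA) = (der (fun x => D (A x)) f) \oA.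
  by apply: functional_extensionality => x; rewrite /der AK.
by rewrite qmul_transport //; [apply: supp_qinv | apply: supp_der].
Qed.

Lemma wall_transport th f : additive_fun th -> supp f P -> unip f ->
  wall L' (fun x => th (A x)) (f \oA) = (wall L th f) \oA.
Proof.
move=> ath fP uf; rewrite [wall L th f]wallE // -{1}(gsplitE sL th uf).
have sg : supp (gsplit L th f) P by apply: supp_gsplit.
have sn : supp (nnpart th (gsplit L th f)) P.
  move=> x; rewrite /nnpart; case: (x =P 0) => [->//|_].
  by case: ifP => [_ /sg|]; rewrite ?eqxx.
have sz : supp (ngpart th (gsplit L th f)) P.
  move=> x; rewrite /ngpart; case: (x =P 0) => [->//|_].
  by case: ifP => [|_ /sg]; rewrite ?eqxx.
rewrite -qmul_transport // wall_fact //.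
- by move=> x y; rewrite AD ath.
- by apply: unip_transport => //; apply: unip_nnpart.
- by apply: unip_transport => //; apply: unip_ngpart.
- by move=> x /supp_nnpart; apply.
move=> x /supp_ngpart[e|]; last by right.
by left; rewrite -[x]AK e transport0.
Qed.

End Transport.

(** * Mutation of the cluster element *)

Section Mutation.
Context (n : nat).
Local Notation V := 'rV[int]_n.
Implicit Types (x y z a b c v : V) (f g h : V -> rat).
Context (L : V -> V -> int) (sL : skew_form L).
Context (p : 'I_n -> int) (p_gt0 : forall i, 0 < p i) (k : 'I_n).
Context (bf : V -> int) (bfE : forall x, L x (unitv k) = p k * bf x).

Local Notation ek := (unitv k).
Local Notation E := (dilog (p k) k).

Lemma bf_additive : additive_fun bf.
Proof.
move=> x y; apply: (mulfI (lt0r_neq0 (p_gt0 k))).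
by rewrite mulrDr -!bfE formDl.
Qed.

Lemma bf_ek : bf ek = 0.
Proof.
have /eqP := bfE ek; rewrite formxx // eq_sym mulf_eq0 gt_eqF //=.
by move/eqP.
Qed.

(* [wt 1] and [wt (-1)] are the linear extensions of the positive and of the
   negative part of the exchange coefficients, and [refl 1], [refl (-1)] the
   two corresponding changes of basis: both turn the form of the seed into the
   form of the mutated seed. *)
Definition wt (s : int) x : int :=
  \sum_i x 0 i * Num.max (s * bf (unitv i)) 0.
Definition refl (s : int) x : V := x + (wt s x - 2 * x 0 k) *: ek.
(** Blind to [ek], hence constant on the lines along which the two quotients of [g] are related; the
    induction on their supports runs over it. *)
Definition offdeg x : int := vdeg x - x 0 k.

Lemma wt_additive s : additive_fun (wt s).
Proof.
by move=> x y; rewrite /wt -big_split; apply: eq_bigr => i _; rewrite mxE mulrDl.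
Qed.

Lemma wt_ge0 s x : vpos x -> 0 <= wt s x.
Proof.
move=> /vposP xp; apply: sumr_ge0 => i _; rewrite mulr_ge0 //.
by rewrite le_max lexx orbT.
Qed.

Lemma wt_unitv s i : wt s (unitv i) = Num.max (s * bf (unitv i)) 0.
Proof.
rewrite /wt (bigD1 i) //= unitvE eqxx mul1r big1 ?addr0 // => j ji.
by rewrite unitvE eq_sym (negPf ji) mul0r.
Qed.

Lemma wt_ek s : wt s ek = 0.
Proof. by rewrite wt_unitv bf_ek mulr0. Qed.

Lemma wtE x : bf x = wt 1 x - wt (-1) x.
Proof.
have aZ : bf x = \sum_i x 0 i * bf (unitv i).
  rewrite [in LHS](row_unitv x).
  have -> : forall r : seq 'I_n, bf (\sum_(i <- r) x 0 i *: unitv i)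
      = \sum_(i <- r) x 0 i * bf (unitv i).
    elim=> [|i r IH]; first by rewrite !big_nil additive_fun0 //; apply: bf_additive.
    by rewrite !big_cons bf_additive IH additive_funZ //; apply: bf_additive.
  by [].
rewrite aZ /wt -sumrB; apply: eq_bigr => i _; rewrite -mulrBr; congr (_ * _).
by rewrite mul1r mulN1r; lia.
Qed.

Lemma coordD x y i : (x + y) 0 i = x 0 i + y 0 i. Proof. by rewrite mxE. Qed.
Lemma coord_scale (m : int) i j : (m *: unitv j : V) 0 i = m * (j == i)%:R.
Proof. by rewrite mxE unitvE. Qed.

Lemma reflD s x y : refl s (x + y) = refl s x + refl s y.
Proof.
rewrite /refl wt_additive coordD addrACA -scalerDl; congr (_ + _ *: _); ring.
Qed.

Lemma wt_refl s t x : wt s (refl t x) = wt s x.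
Proof. by rewrite wt_additive additive_funZ ?wt_ek ?mulr0 ?addr0 //;
  apply: wt_additive. Qed.

Lemma refl_coord s x : refl s x 0 k = wt s x - x 0 k.
Proof. by rewrite coordD coord_scale eqxx mulr1; ring. Qed.

Lemma refl_coord_neq s x i : i != k -> refl s x 0 i = x 0 i.
Proof. by move=> ik; rewrite coordD coord_scale eq_sym (negPf ik) mulr0 addr0. Qed.

Lemma reflK s x : refl s (refl s x) = x.
Proof.
rewrite {1}/refl wt_refl refl_coord /refl -addrA -scalerDl.
have -> : wt s x - 2 * x 0 k + (wt s x - 2 * (wt s x - x 0 k)) = 0 by ring.
by rewrite scale0r addr0.
Qed.

Lemma refl_ek s : refl s ek = - ek.
Proof.
rewrite /refl wt_ek unitvE eqxx mulr1 sub0r scaleNr scaler_nat mulr2n opprD addrA.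
by rewrite subrr sub0r.
Qed.

Lemma refl_swap x : refl (-1) x = refl 1 x - bf x *: ek.
Proof. by rewrite /refl wtE -addrA -scalerBl; congr (_ + _ *: _); ring. Qed.

Definition mutform x y : int := L (refl 1 x) (refl 1 y).

Lemma skew_mutform : skew_form mutform.
Proof.
split=> [x y z|x y]; rewrite /mutform; last exact: formC.
by rewrite reflD formDl.
Qed.

(** The two reflections differ by the transvection sending [x] to [x - bf x *: ek], which preserves
    [L]. *)
Lemma mutform_refl s : s = 1 \/ s = -1 ->
  forall x y, mutform x y = L (refl s x) (refl s y).
Proof.
case=> -> // x y;
  rewrite /mutform !refl_swap formBl // !formBr // !formZl // !formZr //.
rewrite formxx // (formC sL ek) !bfE {2 4}/refl !bf_additive !additive_funZ ?bf_ek;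
  last 2 first.
- exact: bf_additive.
- exact: bf_additive.
by ring.
Qed.

Lemma offdegD : additive_fun offdeg.
Proof. by move=> x y; rewrite /offdeg vdegD coordD; ring. Qed.

Lemma vdeg_unitv i : vdeg (unitv i : V) = 1.
Proof.
rewrite /vdeg (bigD1 i) //= unitvE eqxx big1 ?addr0 // => j ji.
by rewrite unitvE eq_sym (negPf ji).
Qed.

Lemma offdeg_ek : offdeg ek = 0.
Proof. by rewrite /offdeg vdeg_unitv unitvE eqxx subrr. Qed.

Lemma offdeg_ge0 x : vpos x -> 0 <= offdeg x.
Proof.
move=> /vposP xp; rewrite /offdeg /vdeg (bigD1 k) //= addrAC subrr add0r.
exact: sumr_ge0.
Qed.

Lemma offdeg0 x : vpos x -> offdeg x = 0 -> on_axis k x.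
Proof.
move=> /vposP xp; rewrite /offdeg /vdeg (bigD1 k) //= addrAC subrr add0r => /eqP.
rewrite psumr_eq0 => [/allP H|i _]; last exact: xp.
apply/eqP/rowP => i; rewrite coord_scale; case: (eqVneq k i) => [->|ki].
  by rewrite mulr1.
by have := H i; rewrite mem_index_enum eq_sym ki mulr0 => /(_ isT) /eqP.
Qed.

Lemma on_axis_offdeg x : on_axis k x -> offdeg x = 0.
Proof.
by move=> /on_axisP[m ->]; rewrite additive_funZ ?offdeg_ek ?mulr0 //; apply: offdegD.
Qed.

Lemma offdeg_subek x (m : int) : offdeg (x - m *: ek) = offdeg x.
Proof.
rewrite additive_funB ?additive_funZ ?offdeg_ek ?mulr0 ?subr0 //; exact: offdegD.
Qed.

Lemma wt_subek s x (m : int) : wt s (x - m *: ek) = wt s x.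
Proof.
rewrite additive_funB ?additive_funZ ?wt_ek ?mulr0 ?subr0 //; exact: wt_additive.
Qed.

Lemma coord_subek x (m : int) : (x - m *: ek) 0 k = x 0 k - m.
Proof. by rewrite -scaleNr coordD coord_scale eqxx mulr1. Qed.

(** Coordinate [k] of [refl s x] is [wt s x - x 0 k], so these are the nonnegative vectors that
    [refl s] keeps nonnegative; [conedeg s d] imposes this only below off-axis degree [d]. *)
Definition cone (s : int) x : Prop := vpos x /\ x 0 k <= wt s x.
Definition conedeg (s d : int) x : Prop :=
  vpos x /\ (x 0 k <= wt s x \/ d <= offdeg x).

Lemma cone0 s : cone s 0.
Proof. by split; rewrite ?vpos0 // mxE additive_fun0 //; apply: wt_additive. Qed.

Lemma coneD s : addclosed (cone s).
Proof.
by move=> x y [xp xs] [yp ys]; split; rewrite ?vposD // coordD wt_additive lerD.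
Qed.

Lemma conedeg0 s d : conedeg s d 0.
Proof. by have [? ?] := cone0 s; split=> //; left. Qed.

Lemma conedegD s d : addclosed (conedeg s d).
Proof.
move=> x y [xp xs] [yp ys]; split; first exact: vposD.
have := offdeg_ge0 xp; have := offdeg_ge0 yp.
by rewrite offdegD wt_additive coordD; lia.
Qed.

Lemma cone_refl s x : cone s (refl s x) -> vpos x.
Proof.
move=> [/vposP xp]; rewrite refl_coord wt_refl => xk; apply/vposP => i.
case: (eqVneq i k) => [->|ik]; first by move: xk; lia.
by have := xp i; rewrite refl_coord_neq.
Qed.

(** A summand of off-axis degree 0 has nonpositive coordinate [k] and vanishes. Otherwise both
    summands have off-axis degree below [d], so they lie in the cone, and so would [x]. *)
Lemma conedeg_indec s d x a : offdeg x = d -> 0 < d -> wt s x < x 0 k ->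
  conedeg s d a -> conedeg s d (x - a) -> a != 0 -> a != x -> False.
Proof.
move=> xd d0 xk [ap aP] [bp bP] a0 ax.
have b0 : x - a != 0 by rewrite subr_eq0 eq_sym.
have off0 y : vpos y -> offdeg y = 0 -> y 0 k <= wt s y -> y = 0.
  move=> yp y0 yk; have /eqP ye := offdeg0 yp y0; move: yk.
  rewrite {2}ye additive_funZ ?wt_ek ?mulr0 //; last exact: wt_additive.
  move=> yk; have /vposP/(_ k) yk' := yp.
  have -> : y = y 0 k *: ek by [].
  have -> : y 0 k = 0 by apply/eqP; rewrite eq_le yk yk'.
  by rewrite scale0r.
have xE : x = (x - a) + a by rewrite subrK.
move: (x - a) xE bp bP b0 => b xE bp bP b0.
have oa := offdeg_ge0 ap; have ob := offdeg_ge0 bp.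
move: xk xd; rewrite xE wt_additive coordD offdegD => xk xd.
case: (eqVneq (offdeg a) 0) => oa0.
  by case: aP => [wa|da]; [case/eqP: a0; apply: off0 | lia].
case: bP => [wb|db]; last by lia.
case: (eqVneq (offdeg b) 0) => ob0; first by case/eqP: b0; apply: off0.
case: aP => [wa|da]; last by lia.
by move: wa wb xk; move: (a 0 k) (b 0 k) (wt s a) (wt s b) => *; lia.
Qed.

Section Element.
Context (g : V -> rat) (cg : cluster_element p L g).
Local Notation "f ** g" := (qmul L f g) (at level 40, left associativity).
Let h := qinv L E ** g.
Let h' := g ** qinv L E.

Let ug : unip g. Proof. by case: cg. Qed.
Let uE : unip E. Proof. exact: unip_dilog. Qed.
Let uh : unip h. Proof. exact: unip_mul (unip_qinv sL uE) ug. Qed.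
Let uh' : unip h'. Proof. exact: unip_mul ug (unip_qinv sL uE). Qed.
Let Eh : E ** h = g. Proof. by rewrite qmulVKf //; case: ug. Qed.
Let hE : h' ** E = g. Proof. by rewrite qmulfVK //; case: ug. Qed.
Let pk0 : p k != 0. Proof. exact: lt0r_neq0. Qed.

Let lr : line_rel (p k) k bf h h'.
Proof.
apply/(conj_line sL pk0 (proj1 uh) (proj1 uh') bfE).
by rewrite Eh hE.
Qed.

(** Off-axis degree 0 is a face of the orthant, so restriction to it is multiplicative; [g]
    restricts to [E], and its quotient by [E] to 1. *)
Let axis_one (y : V -> rat) : unip y -> (E ** y = g \/ y ** E = g) ->
  forall x, vpos x -> offdeg x = 0 -> y x = one (n:=n) x.
Proof.
move=> uy H x xp x0.
pose r := rs (fun v => offdeg v == 0).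
have spos f : pos f -> supp f (fun v => 0 <= 1 * offdeg v).
  by move=> fp v /fp vp; rewrite mul1r offdeg_ge0.
have rE : r E = E.
  by apply: rs_id => v /supp_dilog /on_axis_offdeg ->.
have rg : r g = E.
  apply: functional_extensionality => v; rewrite /r /rs /dilog.
  case: (boolP (vpos v)) => vp /=; last by rewrite posE ?if_same //; case: ug.
  case: ifPn => [/eqP o0|o0].
    by have [_ axg _] := cg; have xk := offdeg0 vp o0; rewrite (axg k) ?xk.
  by rewrite ifN //; apply: contraNN o0 => /on_axis_offdeg ->.
have ur : unip (r y) by apply: unip_rs; rewrite // additive_fun0 //; apply: offdegD.
have yp := proj1 uy; have Ep := proj1 uE.
suff : r y = one (n:=n) by move=> /(congr1 (@^~ x)); rewrite /r /rs x0 eqxx.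
case: H => [e|e].
  apply: (qmulfI sL uE) (proj1 ur) (@pos_one n) _; rewrite qmulf1 //.
  by rewrite -{1}rE -(@rs0_mul _ L offdeg offdegD _ _ 1) ?e //; apply: spos.
have ye : r y ** E = E.
  by rewrite -{1}rE -(@rs0_mul _ L offdeg offdegD _ _ 1) ?e //; apply: spos.
by rewrite -[r y](qmulfK sL uE) ?ye ?qmulfV //; case: ur.
Qed.

(** By indecomposability, the wall function in degree [x] is [y x], and its logarithmic derivative
    is [vdeg x] times that. The absence of an incoming wall of [g] then kills [y x]. *)
Let core s d (y : V -> rat) : unip y -> supp y (conedeg s d) -> 0 < d ->
  forall x, vpos x -> offdeg x = d -> wt s x < x 0 k ->
  (forall D, additive_fun D -> ~~ on_axis k x ->
     ldv L D (wall L (L x) g) x = ldv L D (wall L (L x) y) x) ->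
  y x = 0.
Proof.
move=> uy sy d0 x xp xd xk H.
have nax i : ~~ on_axis i x.
  apply/negP => xi; case: (eqVneq i k) => [ik|ik].
    by move: xd; rewrite on_axis_offdeg -?ik //; lia.
  move: xi => /eqP xi; move: xk; rewrite xi coord_scale (negPf ik) mulr0 -xi.
  by have := wt_ge0 s xp; lia.
have x0 : x != 0 by apply: contraTneq xk => ->; rewrite mxE additive_fun0 //;
  apply: wt_additive.
have xx : L x x = 0 by rewrite formxx.
have aL := additive_forml sL x.
have ind a : conedeg s d a -> conedeg s d (x - a) -> a != 0 -> a != x -> False.
  exact: conedeg_indec.
have [_ _ /(_ x xp x0 nax vdeg (@additive_vdeg n))] := cg.
rewrite H //; last exact: additive_vdeg.
rewrite (ldv_indec sL (@additive_vdeg n) (unip_wall sL aL y)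
   (supp_wallW sL uy sy (conedeg0 s d) (@conedegD s d)) (conedeg0 s d)
   (@conedegD s d) xp x0 ind).
rewrite (wall_indec sL uy sy (conedeg0 s d) (@conedegD s d) xp x0 xx ind).
move/eqP; rewrite mulf_eq0 intr_eq0 gt_eqF ?vdeg_gt0 //=.
by move/eqP.
Qed.

Let Lek x : L x ek = p k * bf x. Proof. exact: bfE. Qed.

(** For [bf x >= 0], removing [E] on the left preserves the condition at [x], and [core] applies to
    [h]; likewise for [h'] when [bf x <= 0]. For the other signs, the line relation expresses one
    quotient by values of the other just shown to vanish. *)
Let cone_step d : 0 < d ->
  supp h (conedeg (-1) d) -> supp h' (conedeg 1 d) ->
  supp h (conedeg (-1) (d + 1)) /\ supp h' (conedeg 1 (d + 1)).
Proof.
move=> d0 sh sh'.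
have ch x : vpos x -> offdeg x = d -> wt (-1) x < x 0 k -> 0 <= bf x -> h x = 0.
  move=> xp xd xk bx; apply: (core uh sh d0 xp xd xk) => D aD nx.
  by rewrite -{1}Eh ldv_dilogl // Lek mulr_ge0 // ltW.
have ch' x : vpos x -> offdeg x = d -> wt 1 x < x 0 k -> bf x <= 0 -> h' x = 0.
  move=> xp xd xk bx; apply: (core uh' sh' d0 xp xd xk) => D aD nx.
  by rewrite -{1}hE ldv_dilogr // Lek mulr_ge0_le0 // ltW.
split=> x nz.
  have [xp xc] := sh x nz; split=> //.
  case: (lerP (x 0 k) (wt (-1) x)) => xk; first by left.
  right; case: (eqVneq (offdeg x) d) => [xd|]; last by lia.
  exfalso; case: (lerP 0 (bf x)) => bx; first by rewrite ch ?eqxx in nz.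
  have [_ /(_ (ltW bx)) e] := lr x; move: nz; rewrite e big1 ?eqxx // => i _.
  have [->|nz] := eqVneq (h' (x - i%:Z *: ek)) 0; first by rewrite mulr0.
  have [xp' _] := sh' _ nz; case/eqP: nz; apply: ch' => //.
  - by rewrite offdeg_subek.
  (* As [i <= |bf x|] and [wt 1 x = wt (-1) x + bf x], each point of the sum stays outside the cone
     of the other quotient. *)
  - have bE := wtE x; have := ltn_ord i.
    rewrite wt_subek coord_subek; lia.
  rewrite additive_funB ?additive_funZ ?bf_ek ?mulr0 ?subr0; try exact: bf_additive.
  exact: ltW.
have [xp xc] := sh' x nz; split=> //.
case: (lerP (x 0 k) (wt 1 x)) => xk; first by left.
right; case: (eqVneq (offdeg x) d) => [xd|]; last by lia.
exfalso; case: (lerP (bf x) 0) => bx; first by rewrite ch' ?eqxx in nz.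
have [/(_ (ltW bx)) e _] := lr x; move: nz; rewrite e big1 ?eqxx // => i _.
have [->|nz] := eqVneq (h (x - i%:Z *: ek)) 0; first by rewrite mulr0.
have [xp' _] := sh _ nz; case/eqP: nz; apply: ch => //.
- by rewrite offdeg_subek.
- have bE := wtE x; have := ltn_ord i.
  rewrite wt_subek coord_subek; lia.
rewrite additive_funB ?additive_funZ ?bf_ek ?mulr0 ?subr0; try exact: bf_additive.
exact: ltW.
Qed.

Let cone_start : supp h (conedeg (-1) 1) /\ supp h' (conedeg 1 1).
Proof.
have st s (y : V -> rat) : unip y -> (E ** y = g \/ y ** E = g) -> supp y (conedeg s 1).
  move=> uy H x nz; have xp := proj1 uy _ nz; split=> //.
  case: (eqVneq (offdeg x) 0) => [o0|o0]; last first.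
    by right; have := offdeg_ge0 xp; lia.
  left; move: nz; rewrite (axis_one uy H) // /one pnatr_eq0 eqb0 negbK => /eqP ->.
  by rewrite mxE wt_ge0 ?vpos0.
by split; apply: st => //; [left|right].
Qed.

Let supp_cones : supp h (cone (-1)) /\ supp h' (cone 1).
Proof.
have H (d : nat) : supp h (conedeg (-1) (d%:Z + 1)) /\ supp h' (conedeg 1 (d%:Z + 1)).
  elim: d => [|d [IH1 IH2]]; first exact: cone_start.
  have -> : d.+1%:Z + 1 = (d%:Z + 1) + 1 by lia.
  by apply: cone_step => //; lia.
split=> x nz.
  have [/(_ x nz) [xp [xk|xd]] _] := H (absz (offdeg x)); first by split.
  by have := offdeg_ge0 xp; lia.
have [_ /(_ x nz) [xp [xk|xd]]] := H (absz (offdeg x)); first by split.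
by have := offdeg_ge0 xp; lia.
Qed.

Local Notation "f *' g" := (qmul mutform f g) (at level 40, left associativity).
Let y1 : V -> rat := fun x => h' (refl 1 x).
Let y2 : V -> rat := fun x => h (refl (-1) x).

Let sL' : skew_form mutform. Proof. exact: skew_mutform. Qed.
Let L1 : forall x y, mutform x y = L (refl 1 x) (refl 1 y).
Proof. by []. Qed.
Let L2 : forall x y, mutform x y = L (refl (-1) x) (refl (-1) y).
Proof. by apply: mutform_refl; right. Qed.

Let mutform_ek x : mutform x ek = p k * - bf x.
Proof.
by rewrite /mutform refl_ek formNr // formDl // formZl // formxx // mulr0 addr0 bfE
  mulrN.
Qed.

Let cone_pos s x : cone s x -> vpos x. Proof. by case. Qed.

Let uy1 : unip y1.
Proof.
exact: (unip_transport (reflD 1) (@cone_refl 1) (proj2 supp_cones) uh').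
Qed.

Let uy2 : unip y2.
Proof.
exact: (unip_transport (reflD (-1)) (@cone_refl (-1)) (proj1 supp_cones) uh).
Qed.

Let bf_refl s x : bf (refl s x) = bf x.
Proof. by rewrite bf_additive additive_funZ ?bf_ek ?mulr0 ?addr0 //;
  apply: bf_additive. Qed.

Let refl_subek s x (m : int) : refl s (x - m *: ek) = refl s x + m *: ek.
Proof.
rewrite /refl wt_subek coord_subek -addrA -scaleNr -scalerDl -addrA -scalerDl.
by congr (_ + _ *: _); ring.
Qed.

(** The reflections turn [ek] into [- ek], so the sum along each line runs backwards; palindromic
    coefficients allow it to be reversed. *)
Let lr' : line_rel (p k) k (fun x => - bf x) y1 y2.
Proof.
have rev (b : nat) (F : V -> rat) z : \sum_(i < b.+1) (fpoly (p k) b)`_i * F (z -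
  i%:Z *: ek)
    = \sum_(i < b.+1) (fpoly (p k) b)`_i * F (z - b%:Z *: ek + i%:Z *: ek).
  rewrite (reindex_inj rev_ord_inj) /=; apply: eq_bigr => i _.
  have ib : (i <= b)%N by have := ltn_ord i; lia.
  rewrite subSS -fpoly_rev // -addrA -!scaleNr -scalerDl.
  by congr (_ * F (_ + _ *: _)); lia.
move=> x; rewrite abszN; split=> bx.
  have [_ /(_ _) H] := lr (refl (-1) x); rewrite bf_refl in H.
  rewrite /y2 H; last by lia.
  rewrite rev; apply: eq_bigr => i _; congr (_ * _).
  rewrite /y1 refl_subek refl_swap; apply: (congr1 h').
  by congr (_ + _); rewrite -addrA -!scaleNr -scalerDl -[RHS]addr0 -(scale0r ek);
     congr (_ + _ *: _); lia.
have [/(_ _) H _] := lr (refl 1 x); rewrite bf_refl in H.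
rewrite /y1 H; last by lia.
rewrite rev; apply: eq_bigr => i _; congr (_ * _).
rewrite /y2 refl_subek refl_swap; apply: (congr1 h).
by congr (_ + _); congr (_ - _ *: _); lia.
Qed.

(** While [g] is [E ** h] and [h' ** E], the change of variables puts [h'] to the right of the
    dilogarithm and [h] to its left. *)
Definition mutated : V -> rat := E *' y1.

Let mutatedE : mutated = y2 *' E.
Proof. by apply/(conj_line sL' pk0 (proj1 uy1) (proj1 uy2) mutform_ek)/lr'. Qed.

(** On this side both dilogarithms are invisible, the right one of [g] and the left one of
    [mutated]; the wall of [h'] remains in both cases. *)
Let wall_neg th : additive_fun th -> th ek < 0 ->
  wall mutform (fun x => th (refl 1 x)) mutated = fun x => wall L th g (refl 1 x).
Proof.
move=> ath t0; have ath' : additive_fun (fun x => th (refl 1 x)).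
  by move=> x y; rewrite reflD ath.
rewrite /mutated wall_dilogl // ?refl_ek ?additive_funN // ?oppr_gt0 //.
rewrite (wall_transport sL sL' (reflD 1) (reflK 1) L1 (cone0 1) (@coneD 1)
   (@cone_pos 1) (@cone_refl 1) ath (proj2 supp_cones) uh').
by rewrite -hE wall_dilogr.
Qed.

Let wall_pos th : additive_fun th -> 0 < th ek ->
  wall mutform (fun x => th (refl (-1) x)) mutated = fun x => wall L th g (refl (-1) x).
Proof.
move=> ath t0; have ath' : additive_fun (fun x => th (refl (-1) x)).
  by move=> x y; rewrite reflD ath.
rewrite mutatedE wall_dilogr // ?refl_ek ?additive_funN // ?oppr_lt0 //.
rewrite (wall_transport sL sL' (reflD (-1)) (reflK (-1)) L2 (cone0 (-1)) (@coneD (-1))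
   (@cone_pos (-1)) (@cone_refl (-1)) ath (proj1 supp_cones) uh).
by rewrite -Eh wall_dilogl.
Qed.

Let unip_mutated : unip mutated. Proof. exact: unip_mul. Qed.

Let refl_axis s i x : i != k -> on_axis i x -> wt s x = 0 -> refl s x = x.
Proof.
move=> ik /eqP xi x0; rewrite /refl x0 {2}xi coord_scale (negPf ik) mulr0 mulr0 subrr.
by rewrite scale0r addr0.
Qed.

Let wt_axis s i x : on_axis i x -> wt s x = x 0 i * Num.max (s * bf (unitv i)) 0.
Proof. by move=> /eqP {1}->; rewrite additive_funZ ?wt_unitv //;
  apply: wt_additive. Qed.

Let bf_axis i x : on_axis i x -> bf x = x 0 i * bf (unitv i).
Proof. by move=> /eqP {1}->; rewrite additive_funZ //; apply: bf_additive. Qed.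

Let mutated_axis i x : vpos x -> on_axis i x -> mutated x = psi (p i) (absz (x 0 i)).
Proof.
move=> xp xi; have [_ axg _] := cg.
case: (eqVneq i k) => [ik|ik].
  (* On the axis of [k] the cone condition forces [y1] to be trivial, so only [E] contributes. *)
  rewrite ik in xi *; have yE y : y 0 k <= x 0 k -> on_axis k y -> y1 y = one (n:=n) y.
    move=> yx yk; rewrite /y1 /one; case: (eqVneq y 0) => [->|y0].
      by rewrite (transport0 (reflD 1)); case: uh'.
    apply/eqP; apply: contraNT y0 => /(proj2 supp_cones) [yp].
    have [m ye] := on_axisP _ _ yk.
    rewrite refl_coord wt_refl ye additive_funZ ?wt_ek ?mulr0; last exact: wt_additive.
    move: yp; rewrite ye.
    have -> : refl 1 (m *: ek) = (- m) *: ek.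
      rewrite /refl additive_funZ ?wt_ek ?mulr0 ?coord_scale ?eqxx ?mulr1;
        last exact: wt_additive.
      by rewrite -scalerDl; congr (_ *: _); ring.
    move=> /vposP/(_ k); rewrite !coord_scale eqxx mulr1 => m0 m1.
    have -> : m = 0 by lia.
    by rewrite scale0r.
  rewrite /mutated mul_dilogl //; last by case: uy1.
  have xk0 : 0 <= x 0 k by apply/vposP.
  rewrite (bigD1 ord_max) //= big1 ?addr0 => [|j jm].
    have -> : x - (absz (x 0 k))%:Z *: ek = 0.
      by rewrite gez0_abs //; move/eqP: xi => {1}->; rewrite subrr.
    rewrite yE ?on_axis0 ?mxE // /one eqxx mulr1.
    by rewrite (eqP xi) formZr // formxx // !mulr0 qpow0 mulr1 coord_scale eqxx mulr1.
  rewrite yE ?coord_subek; last 2 first.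
  - by lia.
  - by have [m xm] := on_axisP _ _ xi; apply/on_axisP; exists (m - j%:Z);
    rewrite scalerBl -xm.
  suff /negPf ne : x - j%:Z *: ek != 0 by rewrite /one ne mulr0.
  apply: contraNN jm => /eqP e; have := coord_subek x j%:Z; rewrite e mxE => e2.
  by apply/eqP/val_inj => /=; lia.
(* On any other axis [E] contributes its constant term only; the sign of [bf (unitv i)] selects the
   reflection that fixes [x]. *)
have xk : x 0 k = 0 by move/eqP: xi => ->; rewrite coord_scale (negPf ik) mulr0.
have xk0 : absz (x 0 k) = 0%N by rewrite xk.
case: (lerP (bf (unitv i)) 0) => bi.
  rewrite /mutated mul_dilogl //; last by case: uy1.
  rewrite xk0 big_ord_recl big_ord0 addr0 /= mul0r qpow0 !mul1r scale0r subr0 /y1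
    (refl_axis ik) //; last first.
    by rewrite (wt_axis _ xi) max_r ?mulr0 // mul1r.
  have := congr1 (@^~ x) hE; rewrite mul_dilogr //; last by case: uh'.
  by rewrite xk0 big_ord_recl big_ord0 addr0 /= mul0r oppr0 qpow0 !mul1r scale0r
    subr0 => ->; apply: axg.
rewrite mutatedE mul_dilogr //; last by case: uy2.
rewrite xk0 big_ord_recl big_ord0 addr0 /= mul0r oppr0 qpow0 !mul1r scale0r subr0 /y2
  (refl_axis ik) //; last first.
  by rewrite (wt_axis _ xi) max_r ?mulr0 // mulN1r oppr_le0 ltW.
have := congr1 (@^~ x) Eh; rewrite mul_dilogl //; last by case: uh.
by rewrite xk0 big_ord_recl big_ord0 addr0 /= mul0r qpow0 !mul1r scale0r subr0 => ->;
  apply: axg.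
Qed.

Let refl_off_axis s x : s = 1 \/ s = -1 -> s * bf x <= 0 -> vpos (refl s x) -> x != 0 ->
  (forall i, ~~ on_axis i x) -> forall i, ~~ on_axis i (refl s x).
Proof.
move=> sP sb xp x0 nax i; apply/negP => xi.
case: (eqVneq i k) => [ik|ik].
  rewrite ik in xi; case/negP: (nax k); have [m e] := on_axisP _ _ xi.
  apply/on_axisP; exists (- m); rewrite -[x](reflK s) e.
  rewrite /refl additive_funZ ?wt_ek ?mulr0 ?coord_scale ?eqxx ?mulr1;
    last exact: wt_additive.
  by rewrite -scalerDl; congr (_ *: _); ring.
case/negP: (nax i); rewrite -[x](reflK s) (refl_axis ik) //.
have x0' : refl s x != 0.
  apply: contraNN x0 => /eqP e; rewrite -[x](reflK s) e.
  by rewrite (transport0 (reflD s)).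
have xi0 : 0 < refl s x 0 i.
  have /vposP/(_ i) := xp; rewrite le_eqVlt => /orP[/eqP e|//].
  by move: x0'; rewrite (eqP xi) -e scale0r eqxx.
rewrite (wt_axis _ xi) max_r ?mulr0 //.
move: sb; rewrite -(bf_refl s) (bf_axis xi) mulrCA.
by rewrite pmulr_rle0.
Qed.

(** The sign of [bf x] selects the expression of [mutated] whose dilogarithm can be discarded before
    the change of variables, and that of [g] restored after it. *)
Let mutated_off x : vpos x -> x != 0 -> (forall i, ~~ on_axis i x) ->
  forall D, additive_fun D -> ldv mutform D (wall mutform (mutform x) mutated) x = 0.
Proof.
move=> xp x0 nax D aD; have [_ _ offg] := cg.
have aR s : additive_fun (fun x => D (refl s x)) by move=> a b; rewrite reflD aD.
have R0 s : refl s x != 0.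
  apply: contraNN x0 => /eqP e; rewrite -[x](reflK s) e.
  by rewrite (transport0 (reflD s)).
have aL s := additive_forml sL (refl s x).
case: (lerP (bf x) 0) => bx.
  rewrite /mutated ldv_dilogl //; last by rewrite mutform_ek mulr_ge0 ?oppr_ge0 // ltW.
  have -> : mutform x = fun y => L (refl 1 x) (refl 1 y) by [].
  rewrite (wall_transport sL sL' (reflD 1) (reflK 1) L1 (cone0 1) (@coneD 1)
   (@cone_pos 1) (@cone_refl 1) (aL 1) (proj2 supp_cones) uh').
  rewrite (ldv_transport sL sL' (reflD 1) (reflK 1) L1 (cone0 1) (@coneD 1)
   (@cone_pos 1) (@cone_refl 1)); last 2 first.
  - by apply: supp_wallW;
    [exact: sL|exact: uh'|exact: (proj2 supp_cones)|exact: cone0|exact: coneD].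
  - exact: unip_wall.
  case: (boolP (vpos (refl 1 x))) => rp; last by rewrite posE //; apply: pos_ldv.
  have nax' := @refl_off_axis 1 x (or_introl erefl) _ rp x0 nax; rewrite mul1r in nax'.
  rewrite -(@ldv_dilogr _ L sL _ (p k) k) ?hE;
    [exact: offg (nax' bx) _ (aR 1)|..] => //.
  - by rewrite Lek bf_refl mulr_ge0_le0 // ltW.
  - exact: nax'.
rewrite mutatedE ldv_dilogr //;
  last by rewrite mutform_ek mulr_ge0_le0 ?oppr_le0 // ltW.
have -> : mutform x = fun y => L (refl (-1) x) (refl (-1) y).
  by apply: functional_extensionality => y; apply: L2.
rewrite (wall_transport sL sL' (reflD (-1)) (reflK (-1)) L2 (cone0 (-1)) (@coneD (-1))
 (@cone_pos (-1)) (@cone_refl (-1)) (aL (-1)) (proj1 supp_cones) uh).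
rewrite (ldv_transport sL sL' (reflD (-1)) (reflK (-1)) L2 (cone0 (-1)) (@coneD (-1))
 (@cone_pos (-1)) (@cone_refl (-1))); last 2 first.
- by apply: supp_wallW;
  [exact: sL|exact: uh|exact: (proj1 supp_cones)|exact: cone0|exact: coneD].
- exact: unip_wall.
case: (boolP (vpos (refl (-1) x))) => rp; last by rewrite posE //; apply: pos_ldv.
have nax' := @refl_off_axis (-1) x (or_intror erefl) _ rp x0 nax.
rewrite mulN1r oppr_le0 in nax'; have bx' := ltW bx.
rewrite -(@ldv_dilogl _ L sL _ (p k) k) ?Eh;
  [exact: offg (nax' bx') _ (aR (-1))|..] => //.
- by rewrite Lek bf_refl mulr_ge0 // ltW.
- exact: nax'.
Qed.

Lemma cluster_element_mutation : exists g',
  [/\ cluster_element p mutform g',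
      forall th, additive_fun th -> th ek < 0 ->
        wall mutform (fun x => th (refl 1 x)) g' = (fun x => wall L th g (refl 1 x))
    & forall th, additive_fun th -> 0 < th ek ->
        wall mutform (fun x => th (refl (-1) x)) g' = (fun x => wall L th g (refl
          (-1) x))].
Proof.
exists mutated; split; [|exact: wall_neg|exact: wall_pos].
split; [exact: unip_mutated|exact: mutated_axis|exact: mutated_off].
Qed.

End Element.
End Mutation.

(** * Chambers and c-vectors *)

Section SignCoherence.
Context (n : nat).
Local Notation V := 'rV[int]_n.
Implicit Types (x y z v : V) (g : V -> rat) (k l : 'I_n) (w : seq 'I_n).
Context (p : 'I_n -> int) (p_gt0 : forall i, 0 < p i) (U : pred 'I_n).

(* The exchange coefficient epsilon_ik is [coef L k (unitv i)]. *)
Definition coef (L : V -> V -> int) k x : int := (L x (unitv k) %/ p k)%Z.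

Definition seed_form (L : V -> V -> int) : Prop :=
  skew_form L /\ forall k, U k -> forall x, (p k %| L x (unitv k))%Z.

Definition step L k := mutform L k (coef L k).

Definition negpart x : V := \row_i Num.max (- x 0 i) 0.

(** The rule before any sign is known; its last term comes from the mutation of the second half of
    the seed. With [eps] the exchange coefficient it equals [c j + [eps]_+ [c k]_+ - [- eps]_+
    [- c k]_+]. *)
Definition cstep L k (c : 'I_n -> V) j : V :=
  if j == k then - c k
  else c j + Num.max (coef L k (unitv j)) 0 *: c k
           + coef L k (unitv j) *: negpart (c k).

Fixpoint run L w := if w is k :: w' then run (step L k) w' else L.

Fixpoint cvecs L (c : 'I_n -> V) w :=
  if w is k :: w' then cvecs (step L k) (cstep L k c) w' else c.

Definition cvec L w := cvecs L (@unitv n) w.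

Definition pm (s : int) : Prop := s = 1 \/ s = -1.

Lemma run_rcons L w l : run L (rcons w l) = step (run L w) l.
Proof. by elim: w L => //= k w IH L; rewrite IH. Qed.

Lemma cvecs_rcons L c w l : cvecs L c (rcons w l) = cstep (run L w) l (cvecs L c w).
Proof. by elim: w L c => //= k w IH L c; rewrite IH. Qed.

Lemma coefE L k x : seed_form L -> U k -> L x (unitv k) = p k * coef L k x.
Proof. by move=> [_ dv] Uk; rewrite mulrC divzK ?dv. Qed.

Lemma seed_form_step L k : seed_form L -> U k -> seed_form (step L k).
Proof.
move=> sfL Uk; have [sL dv] := sfL.
have bE x : L x (unitv k) = p k * coef L k x by apply: coefE.
split; first exact: skew_mutform.
move=> l Ul x; rewrite /step /mutform.
case: (eqVneq l k) => [->|lk].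
  by rewrite (refl_ek sL p_gt0 bE) formNr // rpredN dv.
have -> : refl k (coef L k) 1 (unitv l)
    = unitv l + Num.max (coef L k (unitv l)) 0 *: unitv k.
  by rewrite /refl wt_unitv unitvE (negPf lk) mulr0 subr0 mul1r.
rewrite formDr // formZr // rpredD ?dv //.
case: (lerP (coef L k (unitv l)) 0) => _; first by rewrite mul0r rpred0.
(* The factor [p k] passes to the exchange coefficient, which becomes [L (unitv l) (unitv k)]; by
   skew symmetry [p l] divides it. *)
rewrite bE mulrA [_ * p k]mulrC -bE mulrC dvdz_mull //.
by rewrite formC // rpredN dv.
Qed.

Lemma seed_form_run L w : seed_form L -> all U w -> seed_form (run L w).
Proof.
elim: w L => //= k w IH L sfL /andP[Uk Uw].
by apply: IH => //; apply: seed_form_step.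
Qed.

Lemma cstep_coherent L k c j s : pm s -> vpos (s *: c k) -> j != k ->
  cstep L k c j = c j + Num.max (s * coef L k (unitv j)) 0 *: c k.
Proof.
move=> [->|->] /vposP cp jk; rewrite /cstep (negPf jk).
  have -> : negpart (c k) = 0; last by rewrite scaler0 addr0 mul1r.
  apply/rowP => i; rewrite !mxE max_r // oppr_le0.
  by have := cp i; rewrite scale1r.
have -> : negpart (c k) = - c k.
  apply/rowP => i; rewrite !mxE max_l //.
  by have := cp i; rewrite scaleN1r mxE.
rewrite -addrA scalerN -scalerBl; congr (_ + _ *: _); lia.
Qed.

Definition cbasis (c : 'I_n -> V) (cs : 'I_n -> V -> int) : Prop :=
  [/\ forall j, additive_fun (cs j), forall i j, cs i (c j) = (i == j)%:R
    & forall x, x = \sum_i cs i x *: c i].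

(* The open cone [th (cvec L w j) > 0] is a chamber of the scattering diagram
   of [g], and the wall on each of its facets is the quantum dilogarithm of
   the corresponding c-vector. *)
Definition chamber L g w : Prop :=
  [/\ forall th, additive_fun th -> (forall j, 0 < th (cvec L w j)) ->
        wall L th g = one (n:=n),
      forall l, exists s, [/\ pm s, vpos (s *: cvec L w l)
        & forall th, additive_fun th -> th (cvec L w l) = 0 ->
            (forall j, j != l -> 0 < th (cvec L w j)) ->
            wall L th g (s *: cvec L w l) = psi (p l) 1],
      exists cs, cbasis (cvec L w) cs
    & forall i j, L (cvec L w i) (cvec L w j) = run L w (unitv i) (unitv j)].

(** A vector of degree 1 has no proper decomposition, so the wall carries the full coefficient at
    every point of the hyperplane of [unitv k]. *)
Lemma wall_unitv L g k th : skew_form L -> cluster_element p L g ->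
  additive_fun th -> th (unitv k) = 0 -> wall L th g (unitv k) = psi (p k) 1.
Proof.
move=> sL [ug ax _] ath tk.
have ge : g (unitv k) = psi (p k) 1.
  rewrite (ax k) ?vpos_unitv //; last by apply/on_axisP; exists 1; rewrite scale1r.
  by rewrite unitvE eqxx.
rewrite -ge; apply: (@wall_indec _ L sL th g (fun v => vpos v)) => //.
- by case: ug.
- exact: vpos0.
- by move=> x y; apply: vposD.
- exact: vpos_unitv.
- exact: unitv_neq0.
move=> a ap bp a0 ak.
have da := vdeg_gt0 ap a0.
have db : 0 < vdeg (unitv k - a) by rewrite vdeg_gt0 // subr_eq0 eq_sym.
have := vdegD (unitv k - a) a; rewrite subrK vdeg_unitv.
by move: da db; lia.
Qed.

Lemma additive_sum (th : V -> int) (r : seq 'I_n) (F : 'I_n -> V) :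
  additive_fun th -> th (\sum_(i <- r) F i) = \sum_(i <- r) th (F i).
Proof.
move=> ath; elim: r => [|i r IH]; first by rewrite !big_nil additive_fun0.
by rewrite !big_cons ath IH.
Qed.

Lemma chamber_nil L g : skew_form L -> cluster_element p L g -> chamber L g [::].
Proof.
move=> sL cg; rewrite /chamber /cvec /=; split=> //.
- move=> th ath tp; apply: functional_extensionality => v; rewrite /one.
  case: (eqVneq v 0) => [->|v0]; first by case: (unip_wall sL ath g).
  apply/eqP; apply: contraT => nz; have [wp _] := unip_wall sL ath g.
  have /eqP := supp_wall nz; have /vposP vp := wp _ nz.
  rewrite (row_unitv v) additive_sum // => /eqP.
  rewrite psumr_eq0 => [/allP H|i _]; last first.
    by rewrite additive_funZ // mulr_ge0 // ltW.
  case/eqP: v0; apply/rowP => i; have := H i; rewrite mem_index_enum => /(_ isT).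
  by rewrite additive_funZ // mulf_eq0 (gt_eqF (tp i)) orbF mxE => /eqP.
- move=> l; exists 1; rewrite scale1r; split; [by left|exact: vpos_unitv|].
  by move=> th ath t0 _; apply: wall_unitv.
exists (fun j x => x 0 j); split; [by move=> j x y; rewrite mxE| |exact: row_unitv].
by move=> i j; rewrite unitvE eq_sym.
Qed.

Section ChamberFacts.
Context (L : V -> V -> int) (sL : skew_form L) (g : V -> rat).
Context (cg : cluster_element p L g) (w : seq 'I_n) (ch : chamber L g w).

(** Coordinates of both signs would allow a functional inside the chamber that vanishes on
    [unitv k], where the wall function is not trivial. *)
Lemma chamber_sign k (gam : 'I_n -> int) :
    unitv k = \sum_j gam j *: cvec L w j ->
  exists2 s, pm s & forall j, 0 <= s * gam j.
Proof.
move=> kE; have [walls _ [cs [ad dl ex]] _] := ch.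
case: (boolP [forall j, 0 <= gam j]) => [/forallP H|/forallPn[i]].
  by exists 1 => [|j]; [left|rewrite mul1r].
rewrite -ltNge => gi.
case: (boolP [forall j, gam j <= 0]) => [/forallP H|/forallPn[i']].
  by exists (-1) => [|j]; [right|rewrite mulN1r oppr_ge0].
rewrite -ltNge => gi'; exfalso.
pose Sp := \sum_(j | 0 < gam j) gam j; pose Sn := \sum_(j | gam j < 0) - gam j.
have Sp0 : 0 < Sp.
  rewrite /Sp (bigD1 i') //= ltr_pwDl // sumr_ge0 // => j /andP[/ltW //].
have Sn0 : 0 < Sn.
  rewrite /Sn (bigD1 i) //= ltr_pwDl ?oppr_gt0 // sumr_ge0 // => j /andP[/ltW].
  by rewrite oppr_ge0.
(* With these values on the c-vectors, [th (unitv k) = Sp Sn - Sn Sp = 0]; the value 1 at zero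
   coordinates only keeps [th] inside the chamber. *)
pose X j := if 0 < gam j then Sn else if gam j < 0 then Sp else 1.
pose th x := \sum_j X j * cs j x.
have ath : additive_fun th.
  by move=> x y; rewrite /th -big_split; apply: eq_bigr => j _; rewrite ad mulrDr.
have thc j : th (cvec L w j) = X j.
  rewrite /th (bigD1 j) //= dl eqxx mulr1 big1 ?addr0 // => i0 ij.
  by rewrite dl (negPf ij) mulr0.
have Xp j : 0 < th (cvec L w j) by rewrite thc /X; case: ifP => // _; case: ifP.
have tk : th (unitv k) = 0.
  rewrite kE additive_sum //.
  rewrite (eq_bigr (fun j => gam j * X j)); last first.
    by move=> j _; rewrite additive_funZ // thc.
  rewrite (bigID (fun j => 0 < gam j)) /=.
  rewrite (eq_bigr (fun j => gam j * Sn)) => [|j gj]; last by rewrite /X gj.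
  rewrite -mulr_suml -/Sp [X in _ + X](bigID (fun j => gam j < 0)) /=.
  rewrite [X in _ + (_ + X)]big1 ?addr0 => [|j /andP[g1 g2]]; last first.
    have -> : gam j = 0 by lia.
    by rewrite mul0r.
  rewrite (eq_bigl (fun j => gam j < 0)) => [|j]; last by lia.
  rewrite (eq_bigr (fun j => - (- gam j * Sp))) => [|j gj]; last first.
    have nj : (0 < gam j) = false by lia.
    by rewrite /X nj gj mulNr opprK.
  by rewrite sumrN -mulr_suml -/Sn; ring.
have := wall_unitv sL cg ath tk; rewrite walls // /one (negPf (unitv_neq0 k)).
by move=> e; have := psi1_neq0 (lt0r_neq0 (p_gt0 k)); rewrite -e eqxx.
Qed.

(** Inside facet [l], at the sum of the other dual coordinates, the wall function has first
    coefficient [psi (p l) 1] by the chamber and [psi (p k) 1] by [wall_unitv]. *)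
Lemma chamber_unitv k l s : pm s -> cvec L w l = s *: unitv k -> p l = p k.
Proof.
move=> sP lE; have [_ /(_ l)[t [tP tv wl]] [cs [ad dl ex]] _] := ch.
pose th x := \sum_(j | j != l) cs j x.
have ath : additive_fun th.
  by move=> x y; rewrite /th -big_split; apply: eq_bigr => j _; rewrite ad.
have thl : th (cvec L w l) = 0.
  by rewrite /th big1 // => j jl; rewrite dl (negPf jl).
have thc j : j != l -> 0 < th (cvec L w j).
  move=> jl; rewrite /th (bigD1 j) //= dl eqxx big1 ?addr0 // => i /andP[_ ij].
  by rewrite dl (negPf ij).
have tk : t *: cvec L w l = unitv k.
  move: tv; rewrite lE scalerA => /vposP/(_ k); rewrite coord_scale eqxx mulr1.
  by case: sP tP => -> [] -> //; rewrite ?mulr1 ?mulN1r ?opprK ?scale1r.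
have thk : th (unitv k) = 0 by rewrite -tk additive_funZ // thl mulr0.
apply: psi1_inj => //.
by rewrite -(wl th ath thl thc) tk; apply: wall_unitv.
Qed.

End ChamberFacts.

(** * Changing the root of the tree *)

Section ChangeOfRoot.
Context (L : V -> V -> int) (sfL : seed_form L) (k : 'I_n) (Uk : U k).
Context (g : V -> rat) (g' : V -> rat).
Context (cg : cluster_element p L g) (cg' : cluster_element p (step L k) g').
Local Notation L' := (step L k).
Local Notation ek := (unitv k).
Local Notation rf := (refl k (coef L k)).

Let sL : skew_form L. Proof. by case: sfL. Qed.
Let bE x : L x ek = p k * coef L k x. Proof. exact: coefE. Qed.
Let sfL' : seed_form L'. Proof. exact: seed_form_step. Qed.
Let sL' : skew_form L'. Proof. by case: sfL'. Qed.
Let pk0 : p k != 0. Proof. exact: lt0r_neq0. Qed.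

Let rfD s x y : rf s (x + y) = rf s x + rf s y. Proof. exact: reflD. Qed.
Let rf0 s : rf s 0 = 0. Proof. exact: (transport0 (rfD s)). Qed.
Let rfN s x : rf s (- x) = - rf s x.
Proof. by apply: (addIr (rf s x)); rewrite -rfD !addNr rf0. Qed.
Let rfZ s (m : int) x : rf s (m *: x) = m *: rf s x.
Proof.
elim: m => [|m IH|m IH]; first by rewrite !scale0r rf0.
  by rewrite intS !scalerDl !scale1r rfD IH.
by rewrite intS opprD !scalerDl !scaleN1r rfD rfN IH.
Qed.
Let rfK s x : rf s (rf s x) = x. Proof. exact: (reflK sL p_gt0 bE). Qed.
Let rf_ek s : rf s ek = - ek. Proof. exact: (refl_ek sL p_gt0 bE). Qed.

Let rf_opp s x : pm s -> rf (- s) x = rf s x - (s * coef L k x) *: ek.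
Proof.
have sw := refl_swap sL p_gt0 bE x.
by case=> ->; rewrite ?opprK ?mul1r ?mulN1r sw // scaleNr opprK subrK.
Qed.

(* The sign [s] tells on which side of the wall of [ek] the chamber of [w] for
   the root [L'] lies: [ek] has sign [s] in the basis [cvec L' w], and the
   corresponding reflection takes the c-vectors along [w] with root [L'] to the
   c-vectors along [k :: w] with root [L]. *)
Definition rooted s w : Prop :=
  [/\ pm s,
      exists2 gam : 'I_n -> int, ek = \sum_j gam j *: cvec L' w j
        & forall j, 0 <= s * gam j
    & forall j, cvec L (k :: w) j = rf s (cvec L' w j)].

Let coef_ek : coef L k ek = 0.
Proof. exact: (bf_ek sL p_gt0 bE). Qed.

Lemma rooted_nil : rooted 1 [::].
Proof.
split; first by left.
  exists (fun j => (j == k)%:R) => [|j]; last by rewrite mul1r; case: (_ == _).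
  rewrite (bigD1 k) //= eqxx scale1r big1 ?addr0 // => j /negPf ->.
  by rewrite scale0r.
move=> j; rewrite /cvec /=; case: (eqVneq j k) => [->|jk].
  by rewrite /cstep eqxx rf_ek.
rewrite (@cstep_coherent L k (@unitv n) j 1) //;
  [|by left|by rewrite scale1r vpos_unitv].
by rewrite mul1r /refl wt_unitv unitvE (negPf jk) mulr0 subr0 mul1r.
Qed.

Let coords_line x : (forall i, i != k -> x 0 i = 0) -> x = x 0 k *: ek.
Proof.
move=> H; apply/rowP => i; rewrite coord_scale; case: (eqVneq k i) => [->|ki].
  by rewrite mulr1.
by rewrite mulr0 H // eq_sym.
Qed.

Let pm_eq s t (r : int) : pm s -> pm t -> 0 <= s * r -> 0 <= t * r -> r != 0 -> s = t.
Proof. by case=> -> [] -> //; rewrite ?mul1r ?mulN1r => ? ? ?; lia. Qed.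

Let unit_multiple (m s : int) x : ek = m *: x -> pm s -> 0 <= s * m -> x = s *: ek.
Proof.
move=> ekl sP sg; have /(congr1 (fun v : V => v 0 k)) := ekl.
rewrite unitvE eqxx mxE => /esym ee.
have ms : m = s.
  have u : m \is a GRing.unit by apply/unitrP; exists (x 0 k); rewrite mulrC ee.
  have := sg; move: u; rewrite qualifE /= /intUnitRing.unitz => /orP[] /eqP ->;
  by case: sP => -> //; rewrite ?mulN1r ?mul1r.
rewrite ekl ms scalerA.
by case: sP => ->; rewrite ?mulrNN mul1r scale1r.
Qed.

(** If [ek] is not a multiple of [C l], another coordinate of [ek] retains the sign [s], and
    mutation at [l] commutes with [rf s] because [C l] and its image have the same sign. Otherwise
    [C l = s *: ek], the chamber crosses the hyperplane of [ek], and [s] becomes [- s]. *)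
Lemma rooted_rcons s w l : all U w -> U l -> chamber L' g' w -> chamber L' g' (rcons
  w l) ->
    chamber L g (k :: w) -> rooted s w -> exists t, rooted t (rcons w l).
Proof.
move=> Uw Ul ch1 ch2 ch3 [sP [gam ekE sg] cE].
have [_ co1 [cs [ad dl ex]] iso] := ch1.
have [e [eP ev _]] := co1 l.
have gamE j : gam j = cs j ek.
  rewrite [in RHS]ekE additive_sum // (bigD1 j) //= additive_funZ // dl eqxx mulr1.
  by rewrite big1 ?addr0 // => i ij;
    rewrite additive_funZ // dl eq_sym (negPf ij) mulr0.
set C := cvec L' w in ekE cE dl ex iso ev *.
set R := run L' w in iso *.
have C'E j : j != l -> cvec L' (rcons w l) j
    = C j + Num.max (e * coef R l (unitv j)) 0 *: C l.
  by move=> jl; rewrite /cvec cvecs_rcons (cstep_coherent _ eP).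
have C'l : cvec L' (rcons w l) l = - C l.
  by rewrite /cvec cvecs_rcons /cstep eqxx.
have D'E j : cvec L (k :: rcons w l) j = cstep R l (cvec L (k :: w)) j.
  by rewrite /cvec /= cvecs_rcons.
pose m j := Num.max (e * coef R l (unitv j)) 0.
pose gam' j := if j == l then - gam l + \sum_(i | i != l) gam i * m i else gam j.
have ekE' : ek = \sum_j gam' j *: cvec L' (rcons w l) j.
  rewrite [LHS]ekE (bigD1 l) //= [RHS](bigD1 l) //= /gam' eqxx C'l.
  rewrite [in RHS](eq_bigr (fun j => gam j *: C j + (gam j * m j) *: C l)); last first.
    by move=> j jl; rewrite (negPf jl) C'E // scalerDr scalerA.
  rewrite big_split /= -scaler_suml addrCA scalerN -scaleNr -scalerDl [RHS]addrC.
  by congr (_ *: _ + _); ring.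
case: (boolP [exists j, (j != l) && (gam j != 0)]) => [/existsP[j /andP[jl
  gj]]|/existsPn H].
  exists s; split=> //.
    exists gam' => //; have [t tP tg] := chamber_sign sL' cg' ch2 ekE'.
    suff -> : s = t by [].
    apply: (pm_eq sP tP (sg j) _ gj).
    by have := tg j; rewrite /gam' (negPf jl).
  have [_ /(_ l)[e2 [e2P e2v _]] _ _] := ch3.
  rewrite cE -/(C l) in e2v.
  (* A coordinate of [C l] other than [k] is untouched by the reflection, so a nonzero one gives
     [C l] and its image the same sign. *)
  have [i ik Ci] : exists2 i, i != k & C l 0 i != 0.
    apply/exists_inP; apply: contraT => /exists_inPn H.
    have Cl : C l = C l 0 k *: ek.
      by apply: coords_line => i ik; have := H i ik; rewrite negbK => /eqP.
    have t0 : C l 0 k * gam j = 0.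
      by rewrite gamE -additive_funZ // -Cl dl (negPf jl).
    have : cs l (C l) = 0.
      move/eqP: t0; rewrite mulf_eq0 (negPf gj) orbF => /eqP t0.
      by rewrite Cl t0 scale0r additive_fun0.
    by rewrite dl eqxx.
  have ee : e2 = e.
    apply: (pm_eq e2P eP _ _ Ci).
      have /vposP/(_ i) := e2v; rewrite mxE.
      by rewrite (refl_coord_neq _ _ _ ik).
    by have /vposP/(_ i) := ev; rewrite mxE.
  move=> j'; rewrite D'E; case: (eqVneq j' l) => [->|j'l].
    by rewrite /cstep eqxx C'l rfN cE.
  rewrite (cstep_coherent _ eP) //; last by rewrite cE -ee.
  by rewrite C'E // rfD rfZ !cE.
have g0 j : j != l -> gam j = 0.
  by move=> jl; have := H j; rewrite jl /= negbK => /eqP.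
have ekl : ek = gam l *: C l.
  by rewrite [LHS]ekE (bigD1 l) //= big1 ?addr0 // => j jl; rewrite g0 // scale0r.
have Cls := unit_multiple ekl sP (sg l).
have pl : p l = p k by apply: (chamber_unitv sL' cg' ch1 sP).
exists (- s); split.
- by case: sP => ->; [right|rewrite opprK; left].
- exists gam' => // j; rewrite /gam'; case: (eqVneq j l) => [_|jl].
    rewrite big1 ?addr0 => [|i il]; last by rewrite g0 // mul0r.
    by rewrite mulrNN.
  by rewrite g0 // mulr0.
have rCl : rf s (C l) = - s *: ek by rewrite Cls rfZ rf_ek scalerN scaleNr.
move=> j; rewrite D'E; case: (eqVneq j l) => [->|jl].
  rewrite /cstep eqxx C'l rfN cE -/(C l) rCl Cls rfZ rf_ek scalerN opprK.
  by rewrite scaleNr !opprK.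
have sP' : pm (- s) by case: sP => ->; [right|rewrite opprK; left].
rewrite (cstep_coherent _ sP') //; last first.
  rewrite cE -/(C l) rCl scalerA mulrNN.
  by case: sP => ->; rewrite ?mulrNN mul1r scale1r vpos_unitv.
rewrite C'E // rfD rfZ !cE -/(C l) -/(C j) rCl.
have -> : rf (- s) (C l) = - s *: ek by rewrite Cls rfZ rf_ek scalerN scaleNr.
rewrite (rf_opp _ sP).
have es : e = s.
  have : vpos ((e * s) *: ek) by rewrite -scalerA -Cls.
  move/vposP/(_ k); rewrite coord_scale eqxx mulr1.
  by case: eP sP => -> [] ->.
have sf : seed_form R by apply: seed_form_run.
(* The isometry clause of [chamber] translates the exchange coefficient at the far end into one at
   the root; [p l = p k] cancels the weights. *)
have key : s * coef R l (unitv j) = - coef L k (C j).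
  have := iso j l; rewrite (coefE _ sf Ul) Cls formZr //.
  have -> : L' (C j) ek = - (p k * coef L k (C j)).
    rewrite /step /mutform rf_ek formNr //.
    by rewrite bE /refl (bf_additive sL p_gt0 bE) (additive_funZ _ _ (bf_additive sL
      p_gt0 bE))
      coef_ek mulr0 addr0.
  rewrite pl => /(congr1 (fun t => s * t)).
  have ss : s * s = 1 by case: sP => ->; rewrite ?mulrNN mul1r.
  rewrite mulrA ss mul1r mulrCA -mulrN => /(mulfI pk0) <-.
  by [].
rewrite es !scalerA; move: (rf s (C j)) => X.
rewrite -[RHS]addrA -scaleNr -scalerDl; congr (_ + _ *: _).
have -> : coef L k (C j) = - (s * coef R l (unitv j)) by rewrite key opprK.
by case: sP => ->; lia.
Qed.

(** On the chamber along [k :: w], [th (rf s ek)] is a sum of terms of sign [s], so [th ek] has sign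
    [- s], which selects the comparison of walls. A facet inside the hyperplane of [ek] escapes it
    and is left to [wall_unitv]. *)
Lemma chamber_cons s w :
    (forall th, additive_fun th -> th ek < 0 ->
       wall L' (fun x => th (rf 1 x)) g' = (fun x => wall L th g (rf 1 x))) ->
    (forall th, additive_fun th -> 0 < th ek ->
       wall L' (fun x => th (rf (-1) x)) g' = (fun x => wall L th g (rf (-1) x))) ->
  chamber L' g' w -> rooted s w -> chamber L g (k :: w).
Proof.
move=> wneg wpos ch [sP [gam ekE sg] cE].
have [ch1 co1 [cs [ad dl ex]] iso] := ch.
set C := cvec L' w in ekE cE ch1 co1 ad dl ex iso *.
have wE th : additive_fun th -> 0 < s * th (rf s ek) ->
    wall L' (fun x => th (rf s x)) g' = (fun x => wall L th g (rf s x)).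
  move=> ath; rewrite rf_ek additive_funN //.
  by case: sP => ->; rewrite ?mul1r ?mulrNN ?mul1r ?oppr_gt0; [apply: wneg|apply: wpos].
have ath' th : additive_fun th -> additive_fun (fun x => th (rf s x)).
  by move=> ath x y; rewrite rfD ath.
have thE th : additive_fun th -> th (rf s ek) = \sum_j gam j * th (cvec L (k :: w) j).
  move=> ath; rewrite [in LHS]ekE.
  have /= -> := additive_sum (index_enum _) (fun j => gam j *: C j) (ath' th ath).
  apply: eq_bigr => j _.
  by rewrite cE rfZ additive_funZ.
have gamE j : gam j = cs j ek.
  rewrite [in RHS]ekE additive_sum // (bigD1 j) //= additive_funZ // dl eqxx mulr1.
  by rewrite big1 ?addr0 // => i ij;
    rewrite additive_funZ // dl eq_sym (negPf ij) mulr0.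
have thpos th (P : pred 'I_n) : additive_fun th ->
    (forall j, P j -> 0 < th (cvec L (k :: w) j)) ->
    (forall j, ~~ P j -> th (cvec L (k :: w) j) = 0) ->
    forall j, P j -> gam j != 0 -> 0 < s * th (rf s ek).
  move=> ath tp t0 j Pj gj; rewrite thE // mulr_sumr (bigD1 j) //= ltr_pwDl //.
    rewrite mulrA mulr_gt0 ?tp // lt_neqAle sg andbT eq_sym mulf_neq0 //.
    by case: sP => ->.
  apply: sumr_ge0 => i _; rewrite mulrA; case: (boolP (P i)) => Pi.
    by rewrite mulr_ge0 // ltW // tp.
  by rewrite t0 ?mulr0.
split.
- move=> th ath tp.
  have [j gj] : exists j, gam j != 0.
    apply/existsP; apply: contraT => /existsPn H.
    have : ek = 0 :> V.
      by rewrite ekE big1 // => j _; have := H j; rewrite negbK => /eqP ->;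
        rewrite scale0r.
    by move/eqP; rewrite (negPf (unitv_neq0 k)).
  have tk := @thpos th predT ath (fun j _ => tp j) (fun j h => ltac:(by [])) j isT gj.
  have e := wE th ath tk; rewrite ch1 in e; last 2 first.
  + exact: ath'.
  + by move=> i; rewrite -cE.
  apply: functional_extensionality => x.
  have := congr1 (@^~ (rf s x)) e; rewrite rfK => <-.
  rewrite /one; suff -> : (rf s x == 0) = (x == 0) by [].
  by apply/eqP/eqP => [h|->]; [rewrite -[x](rfK s) h rf0 | rewrite rf0].
- move=> l; have [e [eP ev ew]] := co1 l.
  case: (boolP [exists j, (j != l) && (gam j != 0)]) => [/existsP[j /andP[jl
    gj]]|/existsPn H].
    have tw th : additive_fun th -> th (cvec L (k :: w) l) = 0 ->
        (forall j, j != l -> 0 < th (cvec L (k :: w) j)) ->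
        wall L th g (e *: cvec L (k :: w) l) = psi (p l) 1.
      move=> ath tl tj.
      have tl' i : ~~ (i != l) -> th (cvec L (k :: w) i) = 0.
        by rewrite negbK => /eqP ->.
      have tk := @thpos th (fun i => i != l) ath tj tl' j jl gj.
      rewrite cE -rfZ -[LHS]/((fun x => wall L th g (rf s x)) _) -wE //.
      by apply: ew; [exact: ath'|rewrite -cE|move=> i il; rewrite -cE; apply: tj].
    exists e; split=> //.
    (* At this interior point of the facet the wall coefficient is nonzero, and wall functions are
       supported on the nonnegative orthant: this is the source of the sign of the c-vector. *)
    pose th x := \sum_(j | j != l) cs j (rf s x).
    have ath : additive_fun th.
      by move=> x y; rewrite /th -big_split; apply: eq_bigr => i _; rewrite rfD ad.
    have thl : th (cvec L (k :: w) l) = 0.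
      by rewrite /th big1 // => i il; rewrite cE rfK dl (negPf il).
    have thc i : i != l -> 0 < th (cvec L (k :: w) i).
      move=> il; rewrite /th (bigD1 i) //= cE rfK dl eqxx big1 ?addr0 // => i'
        /andP[_ ii].
      by rewrite dl (negPf ii).
    have wp := tw th ath thl thc; apply: (proj1 (unip_wall sL ath g)).
    by rewrite wp psi1_neq0 // lt0r_neq0.
  have g0 j : j != l -> gam j = 0.
    by move=> jl; have := H j; rewrite jl /= negbK => /eqP.
  have ekl : ek = gam l *: C l.
    by rewrite [LHS]ekE (bigD1 l) //= big1 ?addr0 // => j jl; rewrite g0 // scale0r.
  have Cls := unit_multiple ekl sP (sg l).
  have pl : p l = p k by apply: (chamber_unitv sL' cg' ch sP).
  have cl : - s *: cvec L (k :: w) l = ek.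
    rewrite cE -/(C l) Cls rfZ rf_ek !scalerN scalerA mulNr scaleNr opprK.
    by case: sP => ->; rewrite ?mulrNN mul1r scale1r.
  exists (- s); rewrite cl; split; [|exact: vpos_unitv|].
    by case: sP => ->; [right|rewrite opprK; left].
  move=> th ath tl _; rewrite pl; apply: wall_unitv => //.
  by rewrite -cl additive_funZ // tl mulr0.
- exists (fun j x => cs j (rf s x)); split.
  + by move=> j x y; rewrite rfD ad.
  + by move=> i j; rewrite cE rfK dl.
  move=> x; rewrite -[LHS](rfK s) {1}(ex (rf s x)).
  have : forall r : seq 'I_n, rf s (\sum_(i <- r) cs i (rf s x) *: C i)
      = \sum_(i <- r) cs i (rf s x) *: cvec L (k :: w) i; last exact.
  by elim=> [|i r IH]; rewrite ?big_nil ?rf0 // !big_cons rfD rfZ IH cE.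
move=> i j; rewrite !cE -(mutform_refl sL p_gt0 bE sP).
exact: iso.
Qed.

End ChangeOfRoot.

(** The side [s] is found by extending prefixes of [w] letter by letter; each extension uses
    chambers of words shorter than [k :: w], for the old root and the new one, hence an induction
    over all [L] and [g]. *)
Theorem chamber_cvec L w g : seed_form L -> cluster_element p L g -> all U w ->
  chamber L g w.
Proof.
have [m] := ubnP (size w); elim: m L w g => // m IH L [|k w] g.
  by move=> _ [sL _] cg _; apply: chamber_nil.
rewrite /= ltnS => wm sfL cg /andP[Uk Uw].
have [sL _] := sfL.
have [g' [cg' wneg wpos]] :=
  cluster_element_mutation sL p_gt0 (fun x => coefE x sfL Uk) cg.
have sfL' := seed_form_step sfL Uk.
have ch' w0 : (size w0 < m)%N -> all U w0 -> chamber (step L k) g' w0.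
  by move=> wm0 Uw0; apply: IH.
have ch w0 : (size w0 < m)%N -> all U w0 -> chamber L g w0.
  by move=> wm0 Uw0; apply: IH.
have [s rs] : exists s, rooted L k s w.
  elim/last_ind: w wm Uw => [|w l IHw] wm Uw; first by exists 1; apply: rooted_nil.
  rewrite size_rcons in wm; rewrite all_rcons in Uw; case/andP: Uw => Ul Uw.
  have [s rs] := IHw (ltnW wm) Uw.
  apply: (rooted_rcons sfL Uk cg' Uw Ul _ _ _ rs).
  - exact: ch' (ltnW wm) Uw.
  - by apply: ch'; rewrite ?size_rcons // all_rcons Ul.
  - by apply: (ch (k :: w)) => //=; rewrite Uk.
apply: (chamber_cons sfL Uk cg cg' wneg wpos (ch' w wm Uw) rs).
Qed.

Theorem cvec_sign_coherent L w j : seed_form L -> all U w ->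
  exists2 s, pm s & vpos (s *: cvec L w j).
Proof.
move=> sfL Uw; have [sL _] := sfL.
have [g cg] := cluster_element_exists p sL.
by have [_ /(_ j)[s [sP sv _]] _ _] := chamber_cvec sfL cg Uw; exists s.
Qed.

End SignCoherence.

(** * Comparison with the exchange matrix *)

Lemma intr_max0 (a : int) : Num.max (a%:~R : rat) 0 = (Num.max a 0)%:~R.
Proof.
by case: (lerP a 0) => a0; [rewrite max_r ?lerz0|rewrite max_l ?ler0z // ltW].
Qed.

Section ExchangeMatrix.
Context (n : nat) (G : fixed_data n) (s : seed G).
Local Notation V := 'rV[int]_n.

Lemma pairing0 (x : latN G) : pairing x (0 : Mo G) = 0.
Proof. by rewrite -(subrr 0) pairingBr subrr. Qed.

Lemma form_0l (x : latN G) : Defs.form 0 x = 0.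
Proof. by rewrite -(subrr 0) form_subl subrr. Qed.

Lemma form_0r (x : latN G) : Defs.form x 0 = 0.
Proof. by rewrite form_skew form_0l oppr0. Qed.

Lemma tform_linr (a : int) (x y z : latNt G) :
  tform z (x + a *: y) = tform z x + a%:~R * tform z y.
Proof. by rewrite tform_skew tform_lin opprD -mulrN -!(tform_skew z). Qed.

Lemma tformxx (x : latNt G) : tform x x = 0.
Proof. by move: (tform_skew x x); lra. Qed.

(* Multiplying by [scale] makes the form integral; [weight i] is then
   [scale / d_i]. *)
Definition scale : nat :=
  ((\prod_i \prod_j absz (denq (Defs.form (s i) (s j)))) * \prod_i dd G i)%N.

Lemma scale_gt0 : (0 < scale)%N.
Proof.
rewrite muln_gt0 !prodn_gt0 // => [i|i]; first exact: dd_gt0.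
by apply: prodn_gt0 => j; rewrite absz_gt0 denq_eq0.
Qed.

Lemma dvdn_prod_ord (F : 'I_n -> nat) i : (F i %| \prod_j F j)%N.
Proof. by rewrite (bigD1 i) //= dvdn_mulr. Qed.

Lemma scale_form_int i j : scale%:R * Defs.form (s i) (s j) \is a Num.int.
Proof.
have /dvdnP[m ->] : (absz (denq (Defs.form (s i) (s j))) %| scale)%N.
  apply: dvdn_mulr; apply: dvdn_trans (dvdn_prod_ord _ i).
  exact: (dvdn_prod_ord (fun j => absz (denq (Defs.form (s i) (s j))))).
rewrite natrM -mulrA rpredM ?rpred_nat //.
by rewrite -[_%:R]/((absz _)%:Z%:~R) absz_denq mulrC -numqE intr_int.
Qed.

Lemma scale_div_int i : scale%:R / (dd G i)%:R \is a @Num.int rat.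
Proof.
have /dvdnP[m ->] : (dd G i %| scale)%N by rewrite dvdn_mull // dvdn_prod_ord.
by rewrite natrM mulfK ?rpred_nat // pnatr_eq0 -lt0n dd_gt0.
Qed.

Definition base_coef i j : int := Num.floor (scale%:R * Defs.form (s i) (s j)).

Definition base_form (x y : V) : int :=
  \sum_i \sum_j x 0 i * y 0 j * base_coef i j.

Definition weight (i : 'I_n) : int := Num.floor (scale%:R / (dd G i)%:R : rat).

Lemma base_coefE i j : (base_coef i j)%:~R = scale%:R * Defs.form (s i) (s j).
Proof. exact/floorK/scale_form_int. Qed.

Lemma weightE i : (weight i)%:~R = scale%:R / (dd G i)%:R :> rat.
Proof. exact/floorK/scale_div_int. Qed.

Lemma dd_neq0 i : (dd G i)%:R != 0 :> rat.
Proof. by rewrite pnatr_eq0 -lt0n dd_gt0. Qed.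

Lemma scale_neq0 : scale%:R != 0 :> rat.
Proof. by rewrite pnatr_eq0 -lt0n scale_gt0. Qed.

Lemma weight_gt0 i : 0 < weight i.
Proof.
by rewrite -(ltr0z rat) weightE divr_gt0 ?ltr0n ?scale_gt0 ?dd_gt0.
Qed.

Lemma base_form_unitv i j : base_form (unitv i) (unitv j) = base_coef i j.
Proof.
rewrite /base_form (bigD1 i) //= [X in _ + X]big1 ?addr0 => [|i' ii]; last first.
  by rewrite big1 // => j' _; rewrite unitvE eq_sym (negPf ii) !mul0r.
rewrite (bigD1 j) //= [X in _ + X]big1 ?addr0 => [|j' jj]; last first.
  by rewrite !unitvE [j == _]eq_sym (negPf jj) mulr0 mul0r.
by rewrite !unitvE !eqxx !mul1r.
Qed.

Lemma base_formEr x j : base_form x (unitv j) = \sum_i x 0 i * base_coef i j.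
Proof.
apply: eq_bigr => i _; rewrite (bigD1 j) //= big1 ?addr0 => [|j' jj]; last first.
  by rewrite unitvE [j == _]eq_sym (negPf jj) mulr0 mul0r.
by rewrite unitvE eqxx mulr1.
Qed.

Lemma skew_base_form : skew_form base_form.
Proof.
split=> [x y z|x y].
  rewrite /base_form -big_split; apply: eq_bigr => i _ /=.
  by rewrite -big_split; apply: eq_bigr => j _ /=; rewrite mxE; ring.
rewrite /base_form exchange_big /= -sumrN; apply: eq_bigr => i _.
rewrite -sumrN; apply: eq_bigr => j _.
have -> : base_coef j i = - base_coef i j.
  by apply: (@intr_inj rat); rewrite rmorphN /= !base_coefE form_skew mulrN.
by ring.
Qed.

Lemma tform_lshift i j :
  tform (tilde_seed s (lshift n i)) (tilde_seed s (lshift n j)) = Defs.form (s i) (s j).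
Proof.
rewrite /tilde_seed !(unsplitK (inl _ : 'I_n + 'I_n)%type) /tform /=.
by rewrite !pairing0 addr0 subr0.
Qed.

Lemma tform_rshift i j :
  tform (tilde_seed s (lshift n i)) (tilde_seed s (rshift n j)) = pairing (s i)
    (f_vec s j).
Proof.
rewrite /tilde_seed (unsplitK (inl _ : 'I_n + 'I_n)%type).
rewrite (unsplitK (inr _ : 'I_n + 'I_n)%type) /tform /=.
by rewrite form_0r pairing0 add0r subr0.
Qed.

Definition unfrozen : pred 'I_n := fun k => k \in Iuf G.

Lemma seed_form_base : seed_form weight unfrozen base_form.
Proof.
split=> [|k kuf x]; first exact: skew_base_form.
rewrite base_formEr; apply: rpred_sum => i _; apply: dvdz_mull.
have := tilde_form_int s [::] (lshift n i) kuf; rewrite /tilde_seed_at /= tform_lshift.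
move=> /intrP[m mE]; suff -> : base_coef i k = m * weight k by apply: dvdz_mull.
apply: (@intr_inj rat); rewrite intrM base_coefE weightE -mE.
by field; rewrite dd_neq0.
Qed.

Local Notation word w := (map val (w : vertex G)).

Lemma word_unfrozen (w : vertex G) : all unfrozen (word w).
Proof. by apply/allP => _ /mapP[k _ ->]; apply: (valP k). Qed.

Local Notation cv w := (cvec weight base_form (word w)).
Local Notation rn w := (run weight base_form (word w)).
Local Notation te w := (tilde_seed_at s w).

(** Mutation of the first half of the seed is the map [refl 1] on unit vectors; for [i = l] the
    coefficient [0 - 2] produces the opposite vector. *)
Lemma mutation_lshift (w : vertex G) (l : {k | k \in Iuf G}) i :
    (forall i j, tform (te w (lshift n i)) (te w (lshift n j)) * scale%:R
       = (rn w (unitv i) (unitv j))%:~R) ->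
  mutation (val l) (te w) (lshift n i) = te w (lshift n i)
    + (wt (coef weight (rn w) (val l)) 1 (unitv i) - 2 * unitv i 0 (val l))
        *: te w (lshift n (val l)).
Proof.
move=> H; have sf := seed_form_run weight_gt0 seed_form_base (word_unfrozen w).
have cE := coefE _ sf (valP l).
rewrite /mutation (inj_eq (@lshift_inj _ _)) wt_unitv mul1r unitvE.
case: (eqVneq i (val l)) => [->|il].
  have -> : coef weight (rn w) (val l) (unitv (val l)) = 0.
    apply: (mulfI (lt0r_neq0 (weight_gt0 (val l)))); rewrite -cE mulr0.
    by apply: formxx; case: sf.
  by rewrite maxxx mulr1 sub0r scaleNr scaler_nat mulr2n opprD addrA subrr sub0r.
rewrite mulr0 subr0; congr (_ + _ *: _).
set t := tform _ _; set a := coef _ _ _ _.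
have -> : t * (dd G (val l))%:R = a%:~R.
  have := H i (val l); rewrite cE intrM weightE -/t -/a => e.
  apply: (mulIf scale_neq0); rewrite mulrAC e; field; exact: dd_neq0.
by rewrite intr_max0 intrKfloor.
Qed.

(** By skew symmetry the bracket of vector [n + j] with vector [l] is minus an entry of the c-vector
    of [l], up to multipliers; its positive part thus becomes [negpart]. *)
Lemma mutation_rshift (w : vertex G) (l : {k | k \in Iuf G}) j :
    (forall i j, tform (te w (lshift n i)) (te w (rshift n j)) * (dd G j)%:R
       = (cv w i 0 j)%:~R) ->
  exists2 b : int, mutation (val l) (te w) (rshift n j)
      = te w (rshift n j) + b *: te w (lshift n (val l))
    & b%:~R * (dd G j)%:R = (negpart (cv w (val l)) 0 j)%:~R * (dd G (val l))%:R :> rat.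
Proof.
move=> H; rewrite /mutation eq_rlshift.
set t := tform _ _ * _; exists (Num.floor (Num.max t 0)) => //.
have tI : t \is a Num.int by apply: tilde_form_int; apply: (valP l).
have -> : (Num.floor (Num.max t 0))%:~R = Num.max t 0.
  by apply: floorK; case: lerP; rewrite ?rpred0.
have tE : t * (dd G j)%:R = (- cv w (val l) 0 j)%:~R * (dd G (val l))%:R.
  by rewrite rmorphN /= -H /t tform_skew; ring.
have d0 : 0 < (dd G j)%:R :> rat by rewrite ltr0n dd_gt0.
have d1 : 0 < (dd G (val l))%:R :> rat by rewrite ltr0n dd_gt0.
have -> : Num.max t 0 = Num.max (t * (dd G j)%:R) 0 / (dd G j)%:R.
  by rewrite maxr_pMl ?invr_ge0 ?ltW // mul0r mulfK // lt0r_neq0.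
rewrite divfK ?lt0r_neq0 // tE mxE -intr_max0 maxr_pMl ?mul0r //; exact: ltW.
Qed.

(** Both blocks are followed together: the bracket of vector [i] with the correction to vector
    [n + j] is the exchange coefficient times [negpart], the last term of [cstep]. *)
Lemma tilde_seed_cvec (w : vertex G) :
  (forall i j, tform (te w (lshift n i)) (te w (lshift n j)) * scale%:R
     = (rn w (unitv i) (unitv j))%:~R) /\
  (forall i j, tform (te w (lshift n i)) (te w (rshift n j)) * (dd G j)%:R
     = (cv w i 0 j)%:~R).
Proof.
elim/last_ind: w => [|w l [IH1 IH2]].
  split=> i j; first by rewrite tform_lshift [run _ _ _]/= base_form_unitv base_coefE
    mulrC.
  rewrite tform_rshift /cvec /= unitvE; case: (eqVneq i j) => [->|ij].
    by rewrite pairing_seed eqxx.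
  have := pairing_seed s j i; rewrite [j == i]eq_sym (negPf ij) => /eqP;
    rewrite mulf_eq0.
  by rewrite (negPf (dd_neq0 i)) orbF => /eqP ->; rewrite mul0r.
have sf := seed_form_run weight_gt0 seed_form_base (word_unfrozen w).
have sR : skew_form (rn w) by case: sf.
have teE : te (rcons w l) = mutation (val l) (te w).
  by rewrite /tilde_seed_at foldl_rcons.
have m1 i := mutation_lshift l i IH1.
split=> i j.
  rewrite map_rcons run_rcons teE !m1 tform_lin !tform_linr tformxx.
  rewrite /step /mutform /refl !formDl // !formDr // !formZl // !formZr // formxx //.
  by rewrite !mulr0 !addr0 !intrD !intrM -!IH1; ring.
have [b bE bj] := mutation_rshift l j IH2.
rewrite map_rcons teE bE m1 tform_lin !tform_linr tformxx mulr0 addr0.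
set ci := wt _ _ _ - _; set til := tform _ (te w (lshift n (val l))).
have -> : (tform (te w (lshift n i)) (te w (rshift n j)) + b%:~R * til
   + ci%:~R * tform (te w (lshift n (val l))) (te w (rshift n j))) * (dd G j)%:R
  = (cv w i 0 j)%:~R + ci%:~R * (cv w (val l) 0 j)%:~R + til * (b%:~R * (dd G j)%:R).
  by rewrite -!IH2; ring.
rewrite bj.
have cE := coefE _ sf (valP l).
have tE : til * (dd G (val l))%:R = (coef weight (rn w) (val l) (unitv i))%:~R.
  have := IH1 i (val l); rewrite cE intrM weightE -/til => e.
  apply: (mulIf scale_neq0); rewrite mulrAC e; field; exact: dd_neq0.
rewrite [til * _]mulrCA tE /cvec cvecs_rcons -/(cv w) /cstep -!intrM -!intrD.
congr (_%:~R); rewrite /ci wt_unitv mul1r unitvE.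
case: (eqVneq i (val l)) => [->|il]; last by rewrite !mxE mulr0 subr0; ring.
have -> : coef weight (rn w) (val l) (unitv (val l)) = 0.
  apply: (mulfI (lt0r_neq0 (weight_gt0 (val l)))); rewrite -cE mulr0.
  exact: formxx.
by rewrite maxxx !mxE mulr0 addr0 mulr1; ring.
Qed.

End ExchangeMatrix.

Theorem corollary5p5 (n : nat) (G : fixed_data n) (s : seed G) (w : vertex G)
    (k : 'I_n) :
  (forall j : 'I_(n + n), (n <= j)%N -> exchange_matrix s w k j <= 0) \/
  (forall j : 'I_(n + n), (n <= j)%N -> 0 <= exchange_matrix s w k j).
Proof.
have [_ cE] := tilde_seed_cvec s w.
have [e eP /vposP ev] := cvec_sign_coherent (@weight_gt0 n G s) k
  (seed_form_base s) (word_unfrozen w).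
have xE (j : 'I_(n + n)) : (n <= j)%N -> exists j', exchange_matrix s w k j
    = (cvec (weight s) (base_form s) (map val w) k 0 j')%:~R.
  case: (split_ordP j) => j' -> nj; first by have := ltn_ord j'; rewrite ltnNge nj.
  by exists j'; rewrite mxE (unsplitK (inr _ : 'I_n + 'I_n)%type) cE.
case: eP ev => -> ev; [right|left] => j /xE[j' ->].
  by rewrite ler0z; have := ev j'; rewrite mxE mul1r.
by rewrite lerz0; have := ev j'; rewrite mxE mulN1r oppr_ge0.
Qed.
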